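(* Let $\mathbb{H}$ be a separable real Hilbert space and $A:\mathbb{H}\rightrightarrows\mathbb{H}$ a maximal monotone operator with $\mathrm{Int}(\mathrm{D}(A))\neq\emptyset$. Let $m,m^{\varepsilon}\in\mathbb{D}(\mathbb{R}^{+},\mathbb{H})$, $\varepsilon>0$, with $m_{0}\in\overline{\mathrm{D}(A)}$. Let $x^{\varepsilon}$ be the unique càdlàg solution of $x^{\varepsilon}_{t}+\int_{0}^{t}A_{\varepsilon}(x^{\varepsilon}_{s})\,ds=m^{\varepsilon}_{t}$, $t\ge0$, and let $x$ be the first component of $(x,k)=\mathcal{SP}(A,\Pi_{\overline{\mathrm{D}(A)}};m)$, where $\Pi_{\overline{\mathrm{D}(A)}}$ is the orthogonal projection. If $m^{\varepsilon}\to m$ in $\mathbb{D}(\mathbb{R}^{+},\mathbb{H})$ (Skorokhod topology $J_{1}$) as $\varepsilon\to0$, then: (j) for any $t\in\mathbb{R}^{+}$: $x^{\varepsilon}_{t}\to x_{t}$ as $\varepsilon\to 0$ provided that $\Delta m_{t}=0$; and there exist $C>0$ and $\varepsilon_{0}>0$ such that for all $0<\varepsilon\le\varepsilon_{0}$, $\int_{0}^{t}|A_{\varepsilon}(x^{\varepsilon}_{s})|\,ds\le C<+\infty$; (jj) $(J_{\varepsilon}(x^{\varepsilon}),m^{\varepsilon})\to(x,m)$ in $\mathbb{D}(\mathbb{R}^{+},\mathbb{H}\times\mathbb{H})$ (topology $J_{1}$); (jjj) if $m$ is continuous, then $\sup_{t\in[0,T]}|x^{\varepsilon}_{t}-x_{t}|\to0$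 for every $T\in\mathbb{R}^{+}$.
   Context: $\mathbb{R}^{+}=[0,\infty)$. $\mathrm{D}(A)=\{z\in\mathbb{H}:A(z)\neq\emptyset\}$, $\mathrm{Gr}(A)=\{(z,y):y\in A(z)\}$; $\overline{\mathrm{D}(A)}$ is closed and convex. Yosida approximation: $J_{\varepsilon}(z)=(I+\varepsilon A)^{-1}(z)$ and $A_{\varepsilon}(z)=\frac1\varepsilon(z-J_{\varepsilon}(z))$, single-valued Lipschitz maps on $\mathbb{H}$. $\mathbb{D}(\mathbb{R}^{+},E)$ is the set of càdlàg functions $\mathbb{R}^{+}\to E$; by convention $x_{0-}=x_{0}$, and $\Delta x_{t}=x_{t}-x_{t-}$. $y^{\varepsilon}\to y$ in $\mathbb{D}(\mathbb{R}^{+},E)$ (topology $J_{1}$) means: there exist strictly increasing continuous bijections $\lambda^{\varepsilon}$ of $\mathbb{R}^{+}$ with $\sup_{t\ge0}|\lambda^{\varepsilon}_{t}-t|\to0$ and $\sup_{t\in[0,T]}|y^{\varepsilon}_{\lambda^{\varepsilon}_{t}}-y_{t}|\to0$ for all $T>0$. $\mathrm{BV}_{loc}(\mathbb{R}^{+};\mathbb{H})$ is the set of functions with finite total variation on every $[0,T]$. For a càdlàg $k\in\mathrm{BV}_{loc}(\mathbb{R}^{+};\mathbb{H})$ put $k^{d}_{t}=\sum_{0\le s\le t}\Delta k_{s}$ and $k^{c}=k-k^{d}$. Integrals $\int_{s}^{t}$ with respect to $dk$ are Lebesgue–Stieltjes integrals over $(s,t]$. ''$d\ell_{t}\in A(y_{t})(dt)$''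 means $\int_{s}^{t}\langle y_{r}-\alpha,d\ell_{r}-\beta\,dr\rangle\ge 0$ for all $0\le s\le t$ and all $(\alpha,\beta)\in\mathrm{Gr}(A)$. For $\Pi:\mathbb{H}\to\overline{\mathrm{D}(A)}$ nonexpansive and equal to the identity on $\overline{\mathrm{D}(A)}$ (e.g. $\Pi=\Pi_{\overline{\mathrm{D}(A)}}$), $(x,k)=\mathcal{SP}(A,\Pi;m)$ denotes the unique pair with: $x,k\in\mathbb{D}(\mathbb{R}^{+},\mathbb{H})$; $x_{t}\in\overline{\mathrm{D}(A)}$ for all $t\ge0$; $k\in\mathrm{BV}_{loc}(\mathbb{R}^{+};\mathbb{H})$, $k_{0}=0$; $x_{t}+k_{t}=m_{t}$ for all $t\ge0$; $dk^{c}_{t}\in A(x_{t})(dt)$; and $x_{t}=\Pi(x_{t-}+\Delta m_{t})$ for all $t\ge0$. If $m$ is continuous, this solution is continuous and does not depend on $\Pi$. *)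

(* Defs.v *)
(* Functions on [0, +oo[ are represented by functions on R
   whose values at negative times are never used. *)
From HB Require Import structures.
From mathcomp Require Import all_boot all_order all_algebra sesquilinear.
From mathcomp Require Import all_classical all_reals all_analysis.
From mathcomp.analysis.showcase Require summability.

Set Implicit Arguments.
Unset Strict Implicit.
Unset Printing Implicit Defensive.
Import Order.TTheory GRing.Theory Num.Theory.
Import numFieldNormedType.Exports.

Local Open Scope classical_set_scope.
Local Open Scope ring_scope.

(* Together with completeness of [H], this makes [H] a real Hilbert space. *)
Definition induces_norm (R : realType) (H : normedModType R)
    (ip : {dot H for idfun}) : Prop :=
  forall z : H, ip z z = `|z| ^+ 2.

Definition separable (T : topologicalType) : Prop :=
  exists2 S : set T, countable S & dense S.

Section Operators.
Context {R : realType} {H : normedModType R}.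
Variable ip : {dot H for idfun}.
Implicit Types (A B : H -> set H) (z : H).

Definition dom A : set H := [set z | A z !=set0].

Definition graph A : set (H * H) := [set p | A p.1 p.2].

Definition monotone A : Prop :=
  forall z1 y1 z2 y2, A z1 y1 -> A z2 y2 -> 0 <= ip (z1 - z2) (y1 - y2).

Definition maximal_monotone A : Prop :=
  monotone A /\
  forall B, monotone B -> graph A `<=` graph B -> graph B = graph A.

(* For [A] maximal monotone and [0 < eps], the set below is a singleton. *)
Definition resolvent A (eps : R) z : H :=
  xget 0 [set y | exists2 a, A y a & y + eps *: a = z].

Definition yosida A (eps : R) z : H := eps^-1 *: (z - resolvent A eps z).

(* The point of [K] nearest to [z], when it exists and is unique. *)
Definition projection (K : set H) z : H :=
  xget 0 [set p | K p /\ forall q, K q -> `|z - p| <= `|z - q|].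

End Operators.

Section Paths.
Context {R : realType} {E : normedModType R}.
Implicit Types (f k : R -> E).

Definition cadlag f : Prop :=
  (forall t, 0 <= t -> f s @[s --> t^'+] --> f t) /\
  (forall t, 0 < t -> cvg (f s @[s --> t^'-])).

Definition leftlim f (t : R) : E :=
  if 0 < t then lim (f s @[s --> t^'-]) else f t.

Definition jump f (t : R) : E := f t - leftlim f t.

(* The library's [total_variation] only covers real-valued functions. *)
Definition vtotal_variation (a b : R) f : \bar R :=
  ereal_sup [set (let F := f \o nth b (a :: s) in
                  \sum_(0 <= n < size s) `|F n.+1 - F n|)%:E
            | s in itv_partition a b].

Definition BVloc k : Prop :=
  forall T : R, 0 <= T -> (vtotal_variation 0 T k < +oo)%E.

(* Unconditional sum over [0, t], as the limit over finite sets of times. *)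
Definition discontinuous_part k (t : R) : E :=
  summability.sum (patch (fun=> 0) `[0, t] (jump k)).

Definition continuous_part k (t : R) : E := k t - discontinuous_part k t.

Definition time_change (lam : R -> R) : Prop :=
  [/\ set_bij `[0, +oo[ `[0, +oo[ lam,
      {in `[0, +oo[ &, {homo lam : s t / s < t}} &
      {within `[0, +oo[, continuous lam}].

(* J1 convergence of a family indexed by [eps > 0], as [eps] tends to [0]. *)
Definition skorokhod_cvg (y : R -> R -> E) (y0 : R -> E) : Prop :=
  [/\ forall eps, 0 < eps -> cadlag (y eps), cadlag y0 &
   exists lam : R -> R -> R,
   [/\ forall eps, 0 < eps -> time_change (lam eps),
       ereal_sup [set (`|lam eps t - t|)%:E | t in `[0, +oo[]
         @[eps --> 0^'+] --> 0%E &
       forall T : R, 0 < T ->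
         ereal_sup [set (`|y eps (lam eps t) - y0 t|)%:E | t in `[0, T]]
           @[eps --> 0^'+] --> 0%E]].

End Paths.

Section Bochner.
Context d (T : measurableType d) {R : realType} {E : normedModType R}.
Variable mu : {measure set T -> \bar R}.
Implicit Types (D : set T) (f s : T -> E).

Definition simple_integrable D s : Prop :=
  [/\ finite_set (range s),
      forall y, measurable (s @^-1` [set y]) &
      forall y, y != 0 -> (mu (D `&` s @^-1` [set y]) < +oo)%E].

Definition simple_integral D s : E :=
  \sum_(y \in range s) fine (mu (D `&` s @^-1` [set y])) *: y.

(* [f] is Bochner integrable on [D], with integral [v]. *)
Definition is_bochner_integral D f (v : E) : Prop :=
  exists s_ : nat -> T -> E,
  [/\ forall n, simple_integrable D (s_ n),
      forall n, mu.-integrable D (EFin \o (fun r => `|f r - s_ n r|)),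
      (\int[mu]_(r in D) `|f r - s_ n r|%:E)%E @[n --> \oo] --> 0%E &
      simple_integral D (s_ n) @[n --> \oo] --> v].

End Bochner.

Section Skorokhod.
Context {R : realType} {H : normedModType R}.
Variable ip : {dot H for idfun}.
Implicit Types (A : H -> set H) (f g l m x y k : R -> H).

(* The integral of <f, dg> over ]s, t] exists and equals [v]. It is taken
   through the polar decomposition dg = h |dg|: the measure |dg| on ]s, t] is
   the Lebesgue-Stieltjes measure of a primitive [V] of the variation of [g],
   [h] is the density of dg with respect to it, and the integral of <f, dg>
   is that of <f, h> with respect to |dg|. *)
Definition is_LS_integral f g (s t v : R) : Prop :=
  exists (V : cumulative R R) (h : R -> H),
  [/\ forall a b, s <= a -> a <= b -> b <= t ->
        (V b - V a)%:E = vtotal_variation a b g,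
      forall a b, s <= a -> a <= b -> b <= t ->
        is_bochner_integral (lebesgue_stieltjes_measure V) `]a, b]
          h (g b - g a),
      (lebesgue_stieltjes_measure V).-integrable `]s, t]
        (EFin \o (fun r => ip (f r) (h r))) &
      \int[lebesgue_stieltjes_measure V]_(r in `]s, t]) ip (f r) (h r) = v].

(* dl_t \in A(y_t)(dt); the integrator dl_r - beta dr is the one associated
   with the function l_r - r beta. *)
Definition differential_inclusion A y l : Prop :=
  forall s t : R, 0 <= s -> s <= t -> forall alpha beta, A alpha beta ->
  exists2 v, is_LS_integral (fun r => y r - alpha) (fun r => l r - r *: beta)
               s t v & 0 <= v.

(* [Pi] is meant to be a nonexpansive map into [closure (dom A)] that is the
   identity there; the pair (x, k) is then unique. *)
Record skorokhod_problem A (Pi : H -> H) m x k : Prop := SkorokhodProblem {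
  sp_cadlag_x : cadlag x ;
  sp_cadlag_k : cadlag k ;
  sp_domain : forall t, 0 <= t -> closure (dom A) (x t) ;
  sp_BV : BVloc k ;
  sp_init : k 0 = 0 ;
  sp_eq : forall t, 0 <= t -> x t + k t = m t ;
  sp_inclusion : differential_inclusion A x (continuous_part k) ;
  sp_jump : forall t, 0 <= t -> x t = Pi (leftlim x t + jump m t) }.

Definition yosida_solution A (eps : R) m x : Prop :=
  cadlag x /\
  forall t, 0 <= t ->
    exists2 v : H,
      is_bochner_integral (@lebesgue_measure R) `[0, t]
        (fun s => yosida A eps (x s)) v &
      x t + v = m t.

End Skorokhod.

(* Main.v *)
Require Import Defs.
From mathcomp Require Import all_boot all_order all_algebra sesquilinear.
From mathcomp Require Import all_classical all_reals all_analysis.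
From mathcomp Require Import measurable_realfun ring lra.
Import Order.TTheory GRing.Theory Num.Theory.
Import numFieldNormedType.Exports.
Local Open Scope classical_set_scope.
Local Open Scope ring_scope.
Set Implicit Arguments.
Unset Strict Implicit.

(* Both x and x^eps are compared with one implicit Euler scheme for the limit
   input m, on a partition of [0, T] on whose intervals m and x oscillate
   little. On each interval the scheme performs a resolvent step and then, at
   the jump of m, a projection with increment n, a normal vector at the new
   position X. The squared distance between the running compensators grows, by
   monotonicity, only by small multiples of their variations; these are bounded
   because A is coercive around an interior point of its domain.
   The penalized solution x^eps is fed the scheme at the times lambda(u_i) of
   the Skorokhod time change; instead of jumping, the reference path relaxes
   from X + n to X on the time scale eps, so that x^eps stays close to X + c n
   with c in [0, 1] and c (s - lambda(u_i)) <= eps. As n is normal at X,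
   J_eps (X + c n) is close to X for every such c, which gives (jj); away from
   jumps n = 0, or c n has already relaxed, which gives (j) and (jjj). *)

(** * Monotone operators and resolvents *)

(** Neither path can be tested directly against the other: along [x] only the measure dk is
    available in place of a slope in [A], and [yosida A eps] along x^eps has no pointwise bound
    uniform in [eps]. The scheme provides what both comparisons need, true graph points ([Z i],
    [be i]): they are admissible test points in the differential inclusion of [x], and they are
    monotone against the pairs (resolvent, Yosida slope) along x^eps. The price is that |be i| is
    out of control when the partition is refined; only the sum of (u i.+1 - u i) |be i| + |n i| has
    a bound [B] independent of the partition. Terms multiplied by [B] must be small through the
    oscillation on the partition intervals, whereas terms multiplied by [W], the sum of |n i| + |be
    i|, are made small through [eps] and the time distortion once the partition is fixed. Hence the
    order of choices: precision, partition, then [eps]. Since paths may jump at the nodes, interval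
    estimates are made on half-open intervals, closed on the left, and end at a left limit. *)

Lemma ler_addeps {R : realType} (a b c : R) : 0 <= c ->
  (forall e, 0 < e -> a <= b + e * c) -> a <= b.
Proof.
move=> c0 h; rewrite leNgt; apply/negP => ba.
have c1 : 0 < c + 1 by lra.
have e0 : 0 < (a - b) / (2 * (c + 1)) by rewrite divr_gt0//; [lra|nra].
have := h _ e0.
have -> : (a - b) / (2 * (c + 1)) * c = (a - b) / 2 * (c / (c + 1)) by field; lra.
have : c / (c + 1) < 1 by rewrite ltr_pdivrMr//; lra.
have : 0 <= c / (c + 1) by rewrite divr_ge0//; lra.
nra.
Qed.

Lemma cauchy_seq_cvg {R : realType} {H : completeNormedModType R} (u : nat -> H) :
  (forall e, 0 < e -> exists N, forall n m, (N <= n)%N -> (N <= m)%N ->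
     `|u n - u m| <= e) ->
  exists l, forall e, 0 < e -> exists N, forall n, (N <= n)%N -> `|u n - l| <= e.
Proof.
move=> h.
have /cauchy_cvgP cu : cauchy (u @ \oo).
  apply/cauchyP => /= e e0.
  have [N hN] := h (e / 2) ltac:(lra).
  exists (u N); exists N => // n /= Nn.
  rewrite -ball_normE /=; apply: le_lt_trans (hN N n _ _) _ => //; lra.
exists (lim (u @ \oo)) => e e0.
have := cu => /cvgrPdist_le /(_ e e0) [N _ hN].
by exists N => n Nn; rewrite distrC; apply: hN.
Qed.

Section Hilbert.
Context {R : realType} {H : normedModType R} {ip : {dot H for idfun}}.
Hypothesis hip : induces_norm ip.
Implicit Types (x y z : H) (a : R).

Lemma ipC x y : ip x y = ip y x.
Proof. by rewrite hermC /= expr0 mul1r. Qed.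
Lemma ipDl x y z : ip (x + y) z = ip x z + ip y z.
Proof. by rewrite linearDl. Qed.
Lemma ipDr x y z : ip z (x + y) = ip z x + ip z y.
Proof. by rewrite linearDr. Qed.
Lemma ipNl x z : ip (- x) z = - ip x z.
Proof. by rewrite linearNl. Qed.
Lemma ipNr x z : ip z (- x) = - ip z x.
Proof. by rewrite linearNr. Qed.
Lemma ipZl a x z : ip (a *: x) z = a * ip x z.
Proof. by rewrite linearZl_LR. Qed.
Lemma ipZr a x z : ip z (a *: x) = a * ip z x.
Proof. by rewrite linearZr_LR. Qed.
Lemma ip0l z : ip 0 z = 0.
Proof. by rewrite linear0l. Qed.
Lemma ip0r z : ip z 0 = 0.
Proof. by rewrite linear0r. Qed.

Definition ipE := (ip0l, ip0r, ipDl, ipDr, ipNl, ipNr, ipZl, ipZr).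

Lemma sqr_norm x : `|x| ^+ 2 = ip x x.
Proof. by rewrite hip. Qed.

Lemma ip_ge0 x : 0 <= ip x x.
Proof. by rewrite hip sqr_ge0. Qed.

Lemma ip_eq0 x : ip x x <= 0 -> x = 0.
Proof.
rewrite hip => x0; apply/normr0_eq0/eqP.
by rewrite -sqrf_eq0 eq_le x0 sqr_ge0.
Qed.

(** Vector identities are reduced throughout to scalar ones by pairing both sides with an arbitrary
    [z], after which [ring] or [lra] applies. *)
Lemma ip_inj x y : (forall z, ip x z = ip y z) -> x = y.
Proof.
move=> xy; apply/subr0_eq/ip_eq0.
by rewrite ipDl ipNl xy subrr.
Qed.

Lemma ip_le x y : ip x y <= `|x| * `|y|.
Proof.
have [->|x0] := eqVneq x 0; first by rewrite ipE normr0 mul0r.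
have [->|y0] := eqVneq y 0; first by rewrite ipE normr0 mulr0.
have nx : 0 < `|x| by rewrite normr_gt0.
have ny : 0 < `|y| by rewrite normr_gt0.
have := ip_ge0 (`|y| *: x - `|x| *: y).
rewrite !ipE (ipC y x) -!sqr_norm.
have := mulr_gt0 nx ny; nra.
Qed.

Lemma ip_ge x y : - (`|x| * `|y|) <= ip x y.
Proof. by have := ip_le (- x) y; rewrite ipE normrN; lra. Qed.

Lemma ip_abs x y : `|ip x y| <= `|x| * `|y|.
Proof. by rewrite ler_norml ip_ge ip_le. Qed.

Lemma norm_le_sqr x a : 0 <= a -> ip x x <= a ^+ 2 -> `|x| <= a.
Proof.
by move=> a0; rewrite -sqr_norm ler_pXn2r ?nnegrE.
Qed.

Lemma ip_le_sqr x a : `|x| <= a -> ip x x <= a ^+ 2.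
Proof.
by move=> xa; rewrite -sqr_norm ler_pXn2r ?nnegrE// (le_trans _ xa).
Qed.

End Hilbert.

Section Monotone.
Context {R : realType} {H : normedModType R} {ip : {dot H for idfun}}.
Hypothesis hip : induces_norm ip.
Implicit Types (A : H -> set H) (x y z : H).

(** Adding the single pair [(x, y)] to the graph keeps it monotone, so maximality forces the pair to
    be there already. *)
Lemma maximal_monotone_mem {A} x y : maximal_monotone ip A ->
  (forall al be, A al be -> 0 <= ip (x - al) (y - be)) -> A x y.
Proof.
move=> [monA maxA] xy.
pose B : H -> set H := fun z => [set w | A z w \/ (z = x /\ w = y)].
have /maxA : Defs.monotone ip B.
  move=> z1 y1 z2 y2 /= [h1|[-> ->]] [h2|[-> ->]].
  - exact: monA.
  - rewrite -(opprB x) -(opprB y) !ipNl !ipNr opprK; exact: xy.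
  - exact: xy.
  - by rewrite !subrr ip0l.
have sAB : graph A `<=` graph B by move=> p /= Ap; left.
move=> /(_ sAB) BA.
have : graph B (x, y) by right.
by rewrite BA.
Qed.

End Monotone.

(** * Minty's theorem by minimization over the Fitzpatrick epigraph *)

Section Minty.
Context {R : realType} {H : completeNormedModType R} {ip : {dot H for idfun}}.
Hypothesis hip : induces_norm ip.
Variable A : H -> set H.
Hypothesis monA : Defs.monotone ip A.
Hypothesis maxA : forall x y,
  (forall al be, A al be -> 0 <= ip (x - al) (y - be)) -> A x y.
Hypothesis A_neq0 : exists x y, A x y.
Implicit Types (x y z al be : H) (c : R).

(* The epigraph of the Fitzpatrick function of [A]. *)
Let G x y c := forall al be, A al be -> ip x be + ip al y - ip al be <= c.

(** If [c < ip x y], the inequalities defining [G] make [(x, y)] monotone against the whole graph,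
    hence a graph point; testing [G] at that very point gives the contradiction. *)
Let G_ge x y c : G x y c -> ip x y <= c.
Proof.
move=> Gxy; rewrite leNgt; apply/negP => cxy.
have /Gxy : A x y.
  apply: maxA => al be /Gxy.
  rewrite !ipE; lra.
lra.
Qed.

Let G_mem x y : A x y -> G x y (ip x y).
Proof. by move=> Axy al be /(monA Axy); rewrite !ipE; lra. Qed.

Let G_convex x y c x' y' c' t : 0 <= t -> t <= 1 -> G x y c -> G x' y' c' ->
  G ((1 - t) *: x + t *: x') ((1 - t) *: y + t *: y') ((1 - t) * c + t * c').
Proof.
move=> t0 t1 g g' al be Aab; rewrite !ipE.
have := g _ _ Aab; have := g' _ _ Aab; nra.
Qed.

(** By [G_ge], [f] dominates half of |x + y|^2 on the epigraph, so its infimum there is finite; the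
    quadratic part makes minimizing sequences converge. *)
Let f x y c := c + (ip x x + ip y y) / 2.

Let f_ge0 x y c : G x y c -> 0 <= f x y c.
Proof.
move=> /G_ge xy; have := ip_ge0 hip (x + y).
by rewrite !ipE (ipC y x) /f; lra.
Qed.

Let minimizer : exists x y c, G x y c /\
  forall x' y' c', G x' y' c' -> f x y c <= f x' y' c'.
Proof.
pose S := [set r | exists x y c, G x y c /\ r = f x y c].
have hS : has_inf S.
  split.
    have [x [y Axy]] := A_neq0.
    by exists (f x y (ip x y)), x, y, (ip x y); split => //; exact: G_mem.
  by exists 0 => _ [x [y [c [g ->]]]]; exact: f_ge0.
pose I := inf S.
have I_le x y c : G x y c -> I <= f x y c.
  by move=> g; apply: ge_inf; [case: hS|exists x, y, c].
have /choice[p hp] : forall n : nat, exists p : H * H * R,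
    G p.1.1 p.1.2 p.2 /\ f p.1.1 p.1.2 p.2 <= I + n.+1%:R^-1.
  move=> n; have n0 : 0 < n.+1%:R^-1 :> R by rewrite invr_gt0.
  have [_ [x [y [c [g ->]]]] le] := inf_adherent n0 hS.
  by exists (x, y, c); split => //=; exact: ltW.
pose X n := (p n).1.1; pose Y n := (p n).1.2; pose C n := (p n).2.
(* Parallelogram identity: the midpoint of two almost minimizers is in the epigraph, so the
   convexity gap, an eighth of the left-hand side, is at most half the sum of the two defects. *)
have key n m : ip (X n - X m) (X n - X m) + ip (Y n - Y m) (Y n - Y m)
    <= 4 * (n.+1%:R^-1 + m.+1%:R^-1).
  have [gn fn] := hp n; have [gm fm] := hp m.
  have := I_le _ _ _ (@G_convex _ _ _ _ _ _ (1/2) ltac:(lra) ltac:(lra) gn gm).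
  move: fn fm; rewrite /f -/(X n) -/(X m) -/(Y n) -/(Y m) -/(C n) -/(C m) !ipE.
  rewrite (ipC (X m) (X n)) (ipC (Y m) (Y n)); move: (n.+1%:R^-1) (m.+1%:R^-1) => a b; lra.
have small e : 0 < e -> exists N, forall n, (N <= n)%N -> n.+1%:R^-1 <= e :> R.
  move=> e0; have /cvgrPdist_le /(_ e e0) [N _ hN] := @cvg_harmonic R.
  exists N => n Nn; have := hN n Nn.
  by rewrite sub0r normrN /harmonic /= ger0_norm ?invr_ge0.
have cau (U : nat -> H) : (forall n m, ip (U n - U m) (U n - U m)
    <= 4 * (n.+1%:R^-1 + m.+1%:R^-1)) ->
    exists l, forall e, 0 < e -> exists N, forall n, (N <= n)%N -> `|U n - l| <= e.
  move=> hU; apply: cauchy_seq_cvg => e e0.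
  have [|N hN] := small (e ^+ 2 / 8); first by rewrite divr_gt0// exprn_gt0.
  exists N => n m Nn Nm; apply: (norm_le_sqr hip); first exact: ltW.
  apply: le_trans (hU n m) _.
  have := hN n Nn; have := hN m Nm.
  by move: (n.+1%:R^-1) (m.+1%:R^-1) => a b; lra.
have [x0 hx0] : exists l, forall e, 0 < e -> exists N, forall n, (N <= n)%N -> `|X n - l| <= e.
  by apply: cau => n m; apply: le_trans (key n m); rewrite lerDl ip_ge0.
have [y0 hy0] : exists l, forall e, 0 < e -> exists N, forall n, (N <= n)%N -> `|Y n - l| <= e.
  by apply: cau => n m; apply: le_trans (key n m); rewrite lerDr ip_ge0.
(* The third coordinate is the one that gives [f] the value [I]; membership in the epigraph follows
   by passing to the limit in each inequality defining [G]. *)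
exists x0, y0, (I - (ip x0 x0 + ip y0 y0) / 2); split; last first.
  by move=> x y c /I_le h; apply: le_trans h; rewrite /f subrK.
move=> al be Aab.
suff : ip x0 be + ip al y0 - ip al be + (ip x0 x0 + ip y0 y0) / 2 <= I by lra.
apply: (@ler_addeps _ _ _ (1 + (`|be| + `|x0|) + (`|al| + `|y0|))).
  by rewrite !addr_ge0.
move=> e e0.
have [N1 h1] := hx0 e e0; have [N2 h2] := hy0 e e0; have [N3 h3] := small e e0.
pose n := maxn N1 (maxn N2 N3).
have {}h1 : `|X n - x0| <= e by apply: h1; rewrite leq_maxl.
have {}h2 : `|Y n - y0| <= e by apply: h2; rewrite /n maxnCA leq_maxl.
have {}h3 : n.+1%:R^-1 <= e by apply: h3; rewrite /n maxnA leq_maxr.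
have [gn fn] := hp n.
have := gn _ _ Aab; move: fn.
rewrite -/(X n) -/(Y n) -/(C n) /f.
have a1 := ip_le hip (x0 - X n) be; have a2 := ip_le hip al (y0 - Y n).
have a3 := ip_le hip x0 (x0 - X n); have a4 := ip_le hip y0 (y0 - Y n).
have a5 := ip_ge0 hip (x0 - X n); have a6 := ip_ge0 hip (y0 - Y n).
rewrite distrC in h1; rewrite distrC in h2.
have b1 := ler_wpM2r (normr_ge0 be) h1; have b2 := ler_wpM2l (normr_ge0 al) h2.
have b3 := ler_wpM2l (normr_ge0 x0) h1; have b4 := ler_wpM2l (normr_ge0 y0) h2.
move: a1 a2 a3 a4 a5 a6; rewrite !ipE (ipC (X n) x0) (ipC (Y n) y0).
by move: (n.+1%:R^-1) h3 => r; lra.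
Qed.

(* By minimality the minimizer [(x0, y0)] of the strongly convex functional
   [f] over the epigraph satisfies [A (- y0) (- x0)], and then [x0 = - y0]. *)
Lemma minty_opp : exists x, A x (- x).
Proof.
have [x0 [y0 [c0 [g0 min0]]]] := minimizer.
(* First variation of [f] at the minimizer towards a graph point: the segment stays in the epigraph,
   and letting [t] tend to 0 removes the quadratic remainder. *)
have key al be : A al be ->
    ip x0 x0 + ip y0 y0 + c0 <= ip al be + ip x0 al + ip y0 be.
  move=> Aab.
  pose D := ip (al - x0) (al - x0) + ip (be - y0) (be - y0).
  have D0 : 0 <= D by rewrite addr_ge0 ?ip_ge0.
  have h t : 0 < t -> t <= 1 ->
      0 <= ip al be + ip x0 al + ip y0 be - (ip x0 x0 + ip y0 y0 + c0) + t * (D / 2).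
    move=> t0 t1.
    have := min0 _ _ _ (G_convex (ltW t0) t1 g0 (G_mem Aab)).
    rewrite /f /D !ipE (ipC al x0) (ipC be y0) => E.
    rewrite -(pmulr_rge0 _ t0); move: E; nra.
  apply: (@ler_addeps _ _ _ (D / 2)); first lra.
  move=> e e0.
  have : 0 < Num.min e 1 by rewrite lt_min e0 ltr01.
  have : Num.min e 1 <= 1 by rewrite ge_min lexx orbT.
  have : Num.min e 1 <= e by rewrite ge_min lexx.
  move: (Num.min e 1) => t te t1 t0.
  have := h _ t0 t1; nra.
have c0_ge := G_ge g0.
(* By [key] and [c0_ge], the pairing of - y0 - al with - x0 - be is at least |x0 + y0|^2. *)
have A0 : A (- y0) (- x0).
  apply: maxA => al be Aab; have := key _ _ Aab.
  have := ip_ge0 hip (x0 + y0).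
  rewrite !ipE (ipC y0 x0) (ipC al x0); lra.
have e0 : x0 = - y0.
  apply/eqP; rewrite -addr_eq0; apply/eqP/(ip_eq0 hip).
  have := key _ _ A0; rewrite !ipE (ipC y0 x0); lra.
by exists x0; rewrite {1}e0.
Qed.

End Minty.

Section Resolvent.
Context {R : realType} {H : completeNormedModType R} {ip : {dot H for idfun}}.
Hypothesis hip : induces_norm ip.
Context {A : H -> set H}.
Hypothesis hA : maximal_monotone ip A.
Hypothesis A_neq0 : dom A !=set0.
Implicit Types (x y z al be : H) (e : R).
Let monA := hA.1.

(** [minty_opp] is applied to the operator [e A - z], still monotone and maximal: a point [x] whose
    image contains [- x] solves the equation. *)
Lemma minty e z : 0 < e -> exists y a, A y a /\ y + e *: a = z.
Proof.
move=> e0.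
have [] := @minty_opp _ _ _ hip (fun y => [set b | exists2 a, A y a & b = e *: a - z]).
- move=> z1 y1 z2 y2 [a1 h1 ->] [a2 h2 ->].
  have := monA h1 h2; rewrite !ipE -(pmulr_rge0 _ e0); lra.
- move=> x y h; exists (e^-1 *: (y + z)); last first.
    by rewrite scalerA divff ?gt_eqF// scale1r addrK.
  apply: (maximal_monotone_mem hA) => al be Aab.
  have := h al (e *: be - z) ltac:(by exists be).
  have -> : ip (x - al) (e^-1 *: (y + z) - be) =
      e^-1 * ip (x - al) (y - (e *: be - z)).
    by rewrite !ipE; field; rewrite gt_eqF.
  by apply: mulr_ge0; rewrite invr_ge0 ltW.
- have [y [a Aya]] := A_neq0.
  by exists y, (e *: a - z), a.
move=> x [a Axa h]; exists x, a; split => //.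
by rewrite -[x]opprK h opprB subrK.
Qed.

Lemma resolvent_yosida e z : 0 < e ->
  A (resolvent A e z) (yosida A e z) /\ resolvent A e z + e *: yosida A e z = z.
Proof.
move=> e0; rewrite /yosida /resolvent; case: xgetP.
  move=> y _ [a Aya <-].
  have -> : y + e *: a - y = e *: a by rewrite addrAC subrr add0r.
  by rewrite scalerA mulVf ?gt_eqF// scale1r.
move=> h; have [y [a [Aya yz]]] := minty z e0.
by have := h y; case; exists a.
Qed.

Lemma yosida_mem e z : 0 < e -> A (resolvent A e z) (yosida A e z).
Proof. by move=> /(resolvent_yosida z)[]. Qed.

Lemma resolventE e z : 0 < e -> resolvent A e z + e *: yosida A e z = z.
Proof. by move=> /(resolvent_yosida z)[]. Qed.

Lemma resolvent_dom e z : 0 < e -> dom A (resolvent A e z).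
Proof. by move=> /yosida_mem; exists (yosida A e z). Qed.

Lemma resolvent_nonexp e z z' : 0 < e ->
  `|resolvent A e z - resolvent A e z'| <= `|z - z'|.
Proof.
move=> e0; have := monA (yosida_mem z e0) (yosida_mem z' e0).
have E : z - z' = (resolvent A e z - resolvent A e z') +
    e *: (yosida A e z - yosida A e z').
  apply: (ip_inj hip) => w.
  by rewrite -{1}(resolventE z e0) -{1}(resolventE z' e0) !ipE; ring.
move: E; move: (resolvent A e z - _) (yosida A e z - _) => w c -> h.
apply: (norm_le_sqr hip) => //; rewrite (sqr_norm hip).
rewrite !ipE (ipC c w).
have := ip_ge0 hip c; nra.
Qed.

Lemma yosida_lip e z z' : 0 < e ->
  `|yosida A e z - yosida A e z'| <= 2 / e * `|z - z'|.
Proof.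
move=> e0; rewrite /yosida -scalerBr normrZ gtr0_norm ?invr_gt0// (mulrC 2) -mulrA.
apply: ler_wpM2l; first by rewrite invr_ge0 ltW.
have := resolvent_nonexp z z' e0.
move: (resolvent A e z) (resolvent A e z') => u v uv.
have -> : z - u - (z' - v) = (z - z') - (u - v) by apply: (ip_inj hip) => w; rewrite !ipE; ring.
apply: le_trans (ler_normB _ _) _; lra.
Qed.

End Resolvent.

Lemma closure_norm {R : realType} {H : normedModType R} (K : set H) z :
  closure K z <-> forall d : R, 0 < d -> exists2 q, K q & `|z - q| <= d.
Proof.
split => [h d d0|h B].
  have /h[q [Kq]] : nbhs z (ball z d) by exact: nbhsx_ballx.
  by rewrite -ball_normE /= => /ltW zq; exists q.
move=> /nbhs_ballP[d /= d0 dB].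
have d20 : 0 < d / 2 by lra.
have [q Kq zq] := h _ d20; exists q; split => //; apply: dB.
by rewrite -ball_normE /=; apply: le_lt_trans zq _; lra.
Qed.

(** * Resolvents for vanishing parameter, projection and coercivity *)

Section Projection.
Context {R : realType} {H : completeNormedModType R} {ip : {dot H for idfun}}.
Hypothesis hip : induces_norm ip.
Context {A : H -> set H}.
Hypothesis hA : maximal_monotone ip A.
Hypothesis A_neq0 : dom A !=set0.
Implicit Types (x y z q : H) (e d : R).
Let monA := hA.1.

(** Monotonicity between the two resolvent points gives [0 <= ip w (w' - w)] for the displacements
    [w] and [w']; the claim is the expansion of |w'|^2 around [w]. It makes the length of the
    displacement monotone in the parameter and turns convergence of lengths into convergence of
    resolvents. *)
Lemma resolvent_dist e d z : 0 < e -> e <= d ->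
  ip (z - resolvent A d z - (z - resolvent A e z))
     (z - resolvent A d z - (z - resolvent A e z)) <=
  ip (z - resolvent A d z) (z - resolvent A d z) -
  ip (z - resolvent A e z) (z - resolvent A e z).
Proof.
move=> e0; rewrite le_eqVlt => /predU1P[->|ed].
  by rewrite !subrr ip0l.
set w' := z - resolvent A d z; set w := z - resolvent A e z.
have d0 : 0 < d by exact: lt_trans ed.
have := monA (yosida_mem hip hA A_neq0 z e0) (yosida_mem hip hA A_neq0 z d0).
rewrite /yosida -/w -/w'.
have -> : resolvent A e z - resolvent A d z = w' - w.
  by apply: (ip_inj hip) => u; rewrite /w /w' !ipE; ring.
clearbody w w'; rewrite !ipE (ipC w' w) => h.
suff : 0 <= ip w w' - ip w w by lra.
have wd : (e^-1 + d^-1) * ip w w' >= e^-1 * ip w w + d^-1 * ip w' w' by lra.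
have ie : 0 < e^-1 by rewrite invr_gt0.
have id : 0 < d^-1 by rewrite invr_gt0.
have di : d^-1 < e^-1 by rewrite ltf_pV2.
have := ip_ge0 hip (w' - w); rewrite !ipE (ipC w' w) => h2.
move: (e^-1) (d^-1) ie id di wd h2 {h} => a b.
move: (ip w w') (ip w w) (ip w' w') => p s t a0 b0 ab wd h2.
rewrite -subr_gt0 in ab; rewrite -(pmulr_rge0 _ ab); nra.
Qed.

(** The squared displacements [W e] shrink with [e] and are bounded below, so [resolvent_dist] makes
    the resolvents Cauchy. The variational inequality is the limit of monotonicity against a graph
    point [(q, y)]; it will identify the limit with the projection. *)
Lemma resolvent_limit z : exists p, [/\ closure (dom A) p,
  forall q, closure (dom A) q -> 0 <= ip (z - p) (p - q) &
  forall g, 0 < g -> exists2 e0, 0 < e0 &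
    forall e, 0 < e -> e <= e0 -> `|resolvent A e z - p| <= g].
Proof.
pose J e := resolvent A e z.
pose W e := ip (z - J e) (z - J e).
have Wmon e d : 0 < e -> e <= d -> W e <= W d.
  move=> e0 ed; have /= := resolvent_dist z e0 ed.
  have := ip_ge0 hip (z - resolvent A d z - (z - resolvent A e z)).
  rewrite /W /J; lra.
pose S := [set W e | e in [set e : R | 0 < e]].
have hS : has_inf S.
  split; first by exists (W 1), 1 => //=.
  by exists 0 => _ [e e0 <-]; exact: ip_ge0.
have W_ge e : 0 < e -> inf S <= W e by move=> e0; apply: ge_inf; [case: hS|exists e].
have near g : 0 < g -> exists2 e0, 0 < e0 & forall e d, 0 < e -> e <= d -> d <= e0 ->
    `|J e - J d| <= g.
  move=> g0; have [|_ [e0 /= e00 <-] le] := @inf_adherent _ S (g ^+ 2) _ hS.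
    exact: exprn_gt0.
  exists e0 => // e d e1 ed de0; apply: (norm_le_sqr hip); first exact: ltW.
  have /= := resolvent_dist z e1 ed.
  have -> : z - resolvent A d z - (z - resolvent A e z) = J e - J d.
    by apply: (ip_inj hip) => u; rewrite /J !ipE; ring.
  move=> /le_trans; apply.
  have := W_ge _ e1; have := Wmon _ _ (lt_le_trans e1 ed) de0.
  move: le; rewrite -/(J d) -/(J e) -/(W d) -/(W e); lra.
have small e : 0 < e -> exists N, forall n, (N <= n)%N -> n.+1%:R^-1 <= e :> R.
  move=> e0; have /cvgrPdist_le /(_ e e0) [N _ hN] := @cvg_harmonic R.
  exists N => n Nn; have := hN n Nn.
  by rewrite sub0r normrN /harmonic /= ger0_norm ?invr_ge0.
have near2 g : 0 < g -> exists2 e0, 0 < e0 & forall e d, 0 < e -> 0 < d -> e <= e0 ->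
    d <= e0 -> `|J e - J d| <= g.
  move=> /near[e0 e00 h]; exists e0 => // e d e1 d1 ee de.
  case: (leP e d) => [ed|/ltW de']; first exact: h.
  by rewrite distrC; apply: h.
have [p hp] : exists l, forall e, 0 < e -> exists N, forall n, (N <= n)%N ->
    `|J (n.+1%:R^-1) - l| <= e.
  apply: cauchy_seq_cvg => g /near2[e0 e00 h].
  have [N hN] := small _ e00.
  by exists N => n m Nn Nm; apply: h; rewrite ?invr_gt0//; exact: hN.
have Jp g : 0 < g -> exists2 e0, 0 < e0 &
    forall e, 0 < e -> e <= e0 -> `|J e - p| <= g.
  move=> g0; have [|e0 e00 h] := near2 (g / 2); first lra.
  exists e0 => // e e1 ee0.
  have [|N1 h1] := hp (g / 2); first lra.
  have [N2 h2] := small _ e00.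
  have := h1 _ (leq_maxl N1 N2); have := h2 _ (leq_maxr N1 N2).
  set r := _ ^-1 => re rp.
  have := h e r e1 _ ee0 re; rewrite /r invr_gt0 => /(_ (ltr0Sn _ _)) er.
  apply: le_trans (ler_distD (J r) _ _) _; lra.
exists p; split => //.
  apply/closure_norm => d /Jp[e e0 /(_ e e0 (lexx _)) h].
  by exists (J e); [exact: resolvent_dom|rewrite distrC].
suff main q : dom A q -> 0 <= ip (z - p) (p - q).
  move=> q /closure_norm hq.
  apply: (@ler_addeps _ _ _ (`|z - p|)) => // d /hq[q' /main h qq'].
  have := ip_ge hip (z - p) (q' - q).
  rewrite distrC in qq'; have := ler_wpM2l (normr_ge0 (z - p)) qq'.
  move: h; have -> : p - q = (p - q') + (q' - q) by rewrite addrA subrK.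
  by rewrite ipDr; lra.
move=> [y Aqy].
apply: (@ler_addeps _ _ _ (`|p - q| + `|z - p| + 1 + `|y| * (`|p - q| + 1))).
  by rewrite !addr_ge0// mulr_ge0// addr_ge0.
move=> g g0.
have : 0 < Num.min g 1 by rewrite lt_min g0 ltr01.
have g'1 : Num.min g 1 <= 1 by rewrite ge_min lexx orbT.
have : Num.min g 1 <= g by rewrite ge_min lexx.
move: (Num.min g 1) g'1 => g' g'1 g'g g'0.
have [e0 e00 he] := Jp g' g'0.
have : 0 < Num.min g e0 by rewrite lt_min g0 e00.
have : Num.min g e0 <= e0 by rewrite ge_min lexx orbT.
have : Num.min g e0 <= g by rewrite ge_min lexx.
move: (Num.min g e0) => e eg ee0 e1.
have := monA (yosida_mem hip hA A_neq0 z e1) Aqy.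
rewrite -/(J e) /yosida -/(J e) => h.
(* Multiplying monotonicity by [e] leaves the slope [y] with a factor [e], so that it disappears in
   the limit. *)
have {}h : - (e * `|y| * `|J e - q|) <= ip (z - J e) (J e - q).
  have := ip_ge hip (J e - q) y.
  move: h; rewrite ipDr ipNr ipZr (ipC (z - _)) => h1 h2.
  have : 0 <= e * (e^-1 * ip (J e - q) (z - J e) - ip (J e - q) y).
    by rewrite mulr_ge0// ltW.
  rewrite mulrBr mulrA divff ?gt_eqF// mul1r.
  have := ler_wpM2l (ltW e1) h2; nra.
have Jpe := he e e1 ee0.
have Jq : `|J e - q| <= `|p - q| + g'.
  by apply: le_trans (ler_distD p _ _) _; lra.
have E : ip (z - J e) (J e - q) =
    ip (z - p) (p - q) - ip (J e - p) (p - q) + ip (z - p) (J e - p)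
    - ip (J e - p) (J e - p) by rewrite !ipE; ring.
have e1' := ip_ge hip (J e - p) (p - q).
have e2' := ip_le hip (z - p) (J e - p).
have e3' := ip_ge0 hip (J e - p).
have f1 := ler_wpM2r (normr_ge0 (p - q)) Jpe.
have f2 := ler_wpM2l (normr_ge0 (z - p)) Jpe.
have f3 : g' * (`|p - q| + `|z - p|) <= g * (`|p - q| + `|z - p|).
  by rewrite ler_wpM2r// addr_ge0.
have f4 : e * `|y| * `|J e - q| <= g * (`|y| * (`|p - q| + 1)).
  rewrite -mulrA ler_pM ?mulr_ge0// ?(ltW e1)//.
  by rewrite ler_wpM2l//; lra.
lra.
Qed.

Lemma projectionP z : [/\ closure (dom A) (projection (closure (dom A)) z),
  forall q, closure (dom A) q ->
    0 <= ip (z - projection (closure (dom A)) z) (projection (closure (dom A)) z - q) &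
  forall g, 0 < g -> exists2 e0, 0 < e0 & forall e, 0 < e -> e <= e0 ->
    `|resolvent A e z - projection (closure (dom A)) z| <= g].
Proof.
have [p [Kp varp limp]] := resolvent_limit z.
suff -> : projection (closure (dom A)) z = p by [].
rewrite /projection; case: xgetP => [p' _ [Kp' minp']|].
  have := minp' p Kp.
  have := varp _ Kp' => h1 h2.
  apply/eqP; rewrite -subr_eq0; apply/eqP/(ip_eq0 hip).
  have : ip (z - p') (z - p') <= ip (z - p) (z - p).
    by rewrite -!(sqr_norm hip) ler_pXn2r ?nnegrE.
  move: h1; rewrite !ipE (ipC p' p) (ipC p z) (ipC p' z); lra.
move=> /(_ p)[]; split => // q Kq.
have := varp q Kq => h; apply: (norm_le_sqr hip) => //; rewrite (sqr_norm hip).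
have := ip_ge0 hip (p - q).
move: h; rewrite !ipE (ipC q p) (ipC p z) (ipC q z); lra.
Qed.

Lemma projection_id z : closure (dom A) z -> projection (closure (dom A)) z = z.
Proof.
have [_ + _] := projectionP z => var /var h.
apply/eqP; rewrite -subr_eq0; apply/eqP/(ip_eq0 hip).
by move: h; set p := projection _ _; rewrite !ipE (ipC p z); lra.
Qed.

(** All points of the normal ray project onto [z]; uniformity in [c] comes from monotonicity against
    one graph point [(al, be)] within [d] of [z]. The distance s to [z] then satisfies s^2 <= 2 d s
    + d (|n| + d) once e |be| <= d. *)
Lemma resolvent_normal_ray z n : closure (dom A) z ->
  (forall q, closure (dom A) q -> 0 <= ip n (z - q)) ->
  forall g, 0 < g -> exists2 e0, 0 < e0 & forall e c, 0 < e -> e <= e0 ->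
    0 <= c -> c <= 1 -> `|resolvent A e (z + c *: n) - z| <= g.
Proof.
move=> Kz nz g g0.
have n0 := normr_ge0 n.
pose D := 4 * (`|n| + g + 1).
have D0 : 0 < D by rewrite /D; lra.
(* Chosen so that 2 d <= g / 2 and d (|n| + d) <= g^2 / 4, which contradicts the quadratic
   inequality for a distance above [g]. *)
pose d := g * (g / D).
have dD : d * D = g ^+ 2 by rewrite /d; field; rewrite gt_eqF.
have gD : g / D <= 1 / 4 by rewrite ler_pdivrMr// /D; lra.
have d0 : 0 < d by rewrite /d mulr_gt0// divr_gt0.
have dg : d <= g / 4 by rewrite /d; nra.
move/closure_norm : Kz => /(_ d d0)[al [be Aab] zal].
have b0 := normr_ge0 be.
exists (d / (`|be| + 1)); first by rewrite divr_gt0//; lra.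
move=> e c e0 ee c0 c1.
have eb : e * `|be| <= d.
  move: ee; rewrite ler_pdivlMr; last lra.
  nra.
have := monA (yosida_mem hip hA A_neq0 (z + c *: n) e0) Aab.
have := nz _ (subset_closure (resolvent_dom hip hA A_neq0 (z + c *: n) e0)).
rewrite /yosida; set v := resolvent _ _ _ => nv h.
have {}h : 0 <= ip (v - al) (z + c *: n - v - e *: be).
  have -> : z + c *: n - v - e *: be = e *: (e^-1 *: (z + c *: n - v) - be).
    by rewrite scalerBr scalerA divff ?gt_eqF// scale1r.
  by rewrite ipZr mulr_ge0// ltW.
rewrite leNgt; apply/negP => gv.
have h1 := ip_le hip (v - z) (z - al).
have h2 := ip_ge hip (z - al) be; have h3 := ip_ge hip (v - z) be.
have h4 := ip_le hip (z - al) n.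
have h5 := ip_le hip (z - al) (z-v).
have E : ip (v - al) (z + c *: n - v - e *: be) =
  - ip (v - z) (v - z) + ip (z - al) (z - v) + c * (- ip n (z - v)) + c * ip (z - al) n - e * ip (v - z) be - e * ip (z - al) be.
  by rewrite !ipE (ipC v z) (ipC n z) (ipC n v); ring.
rewrite E -(sqr_norm hip) in h.
rewrite (distrC z v) in h5.
have s0 := normr_ge0 (v - z).
move: (`|v - z|) (`|z - al|) (normr_ge0 (z - al)) zal gv h1 h2 h3 h4 h5 h s0 => s t t0 td gs h1 h2 h3 h4 h5 h s0.
have k1 : t * s <= d * s by rewrite ler_wpM2r.
have k2 : c * ip (z - al) n <= d * `|n|.
  have : c * ip (z - al) n <= c * (t * `|n|) by rewrite ler_wpM2l.
  have : t * `|n| <= d * `|n| by rewrite ler_wpM2r.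
  have : 0 <= t * `|n| by rewrite mulr_ge0.
  nra.
have k3 : - (e * ip (v - z) be) <= d * s.
  have : e * (- (s * `|be|)) <= e * ip (v - z) be by rewrite ler_wpM2l// ltW.
  have : s * (e * `|be|) <= s * d by rewrite ler_wpM2l.
  lra.
have k4 : - (e * ip (z - al) be) <= d * d.
  have : e * (- (t * `|be|)) <= e * ip (z - al) be by rewrite ler_wpM2l// ltW.
  have : t * (e * `|be|) <= t * d by rewrite ler_wpM2l.
  have : t * d <= d * d by rewrite ler_wpM2r// ltW.
  lra.
have k5 : c * (- ip n (z - v)) <= 0 by rewrite mulr_ge0_le0// oppr_le0.
have : s ^+ 2 <= 2 * d * s + d * (`|n| + d) by lra.
have : 2 * d * s <= g / 2 * s by rewrite ler_wpM2r//; lra.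
have : d * (`|n| + d) <= g ^+ 2 / 4.
  rewrite -dD /D; nra.
have : g * s <= s ^+ 2 by nra.
have : g ^+ 2 <= g * s by nra.
nra.
Qed.

(* Baire: the open sets [F n], where the coercivity constant [n] fails, have no
   common point in [dom A], so one of them misses a ball. *)
Lemma interior_coercive : (dom A)° !=set0 -> exists a r c, [/\ 0 < r, 0 <= c,
  (forall q, `|q - a| <= r -> dom A q) &
  forall al be, A al be -> r * `|be| <= ip be (al - a) + c * (1 + `|al - a|)].
Proof.
move=> [z0 Dz0].
pose D := (dom A)°.
have oD : open D by exact: open_interior.
pose F (n : nat) := [set z | exists al be, A al be /\ n%:R * (1 + `|al|) < ip be (z - al)].
have oF n : open (F n).
  rewrite openE => z [al [be [Aab h]]].
  apply/nbhs_ballP.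
  have b0 := normr_ge0 be.
  exists ((ip be (z - al) - n%:R * (1 + `|al|)) / (`|be| + 1)) => /=.
    by rewrite divr_gt0//; lra.
  move=> w; rewrite -ball_normE /= ltr_pdivlMr; last lra.
  move=> zw; exists al, be; split => //.
  have := ip_le hip be (z - w).
  rewrite !ipE; rewrite !ipE in zw.
  have := normr_ge0 (z - w); nra.
(* Adding the exterior of [D] lets Baire's theorem run in the whole space: if every such open set
   were dense, some point of [D] would lie in all the [F n]. *)
have [n [U [oU U0 UF]]] : exists n U, [/\ open U, U !=set0 & U `&` (F n `|` ~` closure D) = set0].
  apply: contrapT => no.
  have /Baire : forall n, open (F n `|` ~` closure D) /\ dense (F n `|` ~` closure D).
    move=> n; split.
      by apply: openU => //; apply: closed_openC; exact: closed_closure.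
    move=> U U0 oU; apply/set0P/eqP => e; apply: no; exists n, U; split => //.
  move=> /(_ D) [||z [Dz hz]]; [by exists z0|by []|].
  have [y Azy] := interior_subset Dz.
  have y0 := normr_ge0 y; have z0' := normr_ge0 z.
  (* Monotonicity against [(z, y)] keeps [z] out of [F n] as soon as n exceeds |y| (1 + |z|). *)
  pose n := (Num.truncn (`|y| * (1 + `|z|))).+1.
  have nn : `|y| * (1 + `|z|) < n%:R by apply: truncnS_gt.
  have [[al [be [Aab]]]|/(_ (subset_closure Dz))//] := hz n I.
  have := monA Azy Aab; rewrite ipDr ipNr !(ipC (z - al)) => h1 h2.
  have h3 := ip_le hip y (z - al).
  have h4 := ler_normB z al.
  have al0 := normr_ge0 al.
  have h5 : `|y| * `|z - al| <= `|y| * (`|z| + `|al|) by rewrite ler_wpM2l.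
  have h6 : `|y| * (1 + `|z|) * (1 + `|al|) <= n%:R * (1 + `|al|).
    by rewrite ler_wpM2r ?(ltW nn)// addr_ge0.
  have h7 : 0 <= `|y| * (1 + `|z| * `|al|) by rewrite mulr_ge0// addr_ge0// mulr_ge0.
  nra.
have [w [Ow Dw]] : U `&` D !=set0.
  have [v Uv] := U0.
  have : closure D v.
    apply: contrapT => no; have : (U `&` (F n `|` ~` closure D)) v by split => //; right.
    by rewrite UF.
  move=> /(_ U (open_nbhs_nbhs (conj oU Uv)))[w [Dw Ow]]; by exists w.
have : nbhs w (U `&` D) by apply: open_nbhs_nbhs; split => //; exact: openI.
move=> /nbhs_ballP[r0 /= r00 hr].
have hr2 q : `|q - w| <= r0 / 2 -> (U `&` D) q.
  move=> qw; apply: hr; rewrite -ball_normE /= distrC.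
  apply: le_lt_trans qw _; lra.
(* The factor 1 + |w| recentres the bound, since 1 + |al| <= (1 + |w|) (1 + |al - w|). *)
exists w, (r0 / 2), (n%:R * (1 + `|w|)); split.
- lra.
- by rewrite mulr_ge0// addr_ge0.
- by move=> q /hr2[_ /interior_subset].
move=> al be Aab.
have [->|be0] := eqVneq be 0.
  rewrite ip0l normr0 mulr0 add0r mulr_ge0// ?mulr_ge0// addr_ge0//.
have nb : 0 < `|be| by rewrite normr_gt0.
(* The point of the ball farthest in the direction [be]: not being in [F n] there yields the gain
   (r0 / 2) |be|. *)
pose q := w + (r0 / 2 / `|be|) *: be.
have [Oq _] : (U `&` D) q.
  apply: hr2; rewrite /q addrAC subrr add0r normrZ normrM normfV normr_id.
  rewrite divfK ?gt_eqF// ger0_norm//; lra.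
have : ~ F n q.
  move=> Fq; have : (U `&` (F n `|` ~` closure D)) q by split => //; left.
  by rewrite UF.
move=> nF; rewrite leNgt; apply/negP => h; apply: nF; exists al, be; split => //.
have -> : q - al = (w - al) + (r0 / 2 / `|be|) *: be by rewrite /q addrAC.
rewrite ipDr ipZr -(sqr_norm hip).
have -> : r0 / 2 / `|be| * `|be| ^+ 2 = r0 / 2 * `|be|.
  by field; rewrite gt_eqF.
have h1 : `|al| <= `|al - w| + `|w| by rewrite -{1}(subrK w al) ler_normD.
have h2 : n%:R * (1 + `|al|) <= n%:R * (1 + `|w|) * (1 + `|al - w|).
  rewrite -mulrA ler_wpM2l//.
  have := mulr_ge0 (normr_ge0 w) (normr_ge0 (al - w)); lra.
move: h; rewrite -(opprB w al) ipNr normrN.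
rewrite -(opprB w al) normrN in h2.
lra.
Qed.

End Projection.

(** * Stieltjes and Bochner integrals along cadlag paths *)

(** The function is the pointwise limit of its compositions with rounding up to the grid of mesh 1 /
    (n + 1), capped at [b]; each of these takes countably many values on intervals. *)
Lemma right_continuous_measurable {R : realType} (phi : R -> R) (a b : R) :
  (forall x, a <= x -> x < b -> phi y @[y --> x^'+] --> phi x) ->
  measurable_fun (`[a, b] : set R) phi.
Proof.
move=> rc.
pose r (n : nat) (x : R) : R := Num.min b ((Num.ceil (n.+1%:R * x))%:~R / n.+1%:R).
apply: (@measurable_fun_cvg _ _ _ _ (fun n x => phi (r n x))).
  move=> n _ Y mY.
  apply: measurableI; first exact: measurable_itv.
  rewrite (_ : _ @^-1` _ = \bigcup_(k in [set k : int |
      Y (phi (Num.min b (k%:~R / n.+1%:R)))])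
      [set` `](k - 1)%:~R / n.+1%:R, k%:~R / n.+1%:R] ]).
    rewrite bigcup_mkcond; apply: countable_bigcupT_measurable => // k.
    by case: ifP => // _; exact: measurable_itv.
  apply/seteqP; split => [x /= Yx|x [k /= Yk]].
    exists (Num.ceil (n.+1%:R * x)) => //=.
    rewrite in_itv /= ltr_pdivrMr// ler_pdivlMr// mulrC; exact: ceil_itv.
  rewrite in_itv /= ltr_pdivrMr// ler_pdivlMr// mulrC => /ceil_def.
  by rewrite /r mulrC => ->.
move=> x /=; rewrite in_itv /= => /andP[ax xb].
have xr n : x <= r n x.
  by rewrite /r le_min xb /= ler_pdivlMr// mulrC ceil_ge.
move: xb; rewrite le_eqVlt => /predU1P[xb|xb].
  have rx n : r n x = x.
    by apply/eqP; rewrite eq_le xr andbT xb /r ge_min lexx.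
  by under eq_fun do rewrite rx; exact: cvg_cst.
apply/cvgrPdist_le => /= e e0.
have /cvgrPdist_le /(_ e e0) := rc x ax xb.
rewrite near_withinE => -[d /= d0 hd].
have /cvgrPdist_lt /(_ d d0) [N _ hN] := @cvg_harmonic R.
exists N => // n Nn /=.
have [->|nx] := eqVneq (r n x) x; first by rewrite subrr normr0 ltW.
have xlt : x < r n x by rewrite lt_neqAle eq_sym nx xr.
apply: hd => //=; rewrite ltr0_norm ?subr_lt0// opprB.
have := hN n Nn; rewrite /= sub0r normrN /harmonic /= ger0_norm ?invr_ge0// => hn.
apply: le_lt_trans hn.
rewrite lerBlDr (le_trans (_ : _ <= (Num.ceil (n.+1%:R * x))%:~R / n.+1%:R))//.
  by rewrite /r ge_min lexx orbT.
rewrite ler_pdivrMr// mulrDl mulVf// -lerBlDl.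
have := ceilB1_lt (n.+1%:R * x); rewrite intrB (mulrC x) => /ltW; lra.
Qed.

Section RealIntegrable.
Context d (T : measurableType d) {R : realType} (mu : {measure set T -> \bar R}).
Variable D : set T.
Hypothesis mD : measurable D.
Implicit Types f g : T -> R.

Lemma integrable_addr f g : mu.-integrable D (EFin \o f) ->
  mu.-integrable D (EFin \o g) -> mu.-integrable D (EFin \o (fun x => f x + g x)).
Proof. exact: integrableD. Qed.

Lemma integrable_subr f g : mu.-integrable D (EFin \o f) ->
  mu.-integrable D (EFin \o g) -> mu.-integrable D (EFin \o (fun x => f x - g x)).
Proof. exact: integrableB. Qed.

Lemma integrable_mulr (k : R) f : mu.-integrable D (EFin \o f) ->
  mu.-integrable D (EFin \o (fun x => k * f x)).
Proof. exact: integrableZl. Qed.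

End RealIntegrable.

Section SimpleIntegral.
Context d (T : measurableType d) {R : realType} {H : normedModType R}.
Context {ip : {dot H for idfun}}.
Hypothesis hip : induces_norm ip.
Variable mu : {measure set T -> \bar R}.
Variable D : set T.
Hypothesis mD : measurable D.

(** The condition [g 0 = 0] is there because the level set of 0 may have infinite measure: its term
    then vanishes all the same. *)
Lemma integrable_simple_comp (s : T -> H) (g : H -> R) :
  simple_integrable mu D s -> g 0 = 0 ->
  mu.-integrable D (EFin \o (fun x => g (s x))) /\
  \int[mu]_(x in D) g (s x) =
    \sum_(y \in range s) fine (mu (D `&` s @^-1` [set y])) * g y.
Proof.
move=> [fs ms fin] g0.
pose term y x := g y * \1_(s @^-1` [set y]) x.
have it y : mu.-integrable D (EFin \o term y) /\
    \int[mu]_(x in D) term y x = fine (mu (D `&` s @^-1` [set y])) * g y.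
  have [gy0|gy0] := eqVneq (g y) 0.
    have -> : term y = cst 0 by apply/funext => x; rewrite /term gy0 mul0r.
    rewrite gy0 mulr0 Rintegral_cst// mul0r; split => //.
    exact: integrable0.
  have fy : (mu (D `&` s @^-1` [set y]) < +oo)%E.
    by apply: fin; apply: contra_neq gy0 => ->.
  have i1 : mu.-integrable D (EFin \o \1_(s @^-1` [set y])).
    apply/integrableP; split; first exact/measurable_EFinP/measurable_indic.
    under eq_integral => x _ do rewrite /= ger0_norm//.
    by rewrite integral_indic// setIC.
  split.
    exact: integrable_mulr.
  by rewrite RintegralZl// /Rintegral integral_indic// setIC mulrC.
have main r : mu.-integrable D (EFin \o (fun x => \sum_(y <- r) term y x)) /\
    \int[mu]_(x in D) (\sum_(y <- r) term y x) =
    \sum_(y <- r) fine (mu (D `&` s @^-1` [set y])) * g y.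
  elim: r => [|y r [i1 i2]].
    under eq_fun do rewrite big_nil; rewrite big_nil; split.
      exact: integrable0.
    by rewrite Rintegral_cst// mul0r.
  have [j1 j2] := it y; rewrite big_cons -j2 -i2.
  under eq_fun do rewrite big_cons; split.
    exact: integrable_addr.
  by rewrite -RintegralD//; apply: eq_Rintegral => x _; rewrite big_cons.
have E x : g (s x) = \sum_(y <- finmap.enum_fset (fset_set (range s))) term y x.
  rewrite (bigD1_seq (s x)) ?finmap.fset_uniq//=.
    rewrite /term indicE mem_set//= mulr1 big1 ?addr0// => y ys.
    by rewrite indicE memNset ?mulr0//= => /esym/eqP; rewrite (negbTE ys).
  by rewrite in_fset_set// mem_set//; exists x.
rewrite fsbig_finite//.
by have := main (finmap.enum_fset (fset_set (range s))); rewrite (_ : (fun x => \sum_(y <- _) _) = (fun x => g (s x)))//; apply/funext => x; rewrite E.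
Qed.

Lemma simple_integral_ip (s : T -> H) (e : H) : simple_integrable mu D s ->
  mu.-integrable D (EFin \o (fun x => ip e (s x))) /\
  ip e (simple_integral mu D s) = \int[mu]_(x in D) ip e (s x).
Proof.
move=> hs; have [i ->] := @integrable_simple_comp s (ip e) hs (ip0r e); split => //.
case: hs => fs _ _; rewrite /simple_integral !fsbig_finite//= linear_sumr /=.
by apply: eq_bigr => y _; rewrite ipZr.
Qed.

Lemma bochner_approx (h : T -> H) v : is_bochner_integral mu D h v ->
  forall w, 0 < w -> exists s, [/\ simple_integrable mu D s,
    mu.-integrable D (EFin \o (fun x => `|h x - s x|)),
    \int[mu]_(x in D) `|h x - s x| <= w &
    `|simple_integral mu D s - v| <= w].
Proof.
move=> [s [ss si s0 sv]] w w0.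
have /cvgrPdist_le /(_ w w0) [N1 _ h1] := sv.
have /fine_cvg /cvgrPdist_le /(_ w w0) [N2 _ h2] := s0.
have := h1 _ (leq_maxl N1 N2); have := h2 _ (leq_maxr N1 N2).
move: (maxn N1 N2) => n /=; rewrite sub0r normrN => k1 k2.
exists (s n); split => //.
  by apply: le_trans k1; rewrite ler_norm.
by rewrite distrC.
Qed.

(** This is the bridge from Bochner to real integrals: for an approximating simple function the
    pairing with [c] is exact, and the error is |c| times the L1 distance. Keeping [phi] separate
    from [ip c (h x)] allows [phi] to be [ip (f x) (h x)] with [f] varying, [c] being one value of
    [f]. *)
Lemma bochner_test (h : T -> H) v c (phi B : T -> R) :
  is_bochner_integral mu D h v ->
  mu.-integrable D (EFin \o phi) -> mu.-integrable D (EFin \o B) ->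
  (forall x, D x -> `|phi x - ip c (h x)| <= B x) ->
  `|\int[mu]_(x in D) phi x - ip c v| <= \int[mu]_(x in D) B x.
Proof.
move=> hv iphi iB phB.
apply: (@ler_addeps _ _ _ (2 * `|c|)); first by rewrite mulr_ge0.
move=> w w0; have [s [ss si s0 sv]] := bochner_approx hv w0.
have [i1 i2] := simple_integral_ip c ss.
have cv : `|ip c (simple_integral mu D s) - ip c v| <= `|c| * w.
  rewrite -ipNr -ipDr; apply: le_trans (ip_abs hip _ _) _.
  by rewrite ler_wpM2l.
have i3 : mu.-integrable D (EFin \o (fun x => `|c| * `|h x - s x|)).
  exact: integrable_mulr.
have i4 : mu.-integrable D (EFin \o (fun x => B x + `|c| * `|h x - s x|)).
  exact: integrable_addr.
have i5 : mu.-integrable D (EFin \o (fun x => phi x - ip c (s x))).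
  exact: integrable_subr.
have : `|\int[mu]_(x in D) phi x - ip c (simple_integral mu D s)| <=
    \int[mu]_(x in D) B x + `|c| * w.
  rewrite i2 -RintegralB//; apply: le_trans (le_normr_Rintegral _ _) _ => //.
  apply: (@le_trans _ _ (\int[mu]_(x in D) (B x + `|c| * `|h x - s x|))).
    apply: le_Rintegral => //.
      exact: integrable_norm.
    move=> x Dx; have -> : phi x - ip c (s x) = (phi x - ip c (h x)) + ip c (h x - s x).
      by rewrite !ipE; ring.
    apply: le_trans (ler_normD _ _) _; apply: lerD; first exact: phB.
    exact: ip_abs.
  by rewrite RintegralD// lerD2l RintegralZl// ler_wpM2l.
have := ler_distD (ip c (simple_integral mu D s)) (\int[mu]_(x in D) phi x) (ip c v).
lra.
Qed.

(** The majorant is |s| + |h - s| for a single approximating simple function [s]; it serves as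
    dominating function later. *)
Lemma bochner_dominated (h : T -> H) v : is_bochner_integral mu D h v ->
  exists H0 : T -> R, mu.-integrable D (EFin \o H0) /\
    forall x, `|h x| <= H0 x.
Proof.
move=> /bochner_approx /(_ 1 ltr01)[s [ss si _ _]].
have [i1 _] := integrable_simple_comp ss (@normr0 _ H).
exists (fun x => `|s x| + `|h x - s x|); split; first exact: integrable_addr.
by move=> x; rewrite -{1}(subrK (s x) (h x)) addrC ler_normD.
Qed.

End SimpleIntegral.

(** * Lebesgue-Stieltjes integrals through Riemann sums *)

Section RiemannSums.
Context {R : realType} {H : normedModType R} {ip : {dot H for idfun}}.
Hypothesis hip : induces_norm ip.
Implicit Types (f g : R -> H) (s t v : R).

(* Riemann sums taken at right endpoints: since [f] is right-continuous they
   converge by dominated convergence, whatever the atoms of [dg]. *)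
Lemma riemann_right (mu : {measure set (measurableTypeR R) -> \bar R})
    f g h s t F : s < t ->
  (forall a b, s <= a -> a <= b -> b <= t ->
     is_bochner_integral mu `]a, b] h (g b - g a)) ->
  mu.-integrable `]s, t] (EFin \o (fun r => ip (f r) (h r))) ->
  (forall x, s <= x -> x < t -> f y @[y --> x^'+] --> f x) ->
  (forall x, s <= x -> x <= t -> `|f x| <= F) ->
  forall w, 0 < w -> exists n : nat,
    let a (k : nat) := s + (t - s) / n.+1%:R * k%:R in
    `|\int[mu]_(r in `]s, t]) ip (f r) (h r) -
      \sum_(0 <= k < n.+1) ip (f (a k.+1)) (g (a k.+1) - g (a k))| <= w.
Proof.
move=> st hb iphi rcf bf w w0.
have F0 : 0 <= F by apply: le_trans (bf s _ _) => //; exact: ltW.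
have [H0 [iH0 hH0]] : exists H0 : R -> R, mu.-integrable `]s, t] (EFin \o H0) /\
    forall x, `|h x| <= H0 x.
  have hst := hb s t (lexx _) (ltW st) (lexx _).
  have mI : measurable (`]s, t]%classic : set (measurableTypeR R)) by exact: measurable_itv.
  have [H0 [i0 h0]] := bochner_dominated mI hst.
  by exists H0.
have H00 x : 0 <= H0 x by apply: le_trans (hH0 x).
pose d (n : nat) := (t - s) / n.+1%:R.
have d0 n : 0 < d n by rewrite divr_gt0// subr_gt0.
pose a n (k : nat) : R := s + d n * k%:R.
have aS n k : a n k.+1 = a n k + d n by rewrite /a -natr1; ring.
have a0 n : a n 0%N = s by rewrite /a mulr0 addr0.
have an n : a n n.+1 = t by rewrite /a /d divfK ?subrKC.
have ale n k l : (k <= l)%N -> a n k <= a n l.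
  by move=> kl; rewrite lerD2l ler_pM2l// ler_nat.
pose r n (x : R) : R := s + d n * (Num.ceil ((x - s) / d n))%:~R.
have r_piece n k x : a n k < x -> x <= a n k.+1 -> r n x = a n k.+1.
  move=> ax xa; rewrite /r /a; congr (_ + _ * _).
  rewrite (@ceil_def _ _ k.+1%:Z)// ltr_pdivlMr// ler_pdivrMr//.
  have -> : (k.+1%:Z - 1)%:~R = k%:R :> R by rewrite -addn1 PoszD addrK.
  have -> : k.+1%:~R = k.+1%:R :> R by [].
  by move: ax xa; rewrite /a !(mulrC (d n)) => h1 h2; apply/andP; split; lra.
(* Error density of replacing [f] by its value at the right end of the cell; it tends to 0 by right
   continuity and is dominated by [2 * F * H0]. *)
pose G n x := `|f x - f (r n x)| * H0 x.
have r_ge n x : x <= r n x.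
  rewrite /r -lerBlDl mulrC -ler_pdivrMr//; exact: ceil_ge.
have r_lt n x : r n x < x + d n.
  rewrite /r -ltrBrDl mulrC -ltr_pdivlMr//.
  have := ceilB1_lt ((x - s) / d n); rewrite intrB.
  have -> : (x + d n - s) / d n = (x - s) / d n + 1 by field; rewrite gt_eqF.
  lra.
have r_t n : r n t = t.
  rewrite -{1}(an n) (r_piece n n) ?an// -[X in _ < X](an n) aS ltrDl; exact: d0.
have r_le n x : x <= t -> r n x <= t.
  move=> xt; rewrite -(r_t n) lerD2l ler_pM2l// ler_int; apply: le_ceil.
  by rewrite ler_pM2r ?invr_gt0// lerB.
(* Measurability of [G n] and the error bound are proved together, cell by cell: on one cell [r n]
   is constant, and [bochner_test] applies with that value of [f]. *)
have mG n k : (k <= n.+1)%N -> measurable_fun `]s, a n k] (G n) /\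
   (mu.-integrable `]s, a n k] (EFin \o G n) ->
  `|\int[mu]_(x in `]s, a n k]) ip (f x) (h x) -
    \sum_(0 <= i < k) ip (f (a n i.+1)) (g (a n i.+1) - g (a n i))|
  <= \int[mu]_(x in `]s, a n k]) G n x).
  elim: k => [_|k IH kn].
    rewrite a0 set_itvoc0; split; first exact: measurable_fun_set0.
    by move=> _; rewrite !Rintegral_set0 big_geq// subrr normr0.
  have [mk Ik] := IH (ltnW kn).
  have E : `]s, a n k.+1]%classic = `]s, a n k]%classic `|` `]a n k, a n k.+1]%classic.
    rewrite -itv_bndbnd_setU// bnd_simp; last by apply: ale.
    by rewrite -(a0 n) ale.
  have dis : [disjoint `]s, a n k]%classic & `]a n k, a n k.+1]%classic].
    apply/disj_setPS => x /=; rewrite !in_itv /= => -[/andP[_ h1] /andP[h2 _]].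
    by move: (lt_le_trans h2 h1); rewrite ltxx.
  have sk : s <= a n k by rewrite -(a0 n) ale.
  have kt : a n k.+1 <= t by rewrite -(an n) ale.
  have sub : `]a n k, a n k.+1]%classic `<=` `]s, t]%classic.
    move=> x /=; rewrite !in_itv /= => /andP[h1 h2].
    by rewrite (le_lt_trans sk h1) (le_trans h2 kt).
  have subl : `]s, a n k]%classic `<=` `]s, t]%classic.
    move=> x /=; rewrite !in_itv /= => /andP[h1 h2].
    by rewrite h1 (le_trans h2 (le_trans (ale _ _ _ (leqnSn _)) kt)).
  have mc : measurable_fun `]a n k, a n k.+1] (fun x => `|f x - f (a n k.+1)| * H0 x).
    apply: measurable_funM.
      apply: (@measurable_funS _ _ _ _ `[a n k, a n k.+1]) => //.
        by move=> x /=; rewrite !in_itv /= => /andP[/ltW -> ->].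
      apply: right_continuous_measurable => x h1 h2.
      apply: cvg_norm; apply: cvgB; last exact: cvg_cst.
      by apply: rcf; [exact: le_trans h1|exact: lt_le_trans kt].
    have iH0k : mu.-integrable `]a n k, a n k.+1] (EFin \o H0).
      by apply: integrableS iH0 => //; exact: measurable_itv.
    by apply/measurable_EFinP; case/integrableP: iH0k.
  have eqG x : x \in `]a n k, a n k.+1]%classic -> `|f x - f (a n k.+1)| * H0 x = G n x.
    by rewrite inE /= in_itv /= => /andP[h1 h2]; rewrite /G (r_piece n k).
  split.
    rewrite E; apply/measurable_funU => //; split => //.
    exact: eq_measurable_fun mc.
  rewrite E => iG.
  have iGl : mu.-integrable `]s, a n k] (EFin \o G n).
    by apply: integrableS iG => //; exact: measurableU.
  have iGr : mu.-integrable `]a n k, a n k.+1] (EFin \o G n).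
    by apply: integrableS iG => //; exact: measurableU.
  have iphi' : mu.-integrable (`]s, a n k]%classic `|` `]a n k, a n k.+1]%classic) (EFin \o (fun x => ip (f x) (h x))).
    by apply: integrableS iphi => //; [exact: measurableU|rewrite subUset].
  rewrite !Rintegral_setU// big_nat_recr//=.
  have test : `|\int[mu]_(x in `]a n k, a n k.+1]) ip (f x) (h x) -
     ip (f (a n k.+1)) (g (a n k.+1) - g (a n k))| <= \int[mu]_(x in `]a n k, a n k.+1]) G n x.
    apply: (bochner_test hip _ (hb _ _ sk (ale _ _ _ (leqnSn k)) kt)) => //.
      by apply: integrableS iphi => //; exact: measurable_itv.
    move=> x /= xi; rewrite -eqG ?inE//.
    rewrite -ipNl -ipDl; apply: le_trans (ip_abs hip _ _) _.
    by rewrite ler_wpM2l.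
  rewrite opprD addrACA; apply: le_trans (ler_normD _ _) _; apply: lerD => //.
  exact: Ik.
have iG n : mu.-integrable `]s, t] (EFin \o G n).
  have i2 : mu.-integrable `]s, t] (EFin \o (fun x => 2 * F * H0 x)).
    by apply: integrable_mulr.
  apply: le_integrable i2 => //.
    by apply/measurable_EFinP; have [] := mG n n.+1 (leqnn _); rewrite an.
  move=> x /=; rewrite in_itv /= => /andP[sx xt].
  rewrite lee_fin ger0_norm ?mulr_ge0//; apply: le_trans (ler_norm _).
  rewrite ler_wpM2r//; apply: le_trans (ler_normB _ _) _.
  have := bf x (ltW sx) xt.
  have := bf (r n x) (le_trans (ltW sx) (r_ge n x)) (r_le n x xt); lra.
have [n hn] : exists n, \int[mu]_(x in `]s, t]) G n x <= w.
  have : (\int[mu]_(x in `]s, t]) (G n x)%:E @[n --> \oo] --> \int[mu]_(x in `]s, t]) 0)%E.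
    apply: (@dominated_cvg _ _ _ mu `]s, t] _ (fun n => EFin \o G n) (cst 0%E)
      (EFin \o (fun x => 2 * F * H0 x))) => //.
    - by move=> n; apply/measurable_EFinP; have [] := mG n n.+1 (leqnn _); rewrite an.
    - move=> x /=; rewrite in_itv /= => /andP[sx xt].
      apply: cvg_EFin; first exact: nearW.
      rewrite -(mul0r (H0 x)); apply: cvgM; last exact: cvg_cst.
      move: xt; rewrite le_eqVlt => /predU1P[->|xt].
        by under eq_fun do rewrite /= r_t subrr normr0; exact: cvg_cst.
      apply/cvgr0Pnorm_le => e e0 /=.
      have /cvgrPdist_le /(_ e e0) := rcf x (ltW sx) xt.
      rewrite near_withinE => -[del /= del0 hd].
      have c0 : 0 < del / (t - s) by rewrite divr_gt0// subr_gt0.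
      have /cvgrPdist_lt /(_ _ c0) [N _ hN] := @cvg_harmonic R.
      exists N => // n Nn /=; rewrite normr_id.
      have [->|nx] := eqVneq (r n x) x; first by rewrite subrr normr0 ltW.
      have xlt : x < r n x by rewrite lt_neqAle eq_sym nx r_ge.
      apply: hd => //=; rewrite ltr0_norm ?subr_lt0// opprB.
      have := hN n Nn; rewrite /= sub0r normrN /harmonic /= ger0_norm ?invr_ge0//.
      rewrite ltr_pdivlMr ?subr_gt0// mulrC -/(d n) => hn.
      have := r_lt n x; lra.
    - by apply: integrable_mulr.
    - move=> n x /=; rewrite in_itv /= => /andP[sx xt].
      rewrite lee_fin ger0_norm ?mulr_ge0//.
      rewrite ler_wpM2r//; apply: le_trans (ler_normB _ _) _.
      have := bf x (ltW sx) xt.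
      have := bf (r n x) (le_trans (ltW sx) (r_ge n x)) (r_le n x xt); lra.
  rewrite integral0 => /fine_cvg /cvgrPdist_le /(_ w w0) [N _ hN].
  exists N; have := hN N (leqnn _) => /=; rewrite sub0r normrN.
  by apply: le_trans; rewrite ler_norm.
exists n; apply: le_trans hn.
by have [_] := mG n n.+1 (leqnn _); rewrite an; exact.
Qed.

Lemma LS_riemann f g s t v F : s < t -> is_LS_integral ip f g s t v ->
  (forall x, s <= x -> x < t -> f y @[y --> x^'+] --> f x) ->
  (forall x, s <= x -> x <= t -> `|f x| <= F) ->
  forall w, 0 < w -> exists n : nat,
    let a (k : nat) := s + (t - s) / n.+1%:R * k%:R in
    `|v - \sum_(0 <= k < n.+1) ip (f (a k.+1)) (g (a k.+1) - g (a k))| <= w.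
Proof.
move=> st [V [h [_ hb iphi <-]]] rcf bf.
exact: (riemann_right st hb iphi rcf bf).
Qed.

(** Freezing the integrand at [f0] makes the Riemann sums telescope; the cost is [de] times the
    variation of [g], measured by any control [om]. *)
Lemma LS_lower_bound f g s t v F (f0 : H) (de : R) (om : R -> R) :
  s <= t -> is_LS_integral ip f g s t v ->
  (forall x, s <= x -> x < t -> f y @[y --> x^'+] --> f x) ->
  (forall x, s <= x -> x <= t -> `|f x| <= F) ->
  (forall x, s <= x -> x <= t -> `|f x - f0| <= de) ->
  (forall x y, s <= x -> x <= y -> y <= t -> `|g y - g x| <= om y - om x) ->
  v - de * (om t - om s) <= ip f0 (g t - g s).
Proof.
rewrite le_eqVlt => /predU1P[->|st] LS rcf bf fde gom.
  case: LS => V [h [_ _ _ <-]].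
  by rewrite set_itvoc0 Rintegral_set0 !subrr mulr0 subr0 ip0r.
apply: (@ler_addeps _ _ _ 1) => // w w0; rewrite mulr1.
have de0 : 0 <= de by apply: le_trans (fde s _ _) => //; exact: ltW.
have [n /=] := LS_riemann st LS rcf bf w0.
set a := fun k : nat => s + (t - s) / n.+1%:R * k%:R.
have d0 : 0 < (t - s) / n.+1%:R by rewrite divr_gt0// subr_gt0.
have a0 : a 0%N = s by rewrite /a mulr0 addr0.
have an : a n.+1 = t by rewrite /a divfK ?subrKC.
have ale k l : (k <= l)%N -> a k <= a l.
  by move=> kl; rewrite lerD2l ler_pM2l// ler_nat.
have main k : (k <= n.+1)%N ->
    \sum_(0 <= i < k) ip (f (a i.+1)) (g (a i.+1) - g (a i)) <=
    ip f0 (g (a k) - g s) + de * (om (a k) - om s).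
  elim: k => [_|k IH kn].
    by rewrite big_geq// a0 !subrr ip0r mulr0 addr0.
  rewrite big_nat_recr//=.
  have sk : s <= a k by rewrite -a0 ale.
  have kt : a k.+1 <= t by rewrite -an ale.
  have kk := ale _ _ (leqnSn k).
  have h1 := fde (a k.+1) (le_trans sk kk) kt.
  have h2 := gom _ _ sk kk kt.
  have h3 := ip_le hip (f (a k.+1) - f0) (g (a k.+1) - g (a k)).
  have h4 : `|f (a k.+1) - f0| * `|g (a k.+1) - g (a k)| <= de * (om (a k.+1) - om (a k)).
    by rewrite ler_pM.
  have := IH (ltnW kn); move: h3; rewrite !ipE; lra.
have := main n.+1 (leqnn _); rewrite -/(a _) an ler_norml => h1 /andP[_ h2].
lra.
Qed.

End RiemannSums.

(** * Increments of Bochner integrals in time *)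

Section BochnerIncrement.
Context {R : realType} {H : normedModType R} {ip : {dot H for idfun}}.
Hypothesis hip : induces_norm ip.
Let mu := @lebesgue_measure R.
Implicit Types (f : R -> H) (t a b M : R).

Lemma measurable_itvR (i : interval R) :
  measurable ([set` i] : set (measurableTypeR R)).
Proof. exact: measurable_itv. Qed.

Lemma bochner_integrable_comp f t v (phi : H -> R) K : 0 <= t ->
  is_bochner_integral (@lebesgue_measure R) `[0, t] f v ->
  (forall x, 0 <= x -> x < t -> f y @[y --> x^'+] --> f x) ->
  continuous phi -> (forall z, `|phi z| <= K * `|z|) -> 0 <= K ->
  (@lebesgue_measure R).-integrable `[0, t] (EFin \o (fun x => phi (f x))).
Proof.
move=> t0 hv rcf cphi hphi K0.
have [H0 [iH0 hH0]] := bochner_dominated (measurable_itvR `[0, t]) hv.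
have i2 : (@lebesgue_measure R).-integrable `[0, t] (EFin \o (fun x => K * H0 x)).
  by apply: integrable_mulr => //; exact: measurable_itvR.
apply: le_integrable i2 => //.
- apply/measurable_EFinP.
  apply: right_continuous_measurable => x x0 xt.
  by apply: (cvg_comp _ _ (rcf x x0 xt)); exact: cphi.
- move=> x _; rewrite /= lee_fin; apply: le_trans (hphi _) _.
  by apply: le_trans (ler_norm _); rewrite ler_wpM2l.
Qed.

(** The second interval is open at [b], which changes no integral: bounds on a cadlag integrand hold
    on [a, b[ only, since it may jump at [b]. *)
Lemma Rintegral_split (phi : R -> R) a b : 0 <= a -> a <= b ->
  (@lebesgue_measure R).-integrable `[0, b] (EFin \o phi) ->
  \int[@lebesgue_measure R]_(x in `[0, b]) phi x =
  \int[@lebesgue_measure R]_(x in `[0, a]) phi x +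
  \int[@lebesgue_measure R]_(x in `]a, b[) phi x.
Proof.
move=> a0 ab iphi.
have E : `[0, b]%classic = `[0, a]%classic `|` `]a, b]%classic.
  by rewrite -itv_bndbnd_setU// bnd_simp.
rewrite Rintegral_itv_bndo_bndc; last first.
  apply: integrableS iphi => //; try exact: measurable_itvR.
  by move=> x /=; rewrite !in_itv /= => /andP[h1 h2]; rewrite (ltW (le_lt_trans a0 h1)) ltW.
rewrite E Rintegral_setU//; try exact: measurable_itvR.
  by rewrite -E.
apply/disj_setPS => x /=; rewrite !in_itv /= => -[/andP[_ h1] /andP[h2 _]].
by move: (lt_le_trans h2 h1); rewrite ltxx.
Qed.

Lemma Rintegral_oo_le (phi : R -> R) a b M : a <= b ->
  (@lebesgue_measure R).-integrable `]a, b[ (EFin \o phi) ->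
  (forall x, a < x -> x < b -> phi x <= M) ->
  \int[@lebesgue_measure R]_(x in `]a, b[) phi x <= (b - a) * M.
Proof.
move=> ab iphi le.
have mab : @lebesgue_measure R `]a, b[ = (b - a)%:E.
  rewrite lebesgue_measure_itv /= lte_fin; case: ltP => //.
  by move=> ba; have -> : a = b; [apply/eqP; rewrite eq_le ab|rewrite subrr].
apply: (@le_trans _ _ (\int[@lebesgue_measure R]_(x in `]a, b[) M)).
  apply: le_Rintegral => //.
  - apply/integrableP; split; first exact: measurable_cst.
    rewrite (_ : (fun x : R => _) = cst `|M|%:E)//.
    rewrite integral_cst; last exact: measurable_itvR.
    by rewrite -[X in (_ * X)%E]/(@lebesgue_measure R `]a, b[) mab -EFinM ltry.
  - by move=> x /=; rewrite in_itv /= => /andP[]; exact: le.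
rewrite Rintegral_cst; last exact: measurable_itvR.
by rewrite -[X in _ * fine X]/(@lebesgue_measure R `]a, b[) mab mulrC.
Qed.

(** The error vector [e] is tested against itself, so that the vector estimate becomes the scalar
    one |e|^2 <= |e| (b - a) M. *)
Lemma bochner_increment f a b v v' c M : 0 <= a -> a <= b ->
  is_bochner_integral (@lebesgue_measure R) `[0, a] f v ->
  is_bochner_integral (@lebesgue_measure R) `[0, b] f v' ->
  (forall x, 0 <= x -> x < b -> f y @[y --> x^'+] --> f x) ->
  (forall x, a < x -> x < b -> `|f x - c| <= M) ->
  `|v' - v - (b - a) *: c| <= (b - a) * M.
Proof.
move=> a0 ab hv hv' rcf fM.
have b0 := le_trans a0 ab.
set e := v' - v - _.
have [e0|e0] := eqVneq e 0.
  rewrite e0 normr0; case: (ltP a b) => [alb|ba]; last first.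
    by have -> : a = b; [apply/eqP; rewrite eq_le ab|rewrite subrr mul0r].
  rewrite mulr_ge0 ?subr_ge0//.
  apply: le_trans (fM ((a + b) / 2) _ _) => //; lra.
have ne : 0 < `|e| by rewrite normr_gt0.
have ce : continuous (ip e).
  move=> z; apply/cvgrPdist_le => w w0; near=> u.
  rewrite -ipNr -ipDr; apply: le_trans (ip_abs hip _ _) _.
  rewrite -ler_pdivlMl//; near: u.
  apply: cvgr_dist_le => //; rewrite mulr_gt0// invr_gt0//.
have ib : (@lebesgue_measure R).-integrable `[0, b] (EFin \o (fun x => ip e (f x))).
  by apply: (bochner_integrable_comp b0 hv' rcf ce (fun z => ip_abs hip e z)).
have ia : (@lebesgue_measure R).-integrable `[0, a] (EFin \o (fun x => ip e (f x))).
  apply: integrableS ib => //; try exact: measurable_itvR.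
  by move=> x /=; rewrite !in_itv /= => /andP[-> h]; exact: le_trans ab.
have iab : (@lebesgue_measure R).-integrable `]a, b[ (EFin \o (fun x => ip e (f x))).
  apply: integrableS ib => //; try exact: measurable_itvR.
  by move=> x /=; rewrite !in_itv /= => /andP[h1 h2]; rewrite (ltW (le_lt_trans a0 h1)) ltW.
have test t w : is_bochner_integral (@lebesgue_measure R) `[0, t] f w ->
    (@lebesgue_measure R).-integrable `[0, t] (EFin \o (fun x => ip e (f x))) ->
    \int[@lebesgue_measure R]_(x in `[0, t]) ip e (f x) = ip e w.
  move=> hw iw; apply/eqP; rewrite -subr_eq0 -normr_le0.
  apply: le_trans (bochner_test hip (B := cst 0) (measurable_itvR _) hw iw _ _) _.
  - exact: integrable0.
  - by move=> x _; rewrite subrr normr0.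
  - by rewrite Rintegral_cst ?mul0r//; exact: measurable_itvR.
have := Rintegral_split a0 ab ib.
rewrite (test _ _ hv' ib) (test _ _ hv ia) => E.
have h : \int[@lebesgue_measure R]_(x in `]a, b[) ip e (f x) <=
    (b - a) * (ip e c + `|e| * M).
  apply: Rintegral_oo_le => // x ax xb; rewrite -lerBlDl -ipNr -ipDr.
  by apply: le_trans (ip_le hip _ _) _; rewrite ler_wpM2l// fM.
have : ip e e <= `|e| * ((b - a) * M).
  have -> : ip e e = ip e v' - ip e v - (b - a) * ip e c.
    have : ip e (v' - v - (b - a) *: c) = ip e v' - ip e v - (b - a) * ip e c.
      by clearbody e; rewrite !ipE.
    by [].
  rewrite E; lra.
by rewrite -(sqr_norm hip) expr2 ler_pM2l.
Unshelve. all: by end_near. Qed.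

Lemma bochner_norm_increment f a b v' M : 0 <= a -> a <= b ->
  is_bochner_integral (@lebesgue_measure R) `[0, b] f v' ->
  (forall x, 0 <= x -> x < b -> f y @[y --> x^'+] --> f x) ->
  (forall x, a < x -> x < b -> `|f x| <= M) ->
  \int[@lebesgue_measure R]_(x in `[0, b]) `|f x| <=
  \int[@lebesgue_measure R]_(x in `[0, a]) `|f x| + (b - a) * M.
Proof.
move=> a0 ab hv' rcf fM; have b0 := le_trans a0 ab.
have ib : (@lebesgue_measure R).-integrable `[0, b] (EFin \o (fun x => `|f x|)).
  apply: (bochner_integrable_comp (K := 1) (phi := fun z => `|z|) b0 hv' rcf) => //.
    exact: norm_continuous.
  by move=> z; rewrite normr_id mul1r.
rewrite (Rintegral_split a0 ab ib) lerD2l; apply: Rintegral_oo_le => //.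
apply: integrableS ib => //; try exact: measurable_itvR.
by move=> x /=; rewrite !in_itv /= => /andP[h1 h2]; rewrite (ltW (le_lt_trans a0 h1)) ltW.
Qed.

Lemma bochner_norm_increment_ge f a b v' M : 0 <= a -> a <= b ->
  is_bochner_integral (@lebesgue_measure R) `[0, b] f v' ->
  (forall x, 0 <= x -> x < b -> f y @[y --> x^'+] --> f x) ->
  (forall x, a < x -> x < b -> M <= `|f x|) ->
  \int[@lebesgue_measure R]_(x in `[0, a]) `|f x| + (b - a) * M <=
  \int[@lebesgue_measure R]_(x in `[0, b]) `|f x|.
Proof.
move=> a0 ab hv' rcf fM; have b0 := le_trans a0 ab.
have ib : (@lebesgue_measure R).-integrable `[0, b] (EFin \o (fun x => `|f x|)).
  apply: (bochner_integrable_comp (K := 1) (phi := fun z => `|z|) b0 hv' rcf) => //.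
    exact: norm_continuous.
  by move=> z; rewrite normr_id mul1r.
have iab : (@lebesgue_measure R).-integrable `]a, b[ (EFin \o (fun x => `|f x|)).
  apply: integrableS ib => //; try exact: measurable_itvR.
  by move=> x /=; rewrite !in_itv /= => /andP[h1 h2]; rewrite (ltW (le_lt_trans a0 h1)) ltW.
rewrite (Rintegral_split a0 ab ib) lerD2l.
have := @Rintegral_oo_le (fun x => - 1 * `|f x|) a b (- M) ab.
rewrite RintegralZl//.
rewrite mulrN mulN1r lerN2; apply.
  by apply: integrable_mulr => //; exact: measurable_itvR.
by move=> x ax xb; rewrite mulN1r lerN2 fM.
Qed.

Lemma bochner_norm_integral_fin f t v : 0 <= t ->
  is_bochner_integral (@lebesgue_measure R) `[0, t] f v ->
  (forall x, 0 <= x -> x < t -> f y @[y --> x^'+] --> f x) ->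
  (\int[@lebesgue_measure R]_(x in `[0%R, t]) (`|f x|)%:E)%E =
  (\int[@lebesgue_measure R]_(x in `[0, t]) `|f x|)%:E.
Proof.
move=> t0 hv rcf; rewrite /Rintegral fineK//.
apply: integrable_fin_num; first exact: measurable_itvR.
apply: (bochner_integrable_comp (K := 1) (phi := fun z => `|z|) t0 hv rcf) => //.
  exact: norm_continuous.
by move=> z; rewrite normr_id mul1r.
Qed.

End BochnerIncrement.

(** * Energy and variation estimates for discrete paths *)

Section Discrete.
Context {R : realType} {H : normedModType R} {ip : {dot H for idfun}}.
Hypothesis hip : induces_norm ip.

(** Implicit step: |q1|^2 - |q0|^2 <= 2 ip q1 (q1 - q0). The difference [q1] of two compensators is
    the mismatch [p] of the inputs minus the difference [e] of the positions; for the latter,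
    monotonicity supplies the bound [- rho]. *)
Lemma energy_step (q0 q1 p e : H) (P rho : R) :
  q1 = p - e -> `|p| <= P -> - rho <= ip e (q1 - q0) ->
  ip q1 q1 <= ip q0 q0 + 2 * (P * `|q1 - q0| + rho).
Proof.
move=> q1E pP erho.
have h1 := ip_le hip p (q1 - q0).
have h2 : `|p| * `|q1 - q0| <= P * `|q1 - q0| by rewrite ler_wpM2r.
have h3 := ip_ge0 hip (q1 - q0).
have h4 : ip q1 (q1 - q0) = ip p (q1 - q0) - ip e (q1 - q0).
  by rewrite {1}q1E !ipE; ring.
move: h1 h2 h3 h4 erho; move: (`|q1 - q0|) => n.
rewrite !ipE (ipC q0 q1); lra.
Qed.

Lemma ler_sum_prefix (F : nat -> R) (k n : nat) : (k <= n)%N ->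
  (forall j, (j < n)%N -> 0 <= F j) ->
  \sum_(0 <= j < k) F j <= \sum_(0 <= j < n) F j.
Proof.
move=> kn F0; rewrite [leRHS](@big_cat_nat _ _ _ k)//= lerDl.
by rewrite big_nat; apply: sumr_ge0 => j /andP[_ jn]; exact: F0.
Qed.

(* [C] is a sampled path of total variation at most [L] staying within [r / 2]
   of the input [X + K]; the kinetic energy of [C - K - a] absorbs the
   variation of [K]. *)
Lemma discrete_BV (r c T L d : R) : 0 < r -> 0 <= c -> 0 <= T -> 0 <= L -> 0 <= d ->
  exists B : R, 0 <= B /\
  forall (a : H) (X K C : nat -> H) (h : nat -> R) (n : nat),
  K 0%N = 0 -> `|C 0%N - a| <= d ->
  (forall j, (j <= n)%N -> `|X j + K j - C j| <= r / 2) ->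
  (forall j, (j < n)%N -> 0 <= h j) ->
  (forall j, (j < n)%N -> r * `|K j.+1 - K j| <=
     ip (K j.+1 - K j) (X j.+1 - a) + h j * (c * (1 + `|X j.+1 - a|))) ->
  \sum_(0 <= j < n) h j <= T ->
  \sum_(0 <= j < n) `|C j.+1 - C j| <= L ->
  \sum_(0 <= j < n) `|K j.+1 - K j| <= B.
Proof.
move=> r0 c0 T0 L0 d0.
(* Absorbs the distance r / 2 between position and input: 1 + |z + Y| <= (1 + r / 2) (1 + |Y|) when
   |z| <= r / 2. *)
pose c' := c * (1 + r / 2).
have c'0 : 0 <= c' by rewrite mulr_ge0//; lra.
pose y := 1 + d + L + 4 * c' * T.
have c'T : 0 <= c' * T by rewrite mulr_ge0.
have y1 : 1 <= y by rewrite /y; lra.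
exists ((d ^+ 2 + 2 * y * L + L ^+ 2 + 2 * c' * (1 + y) * T) / r); split.
  rewrite divr_ge0//; last exact: ltW.
  have := sqr_ge0 d; have := sqr_ge0 L; have := mulr_ge0 c'T (_ : 0 <= 1 + y).
  have : 0 <= y * L by rewrite mulr_ge0//; lra.
  move=> h1 h2 h3 h4.
  have := h2 ltac:(lra); lra.
move=> a X K C h n K0 C0 near h0 coer hT CL.
pose Y j := C j - K j - a.
have hsum k : (k <= n)%N -> \sum_(0 <= j < k) h j <= T.
  by move=> kn; apply: le_trans hT; exact: ler_sum_prefix.
have Csum k : (k <= n)%N -> \sum_(0 <= j < k) `|C j.+1 - C j| <= L.
  by move=> kn; apply: le_trans CL; exact: ler_sum_prefix.
(* Replacing [X j.+1 - a] by [Y j.+1] costs half of the coercivity constant; the remaining r / 2 is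
   doubled by the polarization identity for [2 * ip dK (Y j.+1)]. *)
have step j : (j < n)%N -> ip (Y j.+1) (Y j.+1) + r * `|K j.+1 - K j| <=
    (`|Y j| + `|C j.+1 - C j|) ^+ 2 + 2 * h j * c' * (1 + `|Y j.+1|).
  move=> jn; have := coer j jn; have hj := h0 j jn.
  set dK := K j.+1 - K j; set dC := C j.+1 - C j.
  pose z := X j.+1 + K j.+1 - C j.+1.
  have zr : `|z| <= r / 2 by exact: near.
  have -> : X j.+1 - a = z + Y j.+1.
    by apply: (ip_inj hip) => u; rewrite /z /Y !ipE; ring.
  have h1 := ip_le hip dK z.
  have h2 : `|dK| * `|z| <= `|dK| * (r / 2) by rewrite ler_wpM2l.
  have h3 := ler_normD z (Y j.+1).
  have h4 : h j * (c * (1 + `|z + Y j.+1|)) <= h j * (c' * (1 + `|Y j.+1|)).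
    rewrite ler_wpM2l// /c' -mulrA ler_wpM2l//.
    have := mulr_ge0 (ltW r0) (normr_ge0 (Y j.+1)); lra.
  have h5 : ip (Y j + dC) (Y j + dC) <= (`|Y j| + `|dC|) ^+ 2.
    by apply: ip_le_sqr => //; exact: ler_normD.
  have E : dK = Y j + dC - Y j.+1.
    by apply: (ip_inj hip) => u; rewrite /dK /dC /Y !ipE; ring.
  have h6 : 2 * ip dK (Y j.+1) = ip (Y j + dC) (Y j + dC) - ip (Y j.+1) (Y j.+1) - ip dK dK.
    have gen (u v w : H) : 2 * ip (u + v - w) w =
        ip (u + v) (u + v) - ip w w - ip (u + v - w) (u + v - w).
      by rewrite !ipE (ipC v u) (ipC w u) (ipC w v); ring.
    by rewrite E; exact: gen.
  have h7 := ip_ge0 hip dK.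
  rewrite ipDr; move: (`|dK|) h1 h2 => k h1 h2 h8; lra.
(* The maximum with 1 allows 1 + y' <= 2 y', so the energy inequality becomes y'^2 <= (b + dC)^2 + 4
   c' h y' and the norm grows additively, without an exponential factor. *)
have bound k : (k <= n)%N -> Num.max 1 `|Y k| <=
    1 + d + \sum_(0 <= j < k) `|C j.+1 - C j| + 4 * c' * \sum_(0 <= j < k) h j.
  elim: k => [_|k IH kn].
    rewrite !big_geq// mulr0 !addr0 ge_max /Y K0 subr0; apply/andP; split; lra.
  have {IH} := IH (ltnW kn); rewrite !big_nat_recr//=.
  have := step k kn; have hk := h0 k kn.
  rewrite -(sqr_norm hip) ge_max => st /andP[b1 b2].
  have dC0 := normr_ge0 (C k.+1 - C k).
  have hc : 0 <= c' * h k by rewrite mulr_ge0.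
  have : 0 <= r * `|K k.+1 - K k| by rewrite mulr_ge0// ltW.
  move: st b1 b2 dC0 hc; move: (\sum_(0 <= j < k) _) (\sum_(0 <= j < k) _) => S2 S1.
  move: (`|C k.+1 - C k|) (`|Y k.+1|) (normr_ge0 (Y k.+1)) (`|Y k|) (normr_ge0 (Y k)) => dC y' y'0 yk yk0 st b1 b2 dC0 hc rK.
  rewrite ge_max; apply/andP; split; first lra.
  rewrite leNgt; apply/negP => big.
  pose b := 1 + d + S1 + 4 * c' * S2.
  have : y' ^+ 2 <= (b + dC) ^+ 2 + 4 * (c' * h k) * y'.
    apply: (@le_trans _ _ ((yk + dC) ^+ 2 + 2 * h k * c' * (1 + y'))); first lra.
    apply: lerD.
      have hb : yk + dC <= b + dC by rewrite lerD2r.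
      by rewrite !expr2 ler_pM// addr_ge0.
    have : 1 <= y' by lra.
    nra.
  have : b + dC + 4 * (c' * h k) < y' by rewrite /b; lra.
  have : 0 <= b + dC by rewrite /b; lra.
  move: (b + dC) (c' * h k) hc => u v v0 u0 uv; nra.
have Yy k : (k <= n)%N -> `|Y k| <= y.
  move=> kn; have := bound k kn; rewrite ge_max => /andP[_] /le_trans; apply.
  have := Csum k kn; have := ler_wpM2l c'0 (hsum k kn); rewrite /y; lra.
rewrite ler_pdivlMr// mulrC mulr_sumr.
have main k : (k <= n)%N -> ip (Y k) (Y k) + \sum_(0 <= j < k) r * `|K j.+1 - K j| <=
    d ^+ 2 + (2 * y + L) * \sum_(0 <= j < k) `|C j.+1 - C j|
    + 2 * c' * (1 + y) * \sum_(0 <= j < k) h j.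
  elim: k => [_|k IH kn].
    rewrite !big_geq// !mulr0 !addr0 /Y K0 subr0; exact: ip_le_sqr.
  have {IH} := IH (ltnW kn); rewrite !big_nat_recr//=.
  have := step k kn; have hk := h0 k kn.
  have h1 : 2 * h k * c' * (1 + `|Y k.+1|) <= 2 * c' * (1 + y) * h k.
    have : h k * c' * (1 + `|Y k.+1|) <= h k * c' * (1 + y).
      apply: ler_wpM2l; first exact: mulr_ge0.
      by rewrite lerD2l; exact: Yy.
    lra.
  have dL : `|C k.+1 - C k| <= L.
    apply: le_trans (Csum k.+1 kn); rewrite big_nat_recr//= lerDr.
    exact: sumr_ge0.
  have h2 : (`|Y k| + `|C k.+1 - C k|) ^+ 2 <= ip (Y k) (Y k) + (2 * y + L) * `|C k.+1 - C k|.
    rewrite -(sqr_norm hip).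
    have := Yy k (ltnW kn); have := normr_ge0 (C k.+1 - C k).
    nra.
  move: (\sum_(0 <= j < k) _) (\sum_(0 <= j < k) _) (\sum_(0 <= j < k) _) => S3 S2 S1.
  by move: (2 * y + L) (2 * c' * (1 + y)) h2 h1 => p q h2 h1; lra.
have := main n (leqnn _); have := ip_ge0 hip (Y n).
have : (2 * y + L) * \sum_(0 <= j < n) `|C j.+1 - C j| <= (2 * y + L) * L.
  by rewrite ler_wpM2l//; lra.
have : 2 * c' * (1 + y) * \sum_(0 <= j < n) h j <= 2 * c' * (1 + y) * T.
  by rewrite ler_wpM2l// mulr_ge0//; lra.
lra.
Qed.

End Discrete.

(** * Cadlag paths and partitions *)

Section Partition.
Context {R : realType}.
Implicit Types (a b t : R) (P : R -> R -> Prop).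

Definition partition_of a b (N : nat) (u : nat -> R) :=
  [/\ u 0%N = a, u N = b & forall i, (i < N)%N -> u i < u i.+1].

Lemma partition_mono a b N u : partition_of a b N u ->
  forall i j, (i <= j)%N -> (j <= N)%N -> u i <= u j.
Proof.
move=> [_ _ us] i j; elim: j => [|j IH]; first by rewrite leqn0 => /eqP ->.
rewrite leq_eqVlt => /predU1P[->//|ij jN].
by apply: le_trans (IH ij (ltnW jN)) _; apply: ltW; exact: us.
Qed.

Lemma partition_locate a b N u t : partition_of a b N u -> a <= t -> t < b ->
  exists2 i, (i < N)%N & u i <= t /\ t < u i.+1.
Proof.
move=> [u0 uN us] at_ tb.
have : exists i, t < u i by exists N; rewrite uN.
move=> /ex_minnP[[|i] ti min]; first by move: ti; rewrite u0 ltNge at_.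
exists i; last by split => //; rewrite leNgt; apply/negP => /min; rewrite ltnn.
rewrite ltnNge; apply/negP => Ni.
by have := min N; rewrite uN => /(_ tb); rewrite ltnNge (leq_trans Ni).
Qed.

Lemma exists_partition P a b : a <= b ->
  (forall t, a <= t -> t <= b -> exists2 d, 0 < d &
    (forall s, a <= s -> s < t -> t - s < d -> P s t) /\
    (forall s, t < s -> s - t < d -> P t s)) ->
  exists N u, partition_of a b N u /\ forall i, (i < N)%N -> P (u i) (u i.+1).
Proof.
move=> ab loc.
pose chain t := exists N u, partition_of a t N u /\
  forall i, (i < N)%N -> P (u i) (u i.+1).
have extend s t : chain s -> s < t -> P s t -> chain t.
  move=> [N [u [[u0 uN us] Pu]]] st Pst.
  exists N.+1, (fun i => if (i <= N)%N then u i else t).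
  have h i : (i < N.+1)%N -> (i < N)%N \/ i = N.
    by rewrite ltnS leq_eqVlt => /predU1P[->|]; [right|left].
  split; first split => //=; first by rewrite ltnn.
    move=> i iN; rewrite -ltnS iN; case: (h i iN) => [iN'|->]; first by rewrite iN'; exact: us.
    by rewrite ltnn uN.
  move=> i iN; rewrite -ltnS iN; case: (h i iN) => [iN'|->]; first by rewrite iN'; exact: Pu.
  by rewrite ltnn uN.
pose S := [set t | [/\ a <= t, t <= b & chain t]].
have Sa : S a by split => //; exists 0%N, (fun=> a); split.
have hS : has_sup S by split; [exists a|exists b => t []].
pose c := sup S.
have ac : a <= c by apply: ub_le_sup => //; case: hS.
have cb : c <= b by apply: ge_sup => [|t []//]; exists a.
have [d d0 [locl locr]] := loc c ac cb.
have cc : chain c.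
  have [s [as_ sb cs] sc] := sup_adherent d0 hS.
  have : s <= c by apply: ub_le_sup => //; case: hS.
  rewrite le_eqVlt => /predU1P[<-//|sc'].
  by apply: (extend s) => //; apply: locl => //; move: sc; rewrite -/c; lra.
suff -> : b = c by [].
apply/eqP; rewrite eq_le cb andbT leNgt; apply/negP => clb.
pose t := Num.min b (c + d / 2).
have ct : c < t by rewrite lt_min clb /=; lra.
have td : t <= c + d / 2 by rewrite ge_min lexx orbT.
have : t <= c.
  apply: ub_le_sup; first by case: hS.
  split; [lra|by rewrite ge_min lexx|].
  by apply: (extend c) => //; apply: locr => //; lra.
lra.
Qed.

End Partition.

Section Cadlag.
Context {R : realType} {E : normedModType R}.
Implicit Types (f g : R -> E) (a b t eta : R).

(** Leaving out [b] leaves out a jump there, which is why a cadlag path has small oscillation on the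
    intervals of some partition. *)
Definition osc_le f eta a b := forall r s, a <= r -> r < b -> a <= s -> s < b ->
  `|f r - f s| <= eta.

Lemma cadlag_right f t eta : cadlag f -> 0 <= t -> 0 < eta ->
  exists2 d, 0 < d & forall s, t <= s -> s < t + d -> `|f s - f t| <= eta.
Proof.
move=> [rc _] t0 e0; have /cvgrPdist_le /(_ eta e0) := rc t t0.
rewrite near_withinE => -[d /= d0 hd]; exists d => // s.
rewrite le_eqVlt => /predU1P[<-|ts sd]; first by rewrite subrr normr0 ltW.
by rewrite distrC; apply: hd => //=; rewrite ltr0_norm ?subr_lt0// opprB; lra.
Qed.

Lemma leftlim_cvg f t : cadlag f -> 0 < t -> f s @[s --> t^'-] --> leftlim f t.
Proof. by move=> [_ lc] t0; rewrite /leftlim t0; exact: lc. Qed.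

Lemma cadlag_left f t eta : cadlag f -> 0 < t -> 0 < eta ->
  exists2 d, 0 < d &
    forall s, t - d < s -> s < t -> `|f s - leftlim f t| <= eta.
Proof.
move=> cf t0 e0; have /cvgrPdist_le /(_ eta e0) := leftlim_cvg cf t0.
rewrite near_withinE => -[d /= d0 hd]; exists d => // s ds st.
by rewrite distrC; apply: hd => //=; rewrite gtr0_norm ?subr_gt0//; lra.
Qed.

Lemma leftlim0 f : leftlim f 0 = f 0.
Proof. by rewrite /leftlim ltxx. Qed.

Lemma osc_leftlim f eta a b : cadlag f -> 0 <= a -> a < b -> osc_le f eta a b ->
  forall s, a <= s -> s < b -> `|f s - leftlim f b| <= eta.
Proof.
move=> cf a0 ab ocf s as_ sb.
apply: (@ler_addeps _ _ _ 1) => // w w0; rewrite mulr1.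
have [|d d0 hd] := @cadlag_left f b w cf _ w0; first exact: le_lt_trans ab.
pose r := Num.max a (b - d / 2).
have ar : a <= r by rewrite le_max lexx.
have rd : b - d / 2 <= r by rewrite le_max lexx orbT.
have rb : r < b by rewrite gt_max ab /=; lra.
apply: le_trans (ler_distD (f r) _ _) _.
by apply: lerD; [exact: ocf|apply: hd => //; lra].
Qed.

Lemma cadlag_local f t eta : cadlag f -> 0 <= t -> 0 < eta ->
  exists2 d, 0 < d & (forall s, 0 <= s -> s < t -> t - s < d -> osc_le f eta s t) /\
    (forall s, t < s -> s - t < d -> osc_le f eta t s).
Proof.
move=> cf t0 e0.
have e2 : 0 < eta / 2 by lra.
have [d1 d10 h1] := cadlag_right cf t0 e2.
have [d2 d20 h2] : exists2 d, 0 < d & forall s, 0 <= s -> s < t -> t - s < d -> osc_le f eta s t.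
  move: t0; rewrite le_eqVlt => /predU1P[<-|t0].
    by exists 1 => // s s0 s0'; move: (le_lt_trans s0 s0'); rewrite ltxx.
  have [d d0 h] := cadlag_left cf t0 e2; exists d => // s s0 st td r r' sr rt sr' rt'.
  apply: le_trans (ler_distD (leftlim f t) _ _) _.
  have := h r; have := h r'; rewrite (distrC _ (f r')) => k1 k2.
  have := k1 ltac:(lra) rt'; have := k2 ltac:(lra) rt; lra.
exists (Num.min d1 d2); first by rewrite lt_min d10.
split => [s s0 st|s ts]; rewrite lt_min => /andP[l1 l2]; first exact: h2.
move=> r r' tr rs tr' rs'.
apply: le_trans (ler_distD (f t) _ _) _.
have := h1 r tr ltac:(lra); have := h1 r' tr' ltac:(lra); rewrite (distrC _ (f r')); lra.
Qed.

Lemma cadlag_bounded f T : cadlag f -> exists2 F, 0 <= F &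
  forall t, 0 <= t -> t <= T -> `|f t| <= F.
Proof.
move=> cf; case: (leP 0 T) => [T0|T0]; last first.
  by exists 0 => // t t0 tT; move: (le_lt_trans (le_trans t0 tT) T0); rewrite ltxx.
(* The partition goes up to [T + 1] so that [T] itself belongs to a half-open interval. *)
have [N [u [pu osc]]] : exists N u, partition_of 0 (T + 1) N u /\
    forall i, (i < N)%N -> osc_le f 1 (u i) (u i.+1).
  apply: exists_partition; first lra.
  by move=> t t0 _; exact: cadlag_local.
exists (1 + \sum_(0 <= i < N) `|f (u i)|); first by rewrite addr_ge0// sumr_ge0.
move=> t t0 tT; have [|i iN [ut tu]] := partition_locate (t := t) pu t0; first lra.
have [_ _ us] := pu.
have := osc i iN t (u i) ut tu (lexx _) (us i iN) => h.
have : `|f (u i)| <= \sum_(0 <= i < N) `|f (u i)|.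
  rewrite (bigD1_seq i) ?iota_uniq ?mem_index_iota//= lerDl.
  by apply: sumr_ge0.
have : `|f t| <= `|f t - f (u i)| + `|f (u i)| by rewrite -{1}(subrK (f (u i)) (f t)) ler_normD.
lra.
Qed.

(** The energy estimates need an input of bounded variation. [C] is the step path with value f (u i)
    on [u i, u i.+1[, and [V] its running variation; the control holds on the whole line, so it
    survives composition with an increasing time change. *)
Lemma cadlag_BV_approx f T eta : cadlag f -> 0 < eta -> exists (C : R -> E) (V : R -> R),
  (forall x y, x <= y -> `|C y - C x| <= V y - V x) /\
  (forall t, 0 <= t -> t <= T -> `|f t - C t| <= eta).
Proof.
move=> cf e0; case: (leP 0 T) => [T0|T0]; last first.
  exists (fun=> 0), (fun=> 0); split; first by move=> *; rewrite !subrr normr0.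
  by move=> t t0 tT; move: (le_lt_trans (le_trans t0 tT) T0); rewrite ltxx.
have [N [u [pu osc]]] : exists N u, partition_of 0 (T + 1) N u /\
    forall i, (i < N)%N -> osc_le f eta (u i) (u i.+1).
  apply: exists_partition; first lra.
  by move=> t t0 _; exact: cadlag_local.
exists (fun s => f (u 0%N) + \sum_(0 <= i < N) (u i.+1 <= s)%R%:R *: (f (u i.+1) - f (u i))).
exists (fun s => \sum_(0 <= i < N) (u i.+1 <= s)%R%:R * `|f (u i.+1) - f (u i)|).
split=> [x y xy|t t0 tT].
  rewrite opprD addrACA subrr add0r -!sumrB; apply: le_trans (ler_norm_sum _ _ _) _.
  apply: ler_sum => i _; rewrite -scalerBl -mulrBl normrZ ler_wpM2r//.
  rewrite ger0_norm ?subr_ge0// ler_nat.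
  by case: (leP _ x) => //= ux; rewrite (le_trans ux xy).
have [|i iN [ut tu]] := partition_locate (t := t) pu t0; first lra.
have [_ _ us] := pu.
have main j : (j <= N)%N -> \sum_(0 <= k < j) (u k.+1 <= t)%R%:R *: (f (u k.+1) - f (u k)) =
    f (u (minn i j)) - f (u 0%N).
  elim: j => [_|j IH jN]; first by rewrite big_geq// minn0 subrr.
  rewrite big_nat_recr//= IH 1?ltnW//.
  case: (ltnP j i) => ji.
    rewrite ?(minn_idPr (ltnW ji)) (minn_idPr ji).
    have -> : u j.+1 <= t by apply: le_trans ut; apply: (partition_mono pu) => //; exact: ltnW.
    by rewrite scale1r addrC addrA subrK.
  rewrite ?(minn_idPl ji) (minn_idPl (leqW ji)).
  have -> : u j.+1 <= t = false.
    apply/negbTE; rewrite -ltNge; apply: lt_le_trans tu _.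
    exact: (partition_mono pu).
  by rewrite scale0r addr0.
rewrite main// (minn_idPl (ltnW iN)) subrKC.
exact: (osc i iN _ _ ut tu (lexx _) (us i iN)).
Qed.

End Cadlag.

(** * Control functions for paths of bounded variation and their jumps *)

Section Variation.
Context {R : realType} {E : normedModType R}.
Implicit Types (k : R -> E) (s t : R).

(** The control is the variation on [0, t]: appending [t] to a partition of [0, s] shows that it
    grows by at least the increment of [k]. *)
Lemma BVloc_control k : BVloc k -> exists v : R -> R,
  forall s t, 0 <= s -> s <= t -> `|k t - k s| <= v t - v s.
Proof.
move=> bv; exists (fun t => fine (vtotal_variation 0 t k)).
have fin t : 0 <= t -> vtotal_variation 0 t k \is a fin_num.
  move=> t0; rewrite ge0_fin_numE; first exact: bv.
  have [l pl] : exists l, itv_partition 0 t l.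
    case: (ltrP 0 t) => [tp|t0'].
      by exists [:: t]; rewrite /itv_partition /= tp.
    by exists [::]; rewrite /itv_partition /=; split => //; rewrite eq_le t0 t0'.
  apply: (@le_trans _ _ (\sum_(0 <= n < size l)
      `|(k \o nth t (0 :: l)) n.+1 - (k \o nth t (0 :: l)) n|)%:E).
    by rewrite lee_fin; apply: sumr_ge0.
  by apply: ereal_sup_ubound; exists l.
move=> s t s0; rewrite le_eqVlt => /predU1P[->|st]; first by rewrite !subrr normr0.
have t0 : 0 <= t by apply: le_trans s0 (ltW st).
rewrite lerBrDl -lerBrDr -lee_fin EFinB !fineK ?fin//.
apply: ge_ereal_sup => _ [l [pl /eqP lasts] <-].
rewrite leeBrDr// -EFinD.
apply: ereal_sup_ubound; exists (rcons l t).
  by split; [rewrite rcons_path pl lasts|rewrite last_rcons].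
congr EFin; rewrite /= size_rcons big_nat_recr//= -!rcons_cons; congr (_ + _).
  apply: eq_big_nat => n /andP[_ nl].
  have -> : nth t (rcons l t) n = nth s l n.
    by rewrite nth_rcons nl; exact: set_nth_default.
  have -> // : nth t (rcons (0 :: l) t) n = nth s (0 :: l) n.
  rewrite nth_rcons /= ltnS (ltnW nl); apply: set_nth_default.
  by rewrite /= ltnS ltnW.
by rewrite !nth_rcons /= ltnn eqxx ltnSn -last_nth lasts.
Qed.

Variables (k : R -> E) (v : R -> R).
Hypothesis ck : cadlag k.
Hypothesis kv : forall s t, 0 <= s -> s <= t -> `|k t - k s| <= v t - v s.

Lemma control_mono s t : 0 <= s -> s <= t -> v s <= v t.
Proof. by move=> s0 st; rewrite -subr_ge0; apply: le_trans (kv s0 st). Qed.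

Lemma jump_control s t : 0 <= s -> s < t -> `|jump k t| <= v t - v s.
Proof.
move=> s0 st; apply: (@ler_addeps _ _ _ 1) => // w w0; rewrite mulr1.
have [d d0 hd] := cadlag_left ck (le_lt_trans s0 st) w0.
pose r := Num.max s (t - d / 2).
have sr : s <= r by rewrite le_max lexx.
have rd : t - d / 2 <= r by rewrite le_max lexx orbT.
have rb : r < t by rewrite gt_max st /=; lra.
have h1 := hd r ltac:(lra) rb.
have h2 := kv (le_trans s0 sr) (ltW rb).
have h3 := control_mono s0 sr.
have := ler_distD (k r) (k t) (leftlim k t); rewrite /jump; lra.
Qed.

(** Once sorted, the times cut ]s, t] into consecutive intervals, and each jump is bounded by the
    increment of [v] over its own interval. The maximum covers an empty list with t < s. *)
Lemma sum_jump_control s t (l : seq R) : 0 <= s -> uniq l ->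
  (forall r, r \in l -> s < r /\ r <= t) ->
  \sum_(r <- l) `|jump k r| <= v (Num.max s t) - v s.
Proof.
move=> s0 ul lst.
have pl : perm_eq l (sort <=%O l) by rewrite perm_sym perm_sort.
rewrite (perm_big _ pl) /=.
have : sorted <%O (sort <=%O l) by rewrite sort_lt_sorted.
have {lst} : forall r, r \in sort <=%O l -> s < r /\ r <= t.
  by move=> r; rewrite mem_sort => /lst.
move: (sort <=%O l) => {ul pl} m.
elim: m s s0 => [|y m IH] s s0 mst srt.
  by rewrite big_nil subr_ge0; apply: control_mono => //; rewrite le_max lexx.
have [sy yt] := mst y (mem_head _ _).
rewrite big_cons.
have h1 := jump_control s0 sy.
have y0 : 0 <= y by apply: le_trans s0 (ltW sy).
have h2 : \sum_(r <- m) `|jump k r| <= v (Num.max y t) - v y.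
  apply: IH => //; last exact: path_sorted srt.
  move=> r rm; split; last by have [] := mst r; rewrite ?inE ?rm ?orbT.
  move: srt => /= /(order_path_min lt_trans) /allP; exact.
move: h2; rewrite (max_idPr yt) (max_idPr (ltW (lt_le_trans sy yt))); lra.
Qed.

End Variation.

(** * The Skorokhod problem *)

Section DiscontinuousPart.
Context {R : realType} {E : completeNormedModType R}.
Variables (k : R -> E) (v : R -> R).
Hypothesis ck : cadlag k.
Hypothesis kv : forall s t, 0 <= s -> s <= t -> `|k t - k s| <= v t - v s.
Implicit Types (s t : R).

Let totally_proper :
  ProperFilter (summability.totally : set_system (finmap.finSet R)).
Proof. exact: summability.totally_filter. Qed.

Lemma jump0 : jump k 0 = 0.
Proof. by rewrite /jump leftlim0 subrr. Qed.

Lemma partial_sum_jump s t (F : finmap.finSet R) : 0 <= s ->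
  \sum_(r <- finmap.enum_fset F | (s < r) && (r <= t)) `|jump k r| <= v (Num.max s t) - v s.
Proof.
move=> s0; rewrite -big_filter; apply: (sum_jump_control ck kv s0).
  by rewrite filter_uniq ?finmap.fset_uniq.
by move=> r; rewrite mem_filter => /andP[/andP[]].
Qed.

Lemma partial_sum_patch t (F : finmap.finSet R) :
  summability.partial_sum (patch (fun=> 0) `[0, t] (jump k)) F =
  \sum_(r <- finmap.enum_fset F | (0 < r) && (r <= t)) jump k r.
Proof.
rewrite /summability.partial_sum -(finmap.big_seq_fsetE _ _ xpredT) /= [RHS]big_mkcond /=.
apply: eq_bigr => r _; rewrite /patch mem_setE in_itv /=.
case: (ltrgtP 0 r) => // <-; by rewrite jump0; case: ifP.
Qed.

(** The sums of jump norms over finite sets are bounded by [v]. A finite set whose norm sum almost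
    attains the supremum gives the Cauchy property, since enlarging it changes the sum of the jumps
    by less than the remaining gap. *)
Lemma discontinuous_part_cvg t :
  cvg (summability.partial_sum (patch (fun=> 0) `[0, t] (jump k)) @ summability.totally).
Proof.
have PF := totally_proper.
apply/cauchy_cvgP/cauchyP => /= e e0.
pose N (F : finmap.finSet R) := \sum_(r <- finmap.enum_fset F | (0 < r) && (r <= t)) `|jump k r|.
pose S := [set N F | F in [set: finmap.finSet R]].
have hS : has_sup S.
  split; first by exists (N finmap.fset0), finmap.fset0.
  exists (v (Num.max 0 t) - v 0) => _ [F _ <-]; exact: partial_sum_jump.
have [_ [F0 _ <-] supF0] := sup_adherent e0 hS.
exists (summability.partial_sum (patch (fun=> 0) `[0, t] (jump k)) F0).
exists F0 => // F /= F0F.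
rewrite -ball_normE /= !partial_sum_patch distrC.
have NF : N F <= sup S by apply: ub_le_sup; [case: hS|exists F].
have perm : perm_eq (finmap.enum_fset F) (finmap.enum_fset F0 ++ finmap.enum_fset (finmap.fsetD F F0)).
  apply: uniq_perm; first exact: finmap.fset_uniq.
    rewrite cat_uniq !finmap.fset_uniq /= andbT; apply/hasPn => r.
    by rewrite /= finmap.in_fsetD => /andP[].
  move=> r; rewrite mem_cat finmap.in_fsetD.
  case: (boolP (r \in finmap.enum_fset F0)) => //= rF0.
  by have /finmap.fsubsetP /(_ _ rF0) := F0F.
rewrite (perm_big _ perm) /= big_cat /= addrAC subrr add0r.
apply: le_lt_trans (ler_norm_sum _ _ _) _.
have : N F = N F0 + \sum_(r <- finmap.enum_fset (finmap.fsetD F F0) | (0 < r) && (r <= t)) `|jump k r|.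
  by rewrite /N (perm_big _ perm) /= big_cat.
lra.
Qed.

Lemma discontinuous_part_increment s t w : 0 <= s -> s <= t -> 0 < w ->
  exists F : finmap.finSet R, `|discontinuous_part k t - discontinuous_part k s -
    \sum_(r <- finmap.enum_fset F | (s < r) && (r <= t)) jump k r| <= w.
Proof.
move=> s0 st w0; have w2 : 0 < w / 2 by lra.
have PF := totally_proper.
have /cvgrPdist_le /(_ _ w2) [F1 _ h1] := discontinuous_part_cvg (t := t).
have /cvgrPdist_le /(_ _ w2) [F2 _ h2] := discontinuous_part_cvg (t := s).
pose F := finmap.fsetU F1 F2; exists F.
have := h1 F (finmap.fsubsetUl _ _); have := h2 F (finmap.fsubsetUr _ _).
rewrite /= !partial_sum_patch -!/(summability.sum _) -!/(discontinuous_part _ _).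
have -> : \sum_(r <- finmap.enum_fset F | (0 < r) && (r <= t)) jump k r =
    \sum_(r <- finmap.enum_fset F | (0 < r) && (r <= s)) jump k r +
    \sum_(r <- finmap.enum_fset F | (s < r) && (r <= t)) jump k r.
  rewrite big_mkcond [X in _ = X + _]big_mkcond [X in _ = _ + X]big_mkcond -big_split /=.
  apply: eq_bigr => r _; case: (leP r s) => rs.
    rewrite (le_trans rs st) addr0; by [].
  by rewrite (le_lt_trans s0 rs) andbF add0r.
move: (discontinuous_part k t) (discontinuous_part k s) => dt ds.
move: (\sum_(_ <- _ | _) _) (\sum_(_ <- _ | _) _) => S1 S2 k2 k1.
have -> : dt - ds - S1 = (dt - (S2 + S1)) - (ds - S2).
  by rewrite [S2 + S1]addrC opprD addrA opprB subrKA addrAC.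
apply: le_trans (ler_normB _ _) _; lra.
Qed.

Lemma discontinuous_part_control s t : 0 <= s -> s <= t ->
  `|discontinuous_part k t - discontinuous_part k s| <= v t - v s.
Proof.
move=> s0 st; apply: (@ler_addeps _ _ _ 1) => // w w0; rewrite mulr1.
have [F hF] := discontinuous_part_increment s0 st w0.
have h := partial_sum_jump t F s0; rewrite (max_idPr st) in h.
have : `|\sum_(r <- finmap.enum_fset F | (s < r) && (r <= t)) jump k r| <=
    \sum_(r <- finmap.enum_fset F | (s < r) && (r <= t)) `|jump k r|.
  exact: ler_norm_sum.
have := ler_normB (discontinuous_part k t - discontinuous_part k s - \sum_(r <- finmap.enum_fset F | (s < r) && (r <= t)) jump k r) (- \sum_(r <- finmap.enum_fset F | (s < r) && (r <= t)) jump k r).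
rewrite opprK subrK normrN; lra.
Qed.

End DiscontinuousPart.

Section SkorokhodFlow.
Context {R : realType} {H : completeNormedModType R} {ip : {dot H for idfun}}.
Hypothesis hip : induces_norm ip.
Context {A : H -> set H}.
Hypothesis hA : maximal_monotone ip A.
Hypothesis A_neq0 : dom A !=set0.
Variables (m x k : R -> H) (v : R -> R).
Hypothesis cm : cadlag m.
Hypothesis SP : skorokhod_problem ip A (projection (closure (dom A))) m x k.
Hypothesis kv : forall s t, 0 <= s -> s <= t -> `|k t - k s| <= v t - v s.
Let cx := sp_cadlag_x SP.
Let ck := sp_cadlag_k SP.

Lemma leftlim_eq t : 0 <= t -> leftlim x t + leftlim k t = leftlim m t.
Proof.
rewrite le_eqVlt => /predU1P[<-|t0].
  by rewrite !leftlim0; apply: (sp_eq SP).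
have h : x s + k s @[s --> t^'-] --> leftlim x t + leftlim k t.
  by apply: cvgD; exact: leftlim_cvg.
apply: esym; rewrite {1}/leftlim t0; apply/cvg_lim => //.
apply: cvg_trans h; apply: near_eq_cvg.
near=> s; apply: (sp_eq SP).
by near: s; exact: nbhs_left_ge.
Unshelve. all: by end_near. Qed.

(** The jump of [k] is [leftlim x t + jump m t] minus its projection [x t], hence normal to the
    closed domain at [x t]. *)
Lemma sp_jump_normal t q : 0 <= t -> closure (dom A) q -> 0 <= ip (x t - q) (jump k t).
Proof.
move=> t0 Kq; have xt := sp_jump SP t0.
have [_ var _] := projectionP hip hA A_neq0 (leftlim x t + jump m t).
have := var q Kq; rewrite -xt ipC.
have -> // : leftlim x t + jump m t - x t = jump k t.
apply: (ip_inj hip) => u.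
by rewrite /jump -(leftlim_eq t0) -(sp_eq SP t0) !ipE; ring.
Qed.

(** The differential inclusion governs the continuous part only; jumps inside the interval are
    handled by [sp_jump_normal], [al] being in the domain. Freezing the position at [x s] costs
    [eta] per unit of variation: twice [v] for the continuous part, as the difference of [k] and its
    jump sum, and once for the jumps, hence the factor 3. *)
Lemma sp_flow_right eta s t al be : 0 <= s -> s <= t -> osc_le x eta s t ->
  A al be -> forall t', s <= t' -> t' < t ->
  - (eta * (3 * (v t' - v s) + `|be| * (t' - s))) <=
  ip (x s - al) (k t' - k s - (t' - s) *: be).
Proof.
move=> s0 st osc Aab t' st' t't.
have [F F0 bF] := cadlag_bounded t cx.
have t'0 : 0 <= t' := le_trans s0 st'.
have [w LSw w0] := sp_inclusion SP s0 st' Aab.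
have om0 a b : s <= a -> a <= b -> b <= t' ->
    `|continuous_part k b - b *: be - (continuous_part k a - a *: be)| <=
    (2 * v b + `|be| * b) - (2 * v a + `|be| * a).
  move=> sa ab bt; have a0 := le_trans s0 sa.
  have -> : continuous_part k b - b *: be - (continuous_part k a - a *: be) =
      (k b - k a) - (discontinuous_part k b - discontinuous_part k a) - (b - a) *: be.
    by apply: (ip_inj hip) => u; rewrite /continuous_part !ipE; ring.
  apply: le_trans (ler_normB _ _) _; rewrite normrZ ger0_norm ?subr_ge0//.
  have := ler_normB (k b - k a) (discontinuous_part k b - discontinuous_part k a).
  have := kv a0 ab; have := discontinuous_part_control ck kv a0 ab; lra.
have := LS_lower_bound hip (F := F + `|al|) (f0 := x s - al) (de := eta)
  (om := fun r => 2 * v r + `|be| * r) st' LSw.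
move=> h1.
have {h1} : w - eta * ((2 * v t' + `|be| * t') - (2 * v s + `|be| * s)) <=
   ip (x s - al) (continuous_part k t' - t' *: be - (continuous_part k s - s *: be)).
  apply: h1 => //.
  - move=> y sy yt; apply: cvgB; last exact: cvg_cst.
    by apply: cx.1; exact: le_trans sy.
  - move=> y sy yt; apply: le_trans (ler_normB _ _) _; rewrite lerD2r bF//.
      exact: le_trans sy.
    by apply: le_trans yt (ltW t't).
  - move=> y sy yt; rewrite opprB addrA subrK; apply: osc => //.
      exact: le_lt_trans t't.
    exact: le_lt_trans st' t't.
have h2 : - (eta * (v t' - v s)) <= ip (x s - al) (discontinuous_part k t' - discontinuous_part k s).
  apply: (@ler_addeps _ _ _ (`|x s - al|)) => // e e0.
  have [G hG] := discontinuous_part_increment ck kv s0 st' e0.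
  have h := partial_sum_jump ck kv t' G s0; rewrite (max_idPr st') in h.
  have eta0 : 0 <= eta.
    apply: le_trans (osc s s _ _ _ _) => //; exact: le_lt_trans t't.
  have : - (eta * (v t' - v s)) <= ip (x s - al) (\sum_(r <- finmap.enum_fset G | (s < r) && (r <= t')) jump k r).
    apply: (@le_trans _ _ (\sum_(r <- finmap.enum_fset G | (s < r) && (r <= t')) (- eta * `|jump k r|))).
      by rewrite -mulr_sumr mulNr lerN2 ler_wpM2l.
    rewrite linear_sumr /=; apply: ler_sum => r /andP[sr rt].
    have r0 : 0 <= r by apply: le_trans s0 (ltW sr).
    have Kal : closure (dom A) al by apply: subset_closure; exists be.
    have := sp_jump_normal r0 Kal.
    have := ip_ge hip (x s - x r) (jump k r).
    have : `|x s - x r| * `|jump k r| <= eta * `|jump k r|.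
      rewrite ler_wpM2r//; apply: osc => //; first exact: le_lt_trans t't.
        exact: ltW.
      exact: le_lt_trans t't.
    rewrite !ipE; lra.
  have := ip_ge hip (x s - al) (discontinuous_part k t' - discontinuous_part k s -
     \sum_(r <- finmap.enum_fset G | (s < r) && (r <= t')) jump k r).
  have := ler_wpM2l (normr_ge0 (x s - al)) hG.
  move: (\sum_(_ <- _ | _) _) => S; rewrite !ipDr !ipNr; lra.
have -> : k t' - k s - (t' - s) *: be =
   (continuous_part k t' - t' *: be - (continuous_part k s - s *: be)) +
   (discontinuous_part k t' - discontinuous_part k s).
  by apply: (ip_inj hip) => u; rewrite /continuous_part !ipE; ring.
rewrite ipDr; lra.
Qed.

(** Limit of [sp_flow_right] from the left of [t]: at [t] itself [x] may jump by more than [eta], so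
    only the left limit of [k] appears. *)
Lemma sp_flow eta s t al be : 0 <= s -> s < t -> osc_le x eta s t -> A al be ->
  - (eta * (3 * (v t - v s) + `|be| * (t - s))) <=
  ip (x s - al) (leftlim k t - k s - (t - s) *: be).
Proof.
move=> s0 st osc Aab.
have eta0 : 0 <= eta.
  by apply: le_trans (osc s s _ _ _ _) => //.
apply: (@ler_addeps _ _ _ (`|x s - al| * (1 + `|be|))).
  by rewrite mulr_ge0// addr_ge0.
move=> w w0.
have [d d0 hd] := cadlag_left ck (le_lt_trans s0 st) w0.
pose r := Num.max s (t - Num.min (d / 2) w).
have dw0 : 0 < Num.min (d / 2) w by rewrite lt_min w0 andbT; lra.
have dw1 : Num.min (d / 2) w <= d / 2 by rewrite ge_min lexx.
have dw2 : Num.min (d / 2) w <= w by rewrite ge_min lexx orbT.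
have sr : s <= r by rewrite le_max lexx.
have rd : t - Num.min (d / 2) w <= r by rewrite le_max lexx orbT.
have rt : r < t by rewrite gt_max st /=; lra.
have h := sp_flow_right s0 (ltW st) osc Aab sr rt.
have h1 := hd r ltac:(lra) rt.
have vm := control_mono kv (le_trans s0 sr) (ltW rt).
have hb : `|be| * (t - r) <= `|be| * w by rewrite ler_wpM2l//; lra.
have hb' : `|be| * (r - s) <= `|be| * (t - s) by rewrite ler_wpM2l//; lra.
have e1 : eta * (3 * (v r - v s) + `|be| * (r - s)) <= eta * (3 * (v t - v s) + `|be| * (t - s)).
  by rewrite ler_wpM2l//; lra.
have -> : leftlim k t - k s - (t - s) *: be =
   (k r - k s - (r - s) *: be) + ((leftlim k t - k r) - (t - r) *: be).
  by apply: (ip_inj hip) => u; rewrite !ipE; ring.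
rewrite ipDr.
have := ip_ge hip (x s - al) ((leftlim k t - k r) - (t - r) *: be).
have : `|x s - al| * `|(leftlim k t - k r) - (t - r) *: be| <= `|x s - al| * (w * (1 + `|be|)).
  rewrite ler_wpM2l//; apply: le_trans (ler_normB _ _) _.
  rewrite normrZ gtr0_norm ?subr_gt0// distrC; lra.
lra.
Qed.

End SkorokhodFlow.

(** * The Euler scheme *)

Lemma big_nat_double {V : nmodType} (F : nat -> V) n :
  \sum_(0 <= j < n.*2) F j = \sum_(0 <= i < n) (F i.*2 + F i.*2.+1).
Proof.
elim: n => [|n IH]; first by rewrite !big_geq.
by rewrite doubleS !big_nat_recr//= IH addrA.
Qed.

Lemma ler_sum_telescope {R : realType} (F f : nat -> R) n :
  (forall j, (j < n)%N -> F j <= f j.+1 - f j) ->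
  \sum_(0 <= j < n) F j <= f n - f 0%N.
Proof.
elim: n => [_|n IH Ff]; first by rewrite big_geq// subrr.
rewrite big_nat_recr//=; have := Ff n (ltnSn n).
have := IH (fun j jn => Ff j (ltnW jn)); lra.
Qed.

Lemma leftlim_control {R : realType} {E : normedModType R} (k : R -> E) (v : R -> R) s t :
  cadlag k -> (forall s t, 0 <= s -> s <= t -> `|k t - k s| <= v t - v s) ->
  0 <= s -> s < t -> `|leftlim k t - k s| <= v t - v s.
Proof.
move=> ck kv s0 st; apply: (@ler_addeps _ _ _ 1) => // w w0; rewrite mulr1.
have [d d0 hd] := cadlag_left ck (le_lt_trans s0 st) w0.
pose r := Num.max s (t - d / 2).
have sr : s <= r by rewrite le_max lexx.
have rd : t - d / 2 <= r by rewrite le_max lexx orbT.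
have rb : r < t by rewrite gt_max st /=; lra.
have h1 := hd r ltac:(lra) rb.
have h2 := kv _ _ s0 sr.
have h3 := control_mono kv (le_trans s0 sr) (ltW rb).
have := ler_distD (k r) (leftlim k t) (k s); rewrite (distrC (leftlim k t) (k r)); lra.
Qed.

Section Euler.
Context {R : realType} {H : completeNormedModType R} {ip : {dot H for idfun}}.
Hypothesis hip : induces_norm ip.
Context {A : H -> set H}.
Hypothesis hA : maximal_monotone ip A.
Hypothesis A_neq0 : dom A !=set0.
Variables (a : H) (r c : R).
Hypotheses (r0 : 0 < r) (c0 : 0 <= c) (ball_a : forall q, `|q - a| <= r -> dom A q)
  (coer : forall al be, A al be -> r * `|be| <= ip be (al - a) + c * (1 + `|al - a|)).
Let K := closure (dom A).
Let Pi := projection K.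
Let monA := hA.1.

(** The normal inequality is tested at the point of the ball around [a] in the direction [n]. It
    plays for projections the role that [coer] plays for slopes, with no additive constant. *)
Lemma normal_coercive z n : (forall q, K q -> 0 <= ip n (z - q)) ->
  r * `|n| <= ip n (z - a).
Proof.
move=> nz; have [->|n0] := eqVneq n 0; first by rewrite ip0l normr0 mulr0.
have nn : 0 < `|n| by rewrite normr_gt0.
have Kq : K (a + (r / `|n|) *: n).
  apply/subset_closure/ball_a; rewrite addrAC subrr add0r normrZ normrM normfV.
  by rewrite normr_id divfK ?gt_eqF// ger0_norm// ltW.
have := nz _ Kq; rewrite opprD addrA ipDr ipNr ipZr -(sqr_norm hip).
have -> : r / `|n| * `|n| ^+ 2 = r * `|n| by field; rewrite gt_eqF.
lra.
Qed.

Variables (m x k : R -> H) (v : R -> R) (T : R).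
Hypothesis T0 : 0 < T.
Hypothesis cm : cadlag m.
Hypothesis m0K : K (m 0).
Hypothesis SP : skorokhod_problem ip A Pi m x k.
Hypothesis kv : forall s t, 0 <= s -> s <= t -> `|k t - k s| <= v t - v s.

(* Implicit Euler scheme on [u]: over [u i, u i.+1[ a resolvent step leads from
   [X i] to [Z i] with slope [be i]; at [u i.+1] the jump of [m] is followed by
   a projection, with increment [n i.+1]. *)
Record euler_scheme N (u : nat -> R) (X Z n be : nat -> H) : Prop := EulerScheme {
  eu_X0 : X 0%N = m 0 ;
  eu_n0 : n 0%N = 0 ;
  eu_A : forall i, (i < N)%N -> A (Z i) (be i) ;
  eu_Z : forall i, (i < N)%N ->
    Z i + (u i.+1 - u i) *: be i = X i + (leftlim m (u i.+1) - m (u i)) ;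
  eu_X : forall i, (i < N)%N -> X i.+1 = Pi (Z i + jump m (u i.+1)) ;
  eu_n : forall i, (i < N)%N -> X i.+1 + n i.+1 = Z i + jump m (u i.+1) ;
  eu_K : forall i, (i <= N)%N -> K (X i) ;
  eu_normal : forall i, (i <= N)%N -> forall q, K q -> 0 <= ip (n i) (X i - q) }.

Lemma euler_exists N u : partition_of 0 T N u ->
  exists X Z n be, euler_scheme N u X Z n be.
Proof.
move=> [u0 uN us].
pose h i := u i.+1 - u i.
pose inc i := leftlim m (u i.+1) - m (u i).
pose X := fix X (i : nat) : H := if i is j.+1 then
  Pi (resolvent A (h j) (X j + inc j) + jump m (u j.+1)) else m 0.
pose Z i := resolvent A (h i) (X i + inc i).
pose n i := if i is j.+1 then Z j + jump m (u j.+1) - X j.+1 else 0.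
exists X, Z, n, (fun i => yosida A (h i) (X i + inc i)).
have h0 i : (i < N)%N -> 0 < h i by move=> iN; rewrite subr_gt0 us.
split => //.
- by move=> i iN; apply: (yosida_mem hip hA A_neq0); exact: h0.
- by move=> i iN; apply: (resolventE hip hA A_neq0); exact: h0.
- by move=> i iN; rewrite /n addrC subrK.
- by case=> [|i] iN //=; have [] := projectionP hip hA A_neq0 (Z i + jump m (u i.+1)).
- case=> [|i] iN q Kq; first by rewrite ip0l.
  by have [_ var _] := projectionP hip hA A_neq0 (Z i + jump m (u i.+1)); exact: var.
Qed.

(** [discrete_BV] is run with two indices per interval: the even index 2 i stands for [X i] at time
    [u i], the odd index 2 i + 1 for [Z i] just before [u i.+1]. The compensator then increases
    alternately by (u i.+1 - u i) be i and by [n i.+1], and projection steps have duration 0. *)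
Lemma euler_BV : exists2 B, 0 <= B & forall N u X Z n be eta,
  partition_of 0 T N u -> euler_scheme N u X Z n be -> eta <= r / 4 ->
  (forall i, (i < N)%N -> osc_le m eta (u i) (u i.+1)) ->
  \sum_(0 <= i < N) ((u i.+1 - u i) * `|be i| + `|n i.+1|) <= B.
Proof.
(* Of the allowed r / 2, one half pays for approximating [m] by [C], the other for the oscillation
   of [m] up to the left limit at odd indices. *)
have r4 : 0 < r / 4 by rewrite divr_gt0.
have [C [V [CV mC]]] := cadlag_BV_approx T cm r4.
have VT : 0 <= V T - V 0 by apply: le_trans (CV 0 T (ltW T0)).
have [B [B0 hB]] := discrete_BV hip r0 c0 (ltW T0) VT (normr_ge0 (C 0 - a)).
exists B => // N u X Z n be eta pu eu eta4 osc.
have [u0 uN us] := pu.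
have um i : (i <= N)%N -> 0 <= u i /\ u i <= T.
  by move=> iN; split; [rewrite -u0|rewrite -uN]; apply: (partition_mono pu).
pose MM j := if odd j then leftlim m (u j./2.+1) else m (u j./2).
pose XX j := if odd j then Z j./2 else X j./2.
pose KK j := MM j - XX j.
pose CC j := C (u j./2).
pose hh j := if odd j then 0 else u j./2.+1 - u j./2.
have Kev i : (i < N)%N -> KK i.*2.+1 - KK i.*2 = (u i.+1 - u i) *: be i.
  move=> iN; rewrite /KK /MM /XX /= odd_double /= uphalf_double doubleK.
  apply: (ip_inj hip) => w.
  have : ip (Z i + (u i.+1 - u i) *: be i) w = ip (X i + (leftlim m (u i.+1) - m (u i))) w.
    by rewrite (eu_Z eu iN).
  rewrite !ipE; lra.
have Kod i : (i < N)%N -> KK i.+1.*2 - KK i.*2.+1 = n i.+1.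
  move=> iN; rewrite /KK /MM /XX /= odd_double /= uphalf_double doubleK.
  apply: (ip_inj hip) => w.
  have : ip (X i.+1 + n i.+1) w = ip (Z i + jump m (u i.+1)) w.
    by rewrite (eu_n eu iN).
  rewrite /jump !ipE; lra.
have h0 i : (i < N)%N -> 0 < u i.+1 - u i by move=> iN; rewrite subr_gt0 us.
have := hB a XX KK CC hh N.*2.
rewrite !big_nat_double.
have -> : \sum_(0 <= i < N) (`|KK i.*2.+1 - KK i.*2| + `|KK i.*2.+2 - KK i.*2.+1|) =
   \sum_(0 <= i < N) ((u i.+1 - u i) * `|be i| + `|n i.+1|).
  apply: eq_big_nat => i /andP[_ iN].
  rewrite -[i.*2.+2]doubleS Kod// Kev// normrZ gtr0_norm//; exact: h0.
have cases j : (j < N.*2)%N -> exists2 i, (i < N)%N & j = i.*2 \/ j = i.*2.+1.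
  move=> jN; exists j./2; first by rewrite ltn_half_double.
  by have := odd_double_half j; case: (odd j) => /= jE; [right|left]; rewrite -[LHS]jE ?add0n ?add1n.
apply.
- by rewrite /KK /MM /XX /= (eu_X0 eu) u0 subrr.
- by rewrite /CC /= u0.
- move=> j jN; rewrite /KK subrKC /MM /CC.
  case: ifP => jo; last first.
    have [j20 j2T] : 0 <= u j./2 /\ u j./2 <= T.
      by apply: um; rewrite -(doubleK N) half_leq.
    apply: le_trans (mC _ j20 j2T) _.
    by rewrite ler_pM2l// lef_pV2 ?posrE// ler_nat.
  have jN' : (j./2 < N)%N.
    rewrite ltn_half_double ltn_neqAle jN andbT; apply/eqP => jE.
    by move: jo; rewrite jE odd_double.
  have [j20 j2T] := um j./2 (ltnW jN').
  have h1 := mC _ j20 j2T.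
  have h2 := osc_leftlim cm j20 (us _ jN') (osc _ jN') (lexx _) (us _ jN').
  apply: le_trans (ler_distD (m (u j./2)) _ _) _.
  rewrite distrC in h2; lra.
- move=> j /cases[i iN [->|->]]; rewrite /hh /= odd_double//= doubleK.
  by apply: ltW; exact: h0.
- move=> j /cases[i iN [->|->]].
    rewrite Kev// /hh /XX /= odd_double /= uphalf_double doubleK.
    rewrite normrZ gtr0_norm ?h0// ipZl.
    have := ler_wpM2l (ltW (h0 i iN)) (coer (eu_A eu iN)); lra.
  rewrite -[i.*2.+2]doubleS Kod// /hh /XX /= odd_double /= doubleK mul0r addr0.
  by apply: normal_coercive; exact: (eu_normal eu).
- have -> : \sum_(0 <= i < N) (hh i.*2 + hh i.*2.+1) = \sum_(0 <= i < N) (u i.+1 - u i).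
    by apply: eq_big_nat => i _; rewrite /hh /= odd_double /= doubleK addr0.
  have := @ler_sum_telescope _ (fun i => u i.+1 - u i) u N (fun _ _ => lexx _).
  rewrite u0 uN; lra.
- have -> : V T - V 0 = V (u N) - V (u 0%N) by rewrite u0 uN.
  apply: (ler_sum_telescope (f := V \o u)) => i iN.
  rewrite /CC /= uphalf_double doubleK subrr normr0 add0r.
  by apply: CV; apply: ltW; exact: us.
Qed.

(** The scheme and [x] receive exactly the same increments of [m], so the mismatch in [energy_step]
    is 0 and the only error is the oscillation of [x] inside an interval. *)
Lemma euler_close N u X Z n be eta B : 0 <= eta ->
  partition_of 0 T N u -> euler_scheme N u X Z n be ->
  (forall i, (i < N)%N -> osc_le x eta (u i) (u i.+1)) ->
  \sum_(0 <= i < N) ((u i.+1 - u i) * `|be i| + `|n i.+1|) <= B ->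
  let D := eta * (8 * (v T - v 0) + 4 * B) in
  (forall i, (i <= N)%N -> ip (X i - x (u i)) (X i - x (u i)) <= D) /\
  (forall i, (i < N)%N ->
     ip (Z i - leftlim x (u i.+1)) (Z i - leftlim x (u i.+1)) <= D).
Proof.
move=> eta0 pu eu osc sumB /=.
have [u0 uN us] := pu.
have cx := sp_cadlag_x SP; have ck := sp_cadlag_k SP.
have um i : (i <= N)%N -> 0 <= u i by move=> iN; rewrite -u0; exact: (partition_mono pu).
have h0 i : (i < N)%N -> 0 < u i.+1 - u i by move=> iN; rewrite subr_gt0 us.
(* Freezing [x] in [sp_flow] costs 3 parts of variation of [k] and one of the scheme; going from
   [x (u i)] to the left limit costs one more of each. The sums 4 and 2 are doubled by
   [energy_step]. *)
pose rho i := eta * (8 * (v (u i.+1) - v (u i)) + 4 * ((u i.+1 - u i) * `|be i| + `|n i.+1|)).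
have rho0 i : (i < N)%N -> 0 <= rho i.
  move=> iN; rewrite mulr_ge0// addr_ge0//.
    by rewrite mulr_ge0// subr_ge0; apply: (control_mono kv (um _ (ltnW iN))); exact/ltW/us.
  by rewrite mulr_ge0// addr_ge0// mulr_ge0// ltW// h0.
have flow i : (i < N)%N -> ip (Z i - leftlim x (u i.+1)) (Z i - leftlim x (u i.+1)) <=
    ip (X i - x (u i)) (X i - x (u i)) + rho i.
  move=> iN; have ui := um i (ltnW iN); have hi := h0 i iN.
  have hf := sp_flow hip hA A_neq0 SP kv ui (us i iN) (osc i iN) (eu_A eu iN).
  have hl := osc_leftlim cx ui (us i iN) (osc i iN) (lexx _) (us i iN).
  have hk := leftlim_control ck kv ui (us i iN).
  pose q0 := x (u i) - X i; pose q1 := leftlim x (u i.+1) - Z i.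
  have dq : q1 - q0 = (u i.+1 - u i) *: be i - (leftlim k (u i.+1) - k (u i)).
    apply: (ip_inj hip) => w.
    have E1 : ip (Z i + (u i.+1 - u i) *: be i) w = ip (X i + (leftlim m (u i.+1) - m (u i))) w.
      by rewrite (eu_Z eu iN).
    have E2 : ip (leftlim x (u i.+1) + leftlim k (u i.+1)) w = ip (leftlim m (u i.+1)) w.
      by rewrite (leftlim_eq SP) ?um.
    have E3 : ip (x (u i) + k (u i)) w = ip (m (u i)) w by rewrite (sp_eq SP).
    move: E1 E2 E3; rewrite /q0 /q1 !ipE; lra.
  have ndq : `|q1 - q0| <= (u i.+1 - u i) * `|be i| + (v (u i.+1) - v (u i)).
    rewrite dq; apply: le_trans (ler_normB _ _) _.
    by rewrite normrZ gtr0_norm// lerD2l.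
  have := @energy_step _ _ _ hip q0 q1 0 (- q1) 0 (rho i / 2).
  rewrite normr0 mul0r !add0r opprK.
  have -> : 2 * (rho i / 2) = rho i by field.
  have -> : ip q0 q0 = ip (X i - x (u i)) (X i - x (u i)) by rewrite /q0 !ipE; ring.
  have -> : ip q1 q1 = ip (Z i - leftlim x (u i.+1)) (Z i - leftlim x (u i.+1)).
    by rewrite /q1 !ipE; ring.
  apply => //.
  have -> : ip (- q1) (q1 - q0) = ip (x (u i) - Z i) (leftlim k (u i.+1) - k (u i) - (u i.+1 - u i) *: be i)
     + ip (x (u i) - leftlim x (u i.+1)) (q1 - q0).
    by rewrite dq /q1 !ipE; ring.
  have h1 := ip_ge hip (x (u i) - leftlim x (u i.+1)) (q1 - q0).
  have h2 : `|x (u i) - leftlim x (u i.+1)| * `|q1 - q0| <=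
      eta * ((u i.+1 - u i) * `|be i| + (v (u i.+1) - v (u i))).
    by rewrite ler_pM.
  have h3 : 0 <= eta * `|n i.+1| by rewrite mulr_ge0.
  rewrite /rho; lra.
(* Both jump increments are normal at the respective new positions, so this step does not increase
   the distance. *)
have jmp i : (i < N)%N -> ip (X i.+1 - x (u i.+1)) (X i.+1 - x (u i.+1)) <=
    ip (Z i - leftlim x (u i.+1)) (Z i - leftlim x (u i.+1)).
  move=> iN; have ui := um i.+1 iN.
  pose q0 := leftlim x (u i.+1) - Z i; pose q1 := x (u i.+1) - X i.+1.
  have dq : q1 - q0 = n i.+1 - jump k (u i.+1).
    apply: (ip_inj hip) => w.
    have E1 : ip (X i.+1 + n i.+1) w = ip (Z i + jump m (u i.+1)) w.
      by rewrite (eu_n eu iN).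
    have E2 : ip (leftlim x (u i.+1) + leftlim k (u i.+1)) w = ip (leftlim m (u i.+1)) w.
      by rewrite (leftlim_eq SP).
    have E3 : ip (x (u i.+1) + k (u i.+1)) w = ip (m (u i.+1)) w by rewrite (sp_eq SP).
    move: E1 E2 E3; rewrite /q0 /q1 /jump !ipE; lra.
  have := @energy_step _ _ _ hip q0 q1 0 (- q1) 0 0.
  rewrite normr0 mul0r !add0r opprK mulr0 addr0.
  have -> : ip q0 q0 = ip (Z i - leftlim x (u i.+1)) (Z i - leftlim x (u i.+1)) by rewrite /q0 !ipE; ring.
  have -> : ip q1 q1 = ip (X i.+1 - x (u i.+1)) (X i.+1 - x (u i.+1)).
    by rewrite /q1 !ipE; ring.
  apply => //.
  rewrite dq oppr0.
  have := eu_normal eu iN (sp_domain SP ui).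
  have := sp_jump_normal hip hA A_neq0 SP ui (eu_K eu iN).
  rewrite /q1 !ipE !(ipC (n i.+1)); lra.
have main i : (i <= N)%N -> ip (X i - x (u i)) (X i - x (u i)) <= \sum_(0 <= j < i) rho j.
  elim: i => [_|i IH iN].
    have -> : X 0%N - x (u 0%N) = 0.
      rewrite (eu_X0 eu) u0; have := sp_eq SP (lexx 0).
      by rewrite (sp_init SP) addr0 => ->; rewrite subrr.
    by rewrite big_geq// ip0l.
  rewrite big_nat_recr//=; have := IH (ltnW iN).
  have := flow i iN; have := jmp i iN; lra.
have tot i : (i <= N)%N -> \sum_(0 <= j < i) rho j <= eta * (8 * (v T - v 0) + 4 * B).
  move=> iN; apply: le_trans (ler_sum_prefix iN rho0) _.
  rewrite /rho -mulr_sumr ler_wpM2l// big_split /= -!mulr_sumr.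
  apply: lerD; last by rewrite ler_wpM2l.
  rewrite ler_wpM2l//.
  have := @ler_sum_telescope _ (fun i => v (u i.+1) - v (u i)) (v \o u) N (fun _ _ => lexx _).
  by rewrite /= u0 uN.
split => i iN; first exact: le_trans (main i iN) (tot i iN).
apply: le_trans (tot i.+1 iN); rewrite big_nat_recr//=.
have := flow i iN; have := main i (ltnW iN); lra.
Qed.

End Euler.

(** * The penalized equation *)

Section YosidaSolution.
Context {R : realType} {H : completeNormedModType R} {ip : {dot H for idfun}}.
Hypothesis hip : induces_norm ip.
Context {A : H -> set H}.
Hypothesis hA : maximal_monotone ip A.
Hypothesis A_neq0 : dom A !=set0.
Variables (eps : R) (mu U : R -> H).
Hypothesis eps0 : 0 < eps.
Hypothesis hU : yosida_solution A eps mu U.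
Implicit Types (s t w : R).
Let y s := yosida A eps (U s).
Let l s := mu s - U s.
Let Nrm t := \int[@lebesgue_measure R]_(s in `[0, t]) `|y s|.
Let cU : cadlag U := hU.1.

Lemma yosida_bochner t : 0 <= t -> is_bochner_integral (@lebesgue_measure R) `[0, t] y (l t).
Proof.
move=> t0; have [v hv E] := hU.2 t t0.
by rewrite /l -E addrAC subrr add0r.
Qed.

Lemma yosida_right t : 0 <= t -> y s @[s --> t^'+] --> y t.
Proof.
move=> t0; apply/cvgrPdist_le => w w0.
have w' : 0 < w / (2 / eps) by rewrite !divr_gt0.
have /cvgrPdist_le /(_ _ w') := cU.1 t t0.
apply: filterS => s hs; apply: le_trans (yosida_lip hip hA A_neq0 _ _ eps0) _.
by rewrite mulrC -ler_pdivlMr// divr_gt0.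
Qed.

Lemma yosida_l0 : l 0 = 0.
Proof.
have hv := yosida_bochner (lexx 0).
have i1 : (@lebesgue_measure R).-integrable `[0, 0] (EFin \o cst (ip (l 0) (y 0))).
  apply/integrableP; split; first exact/measurable_EFinP/measurable_cst.
  rewrite (_ : (fun x : R => _) = cst `|ip (l 0) (y 0)|%:E)//.
  rewrite integral_cst; last exact: measurable_itvR.
  by rewrite -[X in (_ * X)%E]/(@lebesgue_measure R `[0, 0]) set_itv1
    lebesgue_measure_set1 mule0 ltry.
have i2 : (@lebesgue_measure R).-integrable `[0, 0] (EFin \o cst (0 : R)).
  exact: integrable0.
have := bochner_test hip (measurable_itvR _) (c := l 0) hv i1 i2.
have E : forall x : R, `[0, 0]%classic x ->
    `|cst (ip (l 0) (y 0)) x - ip (l 0) (y x)| <= cst (0 : R) x.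
  move=> x /=; rewrite in_itv /= => /andP[x0 x0'].
  have -> : x = 0 by apply/eqP; rewrite eq_le x0 x0'.
  by rewrite subrr normr0.
move=> /(_ E); rewrite !set_itv1 !Rintegral_set1 sub0r normrN => h.
by apply: (ip_eq0 hip); apply: le_trans h; exact: ler_norm.
Qed.

(** Where [y] is nearly constant, [l] and [Nrm] advance like explicit Euler steps. The lower bound
    on [Nrm t] lets (t - s) |y s| be charged to the growth of [Nrm], which is bounded uniformly in
    [eps] in total. *)
Lemma yosida_increment s t w : 0 <= s -> s <= t ->
  (forall x, s <= x -> x < t -> `|y x - y s| <= w) ->
  `|l t - l s - (t - s) *: y s| <= (t - s) * w /\
  Nrm t <= Nrm s + (t - s) * (`|y s| + w) /\
  Nrm s + (t - s) * (`|y s| - w) <= Nrm t.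
Proof.
move=> s0 st yw; have t0 := le_trans s0 st.
have rc x : 0 <= x -> x < t -> y z @[z --> x^'+] --> y x.
  by move=> x0 _; exact: yosida_right.
have hs := yosida_bochner s0; have ht := yosida_bochner t0.
split; last split.
- by apply: (bochner_increment hip s0 st hs ht rc) => x sx xt; apply: yw => //; exact: ltW.
- apply: (bochner_norm_increment s0 st ht rc) => x sx xt.
  rewrite -lerBlDl; apply: le_trans (lerB_dist _ _) _; apply: yw => //; exact: ltW.
- apply: (bochner_norm_increment_ge s0 st ht rc) => x sx xt.
  rewrite lerBlDr -lerBlDl; apply: le_trans (lerB_dist _ _) _.
  by rewrite distrC; apply: yw => //; exact: ltW.
Qed.

Lemma yosida_norm0 : Nrm 0 = 0.
Proof. by rewrite /Nrm set_itv1 Rintegral_set1. Qed.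

Lemma yosida_norm_mono s t : 0 <= s -> s <= t -> Nrm s <= Nrm t.
Proof.
move=> s0 st.
have rc x : 0 <= x -> x < t -> y z @[z --> x^'+] --> y x.
  by move=> x0 _; exact: yosida_right.
have := bochner_norm_increment_ge (M := 0) s0 st (yosida_bochner (le_trans s0 st)) rc.
by rewrite mulr0 addr0; apply.
Qed.

(** For fixed [eps] the Yosida map is Lipschitz with constant 2 / eps, so a grid adapted to the
    cadlag path [U] also controls [y]. The grid depends on [eps]; the estimates drawn from it do not
    keep track of its size. *)
Lemma yosida_grid s t w h : 0 <= s -> s <= t -> 0 < w -> 0 < h ->
  exists L g, partition_of s t L g /\ forall j, (j < L)%N ->
    [/\ g j.+1 - g j <= h,
        forall x, g j <= x -> x < g j.+1 -> `|U x - U (g j)| <= w &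
        forall x, g j <= x -> x < g j.+1 -> `|y x - y (g j)| <= w].
Proof.
move=> s0 st w0 h0.
pose w' := Num.min w (w / (2 / eps)).
have w'0 : 0 < w' by rewrite lt_min w0 !divr_gt0.
have [L [g [pg Pg]]] : exists L g, partition_of s t L g /\
    forall j, (j < L)%N -> osc_le U w' (g j) (g j.+1) /\ g j.+1 - g j <= h.
  apply: (@exists_partition _ (fun a b => osc_le U w' a b /\ b - a <= h)) => // x sx xt.
  have [d d0 [h1 h2]] := cadlag_local cU (le_trans s0 sx) w'0.
  exists (Num.min d h); first by rewrite lt_min d0.
  split => z; rewrite lt_min; [move=> sz zx|move=> xz] => /andP[l1 l2].
  - by split; [apply: h1 => //; exact: le_trans sz|exact: ltW].
  - by split; [apply: h2|exact: ltW].
exists L, g; split => // j jL; have [osc gh] := Pg j jL.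
have [_ _ gs] := pg.
have key x : g j <= x -> x < g j.+1 -> `|U x - U (g j)| <= w'.
  by move=> gx xg; apply: osc => //; exact: gs.
split => // x gx xg.
  by apply: le_trans (key x gx xg) _; rewrite ge_min lexx.
apply: le_trans (yosida_lip hip hA A_neq0 _ _ eps0) _.
rewrite mulrC -ler_pdivlMr ?divr_gt0//.
by apply: le_trans (key x gx xg) _; rewrite ge_min lexx orbT.
Qed.

Lemma yosida_bounded T : exists2 G, 0 <= G & forall t, 0 <= t -> t <= T -> `|y t| <= G /\ `|U t| <= G.
Proof.
have [F F0 bF] := cadlag_bounded T cU.
exists (`|yosida A eps 0| + 2 / eps * F + F).
  by rewrite !addr_ge0// mulr_ge0// divr_ge0// ltW.
move=> t t0 tT; have Ut := bF t t0 tT.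
have := yosida_lip hip hA A_neq0 (U t) 0 eps0; rewrite subr0 => h.
have k : 2 / eps * `|U t| <= 2 / eps * F by rewrite ler_wpM2l// divr_ge0// ltW.
have F1 : 0 <= 2 / eps * F by rewrite mulr_ge0// divr_ge0// ltW.
have n0 := normr_ge0 (yosida A eps 0).
split; last lra.
have : `|y t| <= `|y t - yosida A eps 0| + `|yosida A eps 0|.
  by rewrite -{1}(subrK (yosida A eps 0) (y t)) ler_normD.
rewrite /y; lra.
Qed.

End YosidaSolution.

(* Implicit relaxation of the normal component [n]: the position is
   [Z + c n] with [c] decreasing from [1] to [0] on the time scale [eps]. *)
Lemma yosida_piece (R : realType) (H : completeNormedModType R)
    (ip : {dot H for idfun}) (hip : induces_norm ip)
    (A : H -> set H) (hA : maximal_monotone ip A) (A_neq0 : dom A !=set0)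
    (eps : R) (mu U : R -> H) (eps0 : 0 < eps) (hU : yosida_solution A eps mu U)
    (Z X be n K0 : H) (sg sg' P D b ka : R) :
  let l s := mu s - U s in
  let Nrm t := \int[@lebesgue_measure R]_(s in `[0, t]) `|yosida A eps (U s)| in
  0 <= sg -> sg < sg' -> A Z be -> closure (dom A) X ->
  (forall q, closure (dom A) q -> 0 <= ip n (X - q)) ->
  0 <= P -> `|Z - X| <= D -> 0 < ka -> 0 <= b ->
  (forall s, sg <= s -> s < sg' -> `|Z + K0 + n + (s - sg) *: be - mu s| <= P) ->
  let Err := 2 * (P * (`|n| + `|be| * (sg' - sg) + (Nrm sg' - Nrm sg)) + `|n| * D
                  + eps * `|be| * (`|n| + (Nrm sg' - Nrm sg))) + ka in
  ip (K0 - l sg) (K0 - l sg) + Err <= b ^+ 2 ->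
  (forall s, sg <= s -> s < sg' -> exists c, [/\ 0 <= c, c <= 1, c * (s - sg) <= eps &
     `|U s - Z - c *: n| <= P + b + ka]) /\
  exists c, [/\ 0 <= c, c <= 1, c * (sg' - sg) <= eps &
    let K1 := K0 + (1 - c) *: n + (sg' - sg) *: be in
    ip (K1 - l sg') (K1 - l sg') <= ip (K0 - l sg) (K0 - l sg) + Err].
Proof.
move=> l Nrm sg0 sgs AZ KX nX P0 ZX ka0 b0 inP /= bb.
set Err0 := P * _ + _ + _ in bb *.
have eps_gt0 := eps0; pose y s := yosida A eps (U s).
have sg'0 : 0 <= sg' := le_trans sg0 (ltW sgs).
have [G G0 bG] := yosida_bounded hip hA A_neq0 eps0 hU sg'.
pose dN := Nrm sg' - Nrm sg.
have dN0 : 0 <= dN by rewrite subr_ge0; apply: (yosida_norm_mono hip hA A_neq0 eps0 hU) => //; exact: ltW.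
pose hh := sg' - sg; have hh0 : 0 < hh by rewrite subr_gt0.
have D0 : 0 <= D by apply: le_trans ZX.
have nn := normr_ge0 n; have nb := normr_ge0 be; have nZ := normr_ge0 Z.
pose E0 := `|Z| + `|n| + G.
have E00 : 0 <= E0 by rewrite !addr_ge0.
pose Q := `|n| + `|be| * hh + dN.
have Q0 : 0 <= Q by have := mulr_ge0 nb (ltW hh0); rewrite /Q; lra.
(* [W] collects the coefficients of the grid precision [w]; with w W <= ka the whole discretization
   error is absorbed by [ka]. *)
pose W := 2 * (Q + 2 * hh + 2 * P * hh + eps * `|be| * hh + E0 * hh + 1).
have W0 : 0 < W.
  have e1 : 0 <= P * hh by rewrite mulr_ge0// ltW.
  have e2 : 0 <= eps * `|be| * hh by rewrite !mulr_ge0// ltW.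
  have e3 : 0 <= E0 * hh by rewrite mulr_ge0// ltW.
  by rewrite /W; lra.
have [w [w0 w1 wka wW]] : exists w, [/\ 0 < w, w <= 1, w <= ka / 2 & w * W <= ka].
  exists (Num.min (Num.min 1 (ka / 2)) (ka / W)); split.
  - by rewrite !lt_min ltr01 !divr_gt0.
  - by rewrite !ge_min lexx.
  - by rewrite !ge_min lexx orbT.
  - by rewrite -ler_pdivlMr// ge_min lexx orbT.
have B0 : 0 < `|be| + G + 1 by lra.
have h00 : 0 < w / (`|be| + G + 1) by rewrite divr_gt0.
have [L [g [pg grid]]] := yosida_grid hip hA A_neq0 eps0 hU sg0 (ltW sgs) w0 h00.
have [g0 gL gs] := pg.
have hB j : (j < L)%N -> (g j.+1 - g j) * (`|be| + G + 1) <= w.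
  by move=> jL; have [+ _ _] := grid j jL; rewrite ler_pdivlMr.
have gj j : (j <= L)%N -> sg <= g j /\ g j <= sg'.
  by move=> jL; split; [rewrite -g0|rewrite -gL]; apply: (partition_mono pg).
(* Implicit Euler scheme for c' = - c / eps, starting from 1. *)
pose c := fix c (j : nat) : R := if j is i.+1 then c i * (eps / (eps + (g i.+1 - g i))) else 1.
have hj0 j : (j < L)%N -> 0 < g j.+1 - g j by move=> jL; rewrite subr_gt0 gs.
have ratio j : (j < L)%N -> 0 < eps / (eps + (g j.+1 - g j)) /\ eps / (eps + (g j.+1 - g j)) <= 1.
  move=> jL; have := hj0 j jL => h.
  by clear -eps_gt0 h; split; [rewrite divr_gt0//; lra|rewrite ler_pdivrMr; lra].
have cpos j : (j <= L)%N -> 0 < c j.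
  elim: j => [_|j IH jL] /=; first exact: ltr01.
  by rewrite mulr_gt0 ?IH 1?ltnW//; have [] := ratio j jL.
have cdec j : (j < L)%N -> c j.+1 <= c j.
  move=> jL /=; have [_ r1] := ratio j jL.
  by rewrite ler_piMr// ltW// cpos// ltnW.
have cstep j : (j < L)%N -> c j - c j.+1 = (g j.+1 - g j) * (c j.+1 / eps).
  move=> jL /=; have := hj0 j jL => h; field.
  by rewrite !gt_eqF//; clear -eps_gt0 h; lra.
have c1 j : (j <= L)%N -> c j <= 1.
  by elim: j => [_ //|j IH jL]; apply: le_trans (cdec j jL) (IH (ltnW jL)).
(* Discrete form of c (t) <= eps / (eps + t), kept under multiplication to make the induction
   linear; it yields the bound of [c] times the elapsed time by [eps]. *)
have ctime j : (j <= L)%N -> c j * (eps + (g j - sg)) <= eps.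
  elim: j => [_|j IH jL]; first by rewrite /= g0 subrr; clear -eps_gt0; lra.
  have := IH (ltnW jL); have := cdec j jL; have := cstep j jL.
  have [gsg _] := gj j (ltnW jL).
  have ce : c j.+1 / eps * eps = c j.+1 by rewrite divfK// gt_eqF.
  have gsg' : 0 <= g j - sg by clear -gsg; lra.
  move: (c j.+1) (c j) ce => cj' cj ce st de ih.
  have k1 : (cj - cj') * eps = (g j.+1 - g j) * cj' by rewrite st -mulrA ce.
  have k2 : cj' * (g j - sg) <= cj * (g j - sg) by rewrite ler_wpM2r.
  by clear -k1 k2 ih ce de; lra.
pose Kj j := K0 + (1 - c j) *: n + (g j - sg) *: be.
pose q j := Kj j - l (g j).
(* The reference position is taken at the new index and [U] at the old grid point: the relaxation is
   implicit, while the increment of [l] is driven by the slope at [g j]. *)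
pose e j := Z + c j.+1 *: n - U (g j).
have step j : (j < L)%N -> `|q j.+1 + e j| <= P + w /\
   ip (q j.+1) (q j.+1) <= ip (q j) (q j) + 2 * ((P + w) *
    (`|n| * (c j - c j.+1) + `|be| * (g j.+1 - g j) + (Nrm (g j.+1) - Nrm (g j)) + 2 * w * (g j.+1 - g j))
    + (`|n| * D * (c j - c j.+1) + eps * `|be| * (`|n| * (c j - c j.+1) + (Nrm (g j.+1) - Nrm (g j)) + w * (g j.+1 - g j)) + E0 * w * (g j.+1 - g j))).
  move=> jL; have [gsg gsg'] := gj j (ltnW jL).
  have [_ _ yw] := grid j jL.
  have g00 : 0 <= g j := le_trans sg0 gsg.
  have gjs := gs j jL.
  have [inc nge] : `|l (g j.+1) - l (g j) - (g j.+1 - g j) *: y (g j)| <= (g j.+1 - g j) * w /\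
      Nrm (g j) + (g j.+1 - g j) * (`|y (g j)| - w) <= Nrm (g j.+1).
    by have [? [_ ?]] := yosida_increment hip hA A_neq0 eps0 hU g00 (ltW gjs) yw.
  have [yG UG] : `|y (g j)| <= G /\ `|U (g j)| <= G := bG _ g00 gsg'.
  have hj := hj0 j jL; have hBj := hB j jL.
  set h := g j.+1 - g j in hj hBj inc nge *.
  set yj := y (g j) in inc nge yG yw *.
  set err := l (g j.+1) - l (g j) - h *: yj in inc.
  have dl : l (g j.+1) - l (g j) = h *: yj + err by rewrite /err subrKC.
  have hy : h * `|yj| <= Nrm (g j.+1) - Nrm (g j) + w * h by clear -nge; lra.
  have ndl : `|l (g j.+1) - l (g j)| <= h * (G + 1).
    rewrite dl; apply: le_trans (ler_normD _ _) _; rewrite normrZ gtr0_norm//.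
    have : h * `|yj| <= h * G by rewrite ler_wpM2l// ltW.
    have : h * w <= h * 1 by rewrite ler_wpM2l// ltW.
    by move=> q1 q2; clear -q1 q2 inc; lra.
  have ndl2 : `|l (g j.+1) - l (g j)| <= Nrm (g j.+1) - Nrm (g j) + 2 * w * h.
    rewrite dl; apply: le_trans (ler_normD _ _) _; rewrite normrZ gtr0_norm//; clear -hy inc; lra.
  have pE : q j.+1 + e j = (Z + K0 + n + (g j - sg) *: be - mu (g j)) + (h *: be - (l (g j.+1) - l (g j))).
    clear -hip; apply: (ip_inj hip) => z; rewrite /q /Kj /e /l /h !ipE; ring.
  have np : `|q j.+1 + e j| <= P + w.
    rewrite pE; apply: le_trans (ler_normD _ _) _; apply: lerD.
      by apply: inP => //; apply: lt_le_trans gjs _; have [] := gj j.+1 jL.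
    apply: le_trans (ler_normB _ _) _; rewrite normrZ gtr0_norm//; clear -ndl hBj; lra.
  split => //.
  pose th := c j.+1 / eps.
  have th0 : 0 < th by rewrite divr_gt0// cpos.
  have cth : c j - c j.+1 = h * th by exact: cstep.
  have cE : c j.+1 = eps * th by rewrite /th mulrC divfK// gt_eqF.
  have dq : q j.+1 - q j = h *: (th *: n + be - yj) - err.
    have cj : c j = c j.+1 + h * th by rewrite -cth addrC subrK.
    rewrite /q /Kj cj; move: (c j.+1) => cj'.
    have -> : l (g j.+1) = l (g j) + (h *: yj + err) by rewrite -dl subrKC.
    move: (l (g j)) => lj.
    clearbody err yj; clear -hip; apply: (ip_inj hip) => z; rewrite /h !ipE; ring.
  have ne : `|e j| <= E0.
    apply: le_trans (ler_normB _ _) _; apply: lerD => //.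
    apply: le_trans (ler_normD _ _) _; rewrite lerD2l normrZ ger0_norm; last exact/ltW/cpos.
    by rewrite ler_piMl// c1.
  have eE : e j = (Z - resolvent A eps (U (g j))) + eps *: (th *: n - yj).
    have := resolventE hip hA A_neq0 (U (g j)) eps0.
    rewrite /e cE -/(y (g j)) -/yj; move: (resolvent _ _ _) => J <-.
    by clearbody yj; clear -hip; apply: (ip_inj hip) => z; rewrite !ipE; ring.
  (* With [th] the relaxation speed, c n = eps th n is paired with U - J = eps y, which produces the
     nonnegative square eps |th n - y|^2. Monotonicity handles [Z - J], and normality of [n] at [X]
     handles [X - J]; what remains is |n| times |Z - X|, and terms of order eps |be|. *)
  have main : - (th * (`|n| * D) + eps * `|be| * (th * `|n| + `|yj|)) <= ip (e j) (th *: n + be - yj).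
    rewrite eE; set J := resolvent A eps (U (g j)).
    have m1 : 0 <= ip (Z - J) (be - yj) by exact: hA.1 AZ (yosida_mem hip hA A_neq0 _ eps0).
    have m2 : 0 <= ip n (X - J).
      by apply: nX; apply: subset_closure; exact: (resolvent_dom hip hA A_neq0 _ eps0).
    have m3 := ip_ge hip n (Z - X).
    have m4 : `|n| * `|Z - X| <= `|n| * D by rewrite ler_wpM2l.
    have m5 := ip_ge hip (th *: n - yj) be.
    have m6 : `|th *: n - yj| <= th * `|n| + `|yj|.
      by apply: le_trans (ler_normB _ _) _; rewrite normrZ gtr0_norm.
    have m7 := ler_wpM2r nb m6.
    have m8 := ip_ge0 hip (th *: n - yj).
    have -> : ip (Z - J + eps *: (th *: n - yj)) (th *: n + be - yj) =
      ip (Z - J) (be - yj) + th * (ip n (X - J) + ip n (Z - X)) + eps * (ip (th *: n - yj) (th *: n - yj) + ip (th *: n - yj) be).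
      by clearbody J yj; clear; rewrite !ipE (ipC J n) (ipC Z n) (ipC yj n); ring.
    have n1 : th * (- (`|n| * D)) <= th * (ip n (X - J) + ip n (Z - X)).
      by rewrite ler_wpM2l//; [exact: ltW|clear -m2 m3 m4; lra].
    have n2 : eps * (- (`|be| * (th * `|n| + `|yj|))) <= eps * (ip (th *: n - yj) (th *: n - yj) + ip (th *: n - yj) be).
      by rewrite ler_wpM2l//; [exact: ltW|clear -m5 m7 m8; lra].
    clear -m1 n1 n2; lra.
  have ipe : - (h * (th * (`|n| * D) + eps * `|be| * (th * `|n| + `|yj|)) + E0 * (h * w)) <= ip (e j) (q j.+1 - q j).
    rewrite dq ipDr ipNr ipZr.
    have k1 := ler_wpM2l (ltW hj) main.
    have k2 := ip_le hip (e j) err.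
    have k3 : `|e j| * `|err| <= E0 * (h * w) by rewrite ler_pM.
    clear -k1 k2 k3; lra.
  have ndq : `|q j.+1 - q j| <= `|n| * (c j - c j.+1) + `|be| * h + (Nrm (g j.+1) - Nrm (g j)) + 2 * w * h.
    have -> : q j.+1 - q j = (h * th) *: n + h *: be - (l (g j.+1) - l (g j)).
      by rewrite dq dl; clearbody err yj; clear -hip; apply: (ip_inj hip) => z; rewrite !ipE; ring.
    apply: le_trans (ler_normB _ _) _.
    have := ler_normD ((h * th) *: n) (h *: be).
    have -> : `|(h * th) *: n| = h * th * `|n| by rewrite normrZ gtr0_norm// mulr_gt0.
    have -> : `|h *: be| = h * `|be| by rewrite normrZ gtr0_norm.
    rewrite cth; clear -ndl2; lra.
  have qE : q j.+1 = (q j.+1 + e j) - e j by rewrite addrK.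
  have := energy_step hip qE np ipe.
  have P1 : 0 <= P + w by clear -P0 w0; lra.
  have k1 := ler_wpM2l P1 ndq.
  have k2 : eps * `|be| * (h * `|yj|) <= eps * `|be| * (Nrm (g j.+1) - Nrm (g j) + w * h).
    by rewrite ler_wpM2l// mulr_ge0// ltW.
  move: k1 k2; rewrite cth; move=> k1 k2; clear -k1 k2; lra.
pose F (j : nat) := ip (q 0%N) (q 0%N) + 2 * ((P + w) *
    (`|n| * (1 - c j) + `|be| * (g j - sg) + (Nrm (g j) - Nrm sg) + 2 * w * (g j - sg))
    + (`|n| * D * (1 - c j) + eps * `|be| * (`|n| * (1 - c j) + (Nrm (g j) - Nrm sg) + w * (g j - sg)) + E0 * w * (g j - sg))).
have q0E : q 0%N = K0 - l sg.
  by rewrite /q /Kj /= g0 !subrr !scale0r !addr0.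
have qF j : (j <= L)%N -> ip (q j) (q j) <= F j.
  elim: j => [_|j IH jL]; first by rewrite /F /= g0 !subrr; clear; lra.
  have [_ st] := step j jL; have := IH (ltnW jL); rewrite /F; clear -st; lra.
have FErr j : (j <= L)%N -> F j <= ip (K0 - l sg) (K0 - l sg) + (2 * Err0 + ka).
  move=> jL; rewrite /F q0E lerD2l; have [gsg gsg'] := gj j jL.
  have cj := cpos j jL; have cj1 := c1 j jL.
  have a1 : `|n| * (1 - c j) <= `|n| by rewrite ler_piMr//; clear -cj; lra.
  have a2 : `|be| * (g j - sg) <= `|be| * hh by rewrite ler_wpM2l// /hh; clear -gsg'; lra.
  have a3 : Nrm (g j) - Nrm sg <= dN.
    by rewrite /dN lerD2r; apply: (yosida_norm_mono hip hA A_neq0 eps0 hU) => //; exact: le_trans gsg.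
  have a4 : w * (g j - sg) <= w * hh by rewrite ler_wpM2l ?(ltW w0)// /hh; clear -gsg'; lra.
  have a5 : `|n| * D * (1 - c j) <= `|n| * D by rewrite ler_piMr ?mulr_ge0//; clear -cj; lra.
  have b1 : (P + w) * (`|n| * (1 - c j) + `|be| * (g j - sg) + (Nrm (g j) - Nrm sg) + 2 * w * (g j - sg)) <= (P + w) * (Q + 2 * w * hh).
    by rewrite ler_wpM2l//; [clear -P0 w0; lra|rewrite /Q; clear -a1 a2 a3 a4; lra].
  have b2 : eps * `|be| * (`|n| * (1 - c j) + (Nrm (g j) - Nrm sg) + w * (g j - sg)) <= eps * `|be| * (`|n| + dN + w * hh).
    by rewrite ler_wpM2l//; [rewrite mulr_ge0// ltW|clear -a1 a3 a4; lra].
  have b3 : E0 * (w * (g j - sg)) <= E0 * (w * hh) by rewrite ler_wpM2l.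
  have b4 : w * (w * hh) <= w * hh by rewrite ler_piMl// mulr_ge0// ltW.
  have -> : Err0 = P * Q + `|n| * D + eps * `|be| * (`|n| + dN) by [].
  have b5 : w * Q + 2 * (w * hh) + 2 * (w * P * hh) + w * (eps * `|be| * hh) + w * (E0 * hh) <= ka / 2.
    rewrite /W in wW; move: wW.
    have : w * (P * hh) >= 0 by rewrite !mulr_ge0// ltW.
    move=> b6 wW; clear -wka w0 wW b6; lra.
  clear -b1 b2 b3 b4 b5 a5; lra.
have qb j : (j <= L)%N -> `|q j| <= b.
  move=> jL; apply: (norm_le_sqr hip) => //.
  exact: le_trans (qF j jL) (le_trans (FErr j jL) bb).
split.
- move=> s sgs1 ss'; have [j jL [gs1 sg1]] := partition_locate pg sgs1 ss'.
  exists (c j.+1); split; [exact/ltW/cpos|exact: c1| |].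
    have := ctime j.+1 jL; have cj := cpos j.+1 jL.
    have : c j.+1 * (s - sg) <= c j.+1 * (g j.+1 - sg) by rewrite ler_wpM2l ?(ltW cj)// lerD2r ltW.
    have := mulr_gt0 cj eps0; move=> q1 q2 q3; clear -q1 q2 q3; lra.
  have [_ Uw _] := grid j jL; have [np _] := step j jL.
  have -> : U s - Z - c j.+1 *: n = (U s - U (g j)) - (q j.+1 + e j) + q j.+1.
    by clear -hip; apply: (ip_inj hip) => z; rewrite /e !ipE; ring.
  apply: le_trans (ler_normD _ _) _.
  have := ler_normB (U s - U (g j)) (q j.+1 + e j).
  have := Uw s gs1 sg1; have := qb j.+1 jL; move=> q1 q2 q3; clear -wka np q1 q2 q3; lra.
- exists (c L); split; [exact/ltW/cpos|exact: c1| |].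
    have := ctime L (leqnn _); rewrite gL; have := mulr_gt0 (cpos L (leqnn _)) eps0; move=> q1 q2; clear -q1 q2; lra.
  have := le_trans (qF L (leqnn _)) (FErr L (leqnn _)).
  by rewrite /q /Kj gL.
Qed.

(** * Variation bound for the penalized compensator, uniform in [eps] *)

Section YosidaBV.
Context {R : realType} {H : completeNormedModType R} {ip : {dot H for idfun}}.
Hypothesis hip : induces_norm ip.
Context {A : H -> set H}.
Hypothesis hA : maximal_monotone ip A.
Variables (a : H) (r c : R).
Hypotheses (r0 : 0 < r) (c0 : 0 <= c) (dom_a : dom A a)
  (coer : forall al be, A al be -> r * `|be| <= ip be (al - a) + c * (1 + `|al - a|)).

(** The coercivity at the resolvent point J is moved to [z]: ip y (J - a) loses only eps |y|^2, and
    |J - a| <= |z - a| + |ya| because the Yosida slope at [a] is at most |ya|. *)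
Lemma yosida_coercive : exists2 c1, 0 <= c1 & forall (eps : R) z, 0 < eps -> eps <= 1 ->
  r * `|yosida A eps z| <= ip (yosida A eps z) (z - a) + c1 * (1 + `|z - a|).
Proof.
have A_neq0 : dom A !=set0 by exists a.
have [ya Aya] := dom_a.
exists (c * (1 + `|ya|)); first by rewrite mulr_ge0// addr_ge0.
move=> eps z eps0 eps1.
have := coer (yosida_mem hip hA A_neq0 z eps0).
have zE := resolventE hip hA A_neq0 z eps0.
set y := yosida A eps z in zE *; set J := resolvent A eps z in zE *.
have h1 : ip y (J - a) <= ip y (z - a).
  rewrite -zE; clearbody y J; have := ip_ge0 hip y.
  have : 0 <= eps * ip y y by rewrite mulr_ge0 ?(ltW eps0) ?(ip_ge0 hip).
  rewrite !ipE; lra.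
have h2 : `|J - a| <= `|z - a| + `|ya|.
  have k1 := resolvent_nonexp hip hA A_neq0 z a eps0.
  have k2 : `|resolvent A eps a - a| <= eps * `|ya|.
    have mon := hA.1 _ _ _ _ (yosida_mem hip hA A_neq0 a eps0) Aya.
    have aE := resolventE hip hA A_neq0 a eps0.
    move: mon aE; set ja := resolvent A eps a; set u := yosida A eps a => mon aE.
    have ja_a : ja - a = - (eps *: u) by rewrite -aE opprD addrA subrr sub0r.
    rewrite ja_a normrN normrZ gtr0_norm// ler_wpM2l ?(ltW eps0)//.
    move: mon; rewrite ja_a; clearbody ja u; rewrite !ipE -(sqr_norm hip) => mon.
    have := ip_le hip u ya; have := normr_ge0 u; move: (`|u|) mon => nu mon nu0 le.
    have [->//|nu1] := eqVneq nu 0.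
    have nu2 : 0 < nu by rewrite lt_def nu1.
    by rewrite -(ler_pM2l nu2); nra.
  have k3 := ler_distD (resolvent A eps a) J a.
  have k4 : eps * `|ya| <= `|ya| by rewrite ler_piMl.
  rewrite /J in k3 *; lra.
have h3 : c * (1 + `|J - a|) <= c * (1 + `|ya|) * (1 + `|z - a|).
  rewrite -mulrA ler_wpM2l//.
  have := mulr_ge0 (normr_ge0 ya) (normr_ge0 (z - a)); lra.
lra.
Qed.

Lemma yosida_BV T L d : 0 < T -> 0 <= L -> 0 <= d ->
  exists2 B, 0 <= B & forall (eps : R) mu U (C : R -> H) (V : R -> R),
  0 < eps -> eps <= 1 -> yosida_solution A eps mu U ->
  (forall s t : R, 0 <= s -> s <= t -> `|C t - C s| <= V t - V s) -> V T - V 0 <= L ->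
  `|C 0 - a| <= d ->
  (forall s : R, 0 <= s -> s < T -> `|mu s - C s| <= r / 2) ->
  \int[@lebesgue_measure R]_(s in `[0, T]) `|yosida A eps (U s)| <= B.
Proof.
move=> T0 L0 d0.
have A_neq0 : dom A !=set0 by exists a.
have [c1 c10 hc1] := yosida_coercive.
(* The constant pays for recentring the coercivity (2 c1), for r |dl - h y| (r), and for |dl|^2 and
   the pairing of the increment error with the position (2). *)
have r0' := r0; have c30 : 0 <= 2 * c1 + r + 2 by lra.
have [B [B0 hB]] := discrete_BV hip r0 c30 (ltW T0) L0 d0.
exists (B + 2 * T); first lra.
move=> eps mu U C V eps0 eps1 hU CV VL C0 near.
pose y s := yosida A eps (U s).
pose l s := mu s - U s.
pose Nrm t := \int[@lebesgue_measure R]_(s in `[0, t]) `|y s|.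
have [G G0 bG] := yosida_bounded hip hA A_neq0 eps0 hU T.
have G1 : 0 < G + 1 by lra.
(* This step size makes |dl|^2 <= h for the increment [dl] of [l] over a cell of length [h], so the
   square is harmless after summation. *)
have h00 : 0 < ((G + 1) ^+ 2)^-1 by rewrite invr_gt0 exprn_gt0.
have [N [g [pg grid]]] := yosida_grid hip hA A_neq0 eps0 hU (lexx 0) (ltW T0) ltr01 h00.
have [g0 gN gs] := pg.
have gj j : (j <= N)%N -> 0 <= g j /\ g j <= T.
  by move=> jN; split; [rewrite -g0|rewrite -gN]; apply: (partition_mono pg).
have hj j : (j < N)%N -> 0 < g j.+1 - g j by move=> jN; rewrite subr_gt0 gs.
have hsq j : (j < N)%N -> (g j.+1 - g j) * (G + 1) ^+ 2 <= 1.
  by move=> jN; have [+ _ _] := grid j jN; rewrite -[X in _ <= X]mul1r ler_pdivlMr ?exprn_gt0.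
have inc j : (j < N)%N ->
   `|l (g j.+1) - l (g j) - (g j.+1 - g j) *: y (g j)| <= g j.+1 - g j /\
   Nrm (g j.+1) - Nrm (g j) <= `|l (g j.+1) - l (g j)| + 2 * (g j.+1 - g j).
  move=> jN; have [_ _ yw] := grid j jN; have [gj0 gjT] := gj j (ltnW jN).
  have [i1 [i2 _]] := yosida_increment hip hA A_neq0 eps0 hU gj0 (ltW (gs j jN)) yw.
  rewrite mulr1 in i1; split; first exact: i1.
  have := lerB_dist ((g j.+1 - g j) *: y (g j)) (l (g j.+1) - l (g j)).
  rewrite distrC normrZ (gtr0_norm (hj j jN)).
  move: i1 i2; rewrite -/(y _) -/(l _) -/(l _) -/(Nrm _) -/(Nrm _); lra.
have tele (f : R -> R) : \sum_(0 <= j < N) (f (g j.+1) - f (g j)) <= f T - f 0.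
  by have := @ler_sum_telescope _ (fun j => f (g j.+1) - f (g j)) (f \o g) N (fun _ _ => lexx _); rewrite /= g0 gN.
have N0 : Nrm 0 = 0 by exact: yosida_norm0.
have -> : \int[@lebesgue_measure R]_(s in `[0, T]) `|yosida A eps (U s)| = Nrm T - Nrm 0 by rewrite N0 subr0.
apply: (@le_trans _ _ (\sum_(0 <= j < N) (`|l (g j.+1) - l (g j)| + 2 * (g j.+1 - g j)))).
  have -> : Nrm T - Nrm 0 = \sum_(0 <= j < N) (Nrm (g j.+1) - Nrm (g j)).
    by rewrite (telescope_sumr (Nrm \o g))//= g0 gN.
  by rewrite big_nat [leRHS]big_nat; apply: ler_sum => j /andP[_ jN]; have [] := inc j jN.
rewrite big_split /= -mulr_sumr; apply: lerD; last first.
  by have := tele id; rewrite /= subr0; lra.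
(* The slope of a cell is taken at its left end, whereas [discrete_BV] wants position plus new
   compensator close to the input. Subtracting the increment of [l] makes that sum equal to mu (g
   i); hence also the shifted sampling [CC]. *)
pose XX j := if j is i.+1 then U (g i) - (l (g i.+1) - l (g i)) else U 0.
pose CC j := C (g j.-1).
apply: (hB a XX (l \o g) CC (fun j => g j.+1 - g j)).
- by rewrite /= g0; exact: (yosida_l0 hip hU).
- by rewrite /CC /= g0.
- case=> [_|j jN] /=.
    by rewrite /CC /= g0 /l subrKC; exact: near.
  have [gj0 gjT] := gj j (ltnW jN).
  have -> : U (g j) - (l (g j.+1) - l (g j)) + l (g j.+1) - C (g j) = mu (g j) - C (g j).
    by apply: (ip_inj hip) => z; rewrite /l !ipE; ring.
  by apply: near => //; apply: lt_le_trans (gs j jN) _; have [] := gj j.+1 jN.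
- by move=> j jN; exact/ltW/hj.
- move=> j jN /=; have [gj0 gjT] := gj j (ltnW jN).
  have [i1 _] := inc j jN; have [yG _] := bG _ gj0 gjT.
  have h0 := hj j jN; have hs := hsq j jN; have co := hc1 eps (U (g j)) eps0 eps1.
  rewrite -/(y (g j)) in yG co.
  set h := g j.+1 - g j in i1 h0 hs *; set dl := l (g j.+1) - l (g j) in i1 *.
  set yj := y (g j) in i1 yG co *; set u := U (g j) in co *.
  set err := dl - h *: yj in i1.
  have dlE : dl = h *: yj + err by rewrite /err subrKC.
  have nd : `|dl| <= h * (G + 1).
    rewrite dlE; apply: le_trans (ler_normD _ _) _; rewrite normrZ gtr0_norm//.
    have : h * `|yj| <= h * G by rewrite ler_wpM2l// ltW.
    lra.
  have nd2 : `|dl| ^+ 2 <= h.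
    have : `|dl| ^+ 2 <= (h * (G + 1)) ^+ 2 by rewrite ler_sqr ?nnegrE// mulr_ge0// ltW.
    have : h * (h * (G + 1) ^+ 2) <= h * 1 by rewrite ler_wpM2l// ltW.
    rewrite exprMn; lra.
  have nd1 : `|dl| <= 1.
    apply: le_trans nd (le_trans _ hs); rewrite ler_wpM2l ?(ltW h0)//.
    by rewrite ler_eXnr//; lra.
  have nu : `|u - a| <= `|u - dl - a| + 1.
    have := ler_normD (u - dl - a) dl.
    have -> : u - dl - a + dl = u - a by rewrite addrAC subrK.
    lra.
  have k1 : h * (r * `|yj|) <= h * (ip yj (u - a) + c1 * (1 + `|u - a|)).
    by rewrite ler_wpM2l// ltW.
  have k2 : `|dl| <= h * `|yj| + h.
    rewrite dlE; apply: le_trans (ler_normD _ _) _; rewrite normrZ gtr0_norm//; lra.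
  have k3 : r * `|dl| <= r * (h * `|yj| + h) by rewrite ler_wpM2l// ltW.
  have k4 : h * ip yj (u - a) = ip dl (u - dl - a) + `|dl| ^+ 2 - ip err (u - a).
    rewrite (sqr_norm hip) dlE; clearbody err yj u.
    by rewrite !ipE (ipC yj u) (ipC err u) (ipC err yj); ring.
  have k5 := ip_ge hip err (u - a).
  have k6 : `|err| * `|u - a| <= h * (`|u - dl - a| + 1) by rewrite ler_pM.
  have k7 : h * (c1 * (1 + `|u - a|)) <= h * (c1 * (2 + `|u - dl - a|)).
    by rewrite ler_wpM2l ?(ltW h0)// ler_wpM2l//; lra.
  have k8 : 0 <= h * (c1 * `|u - dl - a|) by rewrite !mulr_ge0// ltW.
  have k9 : 0 <= h * ((r + 1) * `|u - dl - a|).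
    by rewrite mulr_ge0 ?(ltW h0)// mulr_ge0// addr_ge0 ?(ltW r0).
  move: k1 k2 k3 k4 k5 k6 k7 k8 k9 nd2; clear -h0; lra.
- by have := tele id; rewrite /= subr0.
- have gN1 : (N.-1 <= N)%N by exact: leq_pred.
  have [p0 pT] := gj _ gN1.
  have V1 := control_mono CV p0 pT.
  have V2 : V 0 = V (g 0%N) by rewrite g0.
  apply: le_trans (_ : V (g N.-1) - V (g 0%N) <= _); last by rewrite -V2; lra.
  apply: (ler_sum_telescope (f := fun j => V (g j.-1))) => -[|j] jN.
    by rewrite /CC /= !subrr normr0.
  by apply: CV; [have [] := gj j (ltnW (ltnW jN))|exact/ltW/gs/ltnW].
Qed.

End YosidaBV.

(** [yosida_piece] is iterated over the intervals [sg i, sg i.+1[, images of those of the scheme.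
    Here [d] bounds the distortion of their lengths, and [om] the fraction of [n i] not yet released
    at the end, since c (sg i.+1 - sg i) <= eps. *)
Lemma yosida_chain (R : realType) (H : completeNormedModType R)
  (ip : {dot H for idfun}) (hip : induces_norm ip)
  (A : H -> set H) (hA : maximal_monotone ip A) (A_neq0 : dom A !=set0) (m : R -> H) N (u : nat -> R) (X Z n be : nat -> H)
  (eps : R) (mu U : R -> H) (sg : nat -> R) (E D Hb d om W B B' ka b : R) :
  0 < eps -> yosida_solution A eps mu U ->
  u 0%N = 0 -> (forall i, (i < N)%N -> u i < u i.+1) ->
  @euler_scheme R H ip A m N u X Z n be ->
  sg 0%N = 0 -> (forall i, (i < N)%N -> sg i < sg i.+1) ->
  (forall i, (i < N)%N -> `|Z i - X i| <= D) ->
  (forall i, (i < N)%N -> (u i.+1 - u i) * `|be i| <= Hb) ->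
  (forall i s, (i < N)%N -> sg i <= s -> s < sg i.+1 -> `|leftlim m (u i.+1) - mu s| <= E) ->
  (forall i, (i < N)%N -> `|sg i.+1 - sg i - (u i.+1 - u i)| <= d) ->
  (forall i, (i < N)%N -> eps <= om * (sg i.+1 - sg i)) ->
  \sum_(0 <= i < N) (`|n i| + `|be i|) <= W ->
  \sum_(0 <= i < N) ((u i.+1 - u i) * `|be i| + `|n i|) <= B ->
  \int[@lebesgue_measure R]_(s in `[0, sg N]) `|yosida A eps (U s)| <= B' ->
  0 <= D -> 0 <= E -> 0 <= Hb -> 0 <= d -> 0 <= om -> 0 < ka -> 0 <= b ->
  let P := E + Hb + (om + 2 * d) * W in
  2 * (P * (B + d * W + B') + B * D + eps * (W * (W + B'))) + N%:R * ka <= b ^+ 2 ->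
  forall i, (i < N)%N -> forall s, sg i <= s -> s < sg i.+1 ->
    exists c, [/\ 0 <= c, c <= 1, c * (s - sg i) <= eps &
      `|U s - Z i - c *: n i| <= P + b + ka].
Proof.
move=> eps0 hU u0 us eu sg0 sgs ZX hbe near dsg epsom sumW sumB sumB' D0 E0 Hb0 d0 om0 ka0 b0 /=.
set P := E + Hb + _ => total.
pose Nrm t := \int[@lebesgue_measure R]_(s in `[0, t]) `|yosida A eps (U s)|.
pose l s := mu s - U s.
have h0 i : (i < N)%N -> 0 < u i.+1 - u i by move=> iN; rewrite subr_gt0 us.
have s0 i : (i < N)%N -> 0 < sg i.+1 - sg i by move=> iN; rewrite subr_gt0 sgs.
have sgm i : (i <= N)%N -> 0 <= sg i.
  elim: i => [|i IH] iN; first by rewrite sg0.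
  exact: le_trans (IH (ltnW iN)) (ltW (sgs i iN)).
have Nrm_mono i : (i < N)%N -> 0 <= Nrm (sg i.+1) - Nrm (sg i).
  move=> iN; rewrite subr_ge0.
  exact: (yosida_norm_mono hip hA A_neq0 eps0 hU (sgm _ (ltnW iN)) (ltW (sgs i iN))).
have sgM i j : (i <= j)%N -> (j <= N)%N -> sg i <= sg j.
  by apply: (@partition_mono _ 0 (sg N)).
have Nrm_ge0 i : (i <= N)%N -> 0 <= Nrm (sg i).
  move=> iN; have := yosida_norm_mono hip hA A_neq0 eps0 hU (lexx 0) (sgm i iN).
  by rewrite yosida_norm0.
have Nrm_le i : (i <= N)%N -> Nrm (sg i) <= B'.
  move=> iN; apply: le_trans sumB'.
  exact: (yosida_norm_mono hip hA A_neq0 eps0 hU (sgm _ iN) (sgM _ _ iN (leqnn N))).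
have W0 : 0 <= W by apply: le_trans sumW; apply: sumr_ge0 => i _; exact: addr_ge0.
have P0 : 0 <= P by rewrite /P !addr_ge0// mulr_ge0// addr_ge0// mulr_ge0.
(* Drift of the reference compensator from that of the scheme over one interval: the unreleased part
   of [n i], and [be i] acting for a slightly wrong duration. *)
pose dl i := om * `|n i| + d * `|be i|.
pose Er i := 2 * (P * (`|n i| + `|be i| * (sg i.+1 - sg i) + (Nrm (sg i.+1) - Nrm (sg i))) + `|n i| * D
                  + eps * `|be i| * (`|n i| + (Nrm (sg i.+1) - Nrm (sg i)))) + ka.
have Er0 i : (i < N)%N -> 0 <= Er i.
  move=> iN; have e1 := Nrm_mono i iN; have e2 := ltW (s0 i iN).
  rewrite /Er; move: (Nrm (sg i.+1) - Nrm (sg i)) e1 => nu e1.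
  move: (sg i.+1 - sg i) e2 => h e2; have e4 := ltW eps0.
  rewrite addr_ge0 ?(ltW ka0)// mulr_ge0// addr_ge0//; last by rewrite !mulr_ge0// addr_ge0.
  by rewrite addr_ge0 ?mulr_ge0// addr_ge0// addr_ge0// mulr_ge0.
have dl0 i : 0 <= dl i by rewrite addr_ge0// mulr_ge0.
have bW i : (i < N)%N -> `|n i| + `|be i| <= W.
  move=> iN; apply: le_trans sumW; rewrite big_mkord.
  by rewrite (bigD1 (Ordinal iN))//= lerDl; apply: sumr_ge0 => j _; exact: addr_ge0.
have dlsum i : (i <= N)%N -> \sum_(0 <= j < i) dl j <= (om + d) * W.
  move=> iN; apply: le_trans (ler_sum_prefix iN (fun j _ => dl0 j)) _.
  apply: le_trans (_ : \sum_(0 <= j < N) (om + d) * (`|n j| + `|be j|) <= _).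
    apply: ler_sum => j _; rewrite /dl.
    have := mulr_ge0 om0 (normr_ge0 (be j)); have := mulr_ge0 d0 (normr_ge0 (n j)); lra.
  by rewrite -mulr_sumr ler_wpM2l// addr_ge0.
have Ersum i : (i <= N)%N -> \sum_(0 <= j < i) Er j <= b ^+ 2.
  move=> iN; apply: le_trans (ler_sum_prefix iN Er0) (le_trans _ total).
  have NB i' : (i' < N)%N -> Nrm (sg i'.+1) - Nrm (sg i') <= B'.
    move=> iN'; have q1 := Nrm_le i'.+1 iN'; have q2 := Nrm_ge0 i' (ltnW iN'); lra.
  have B'0 : 0 <= B' by apply: le_trans (Nrm_ge0 0%N isT) (Nrm_le 0%N isT).
  pose al := 2 * (P + D); pose bt := 2 * (P * d + eps * (W + B')).
  have al0 : 0 <= al by rewrite mulr_ge0// addr_ge0.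
  have bt0 : 0 <= bt.
    by rewrite mulr_ge0// addr_ge0// mulr_ge0 ?(ltW eps0)// addr_ge0.
  apply: le_trans (_ : \sum_(0 <= j < N) (al * ((u j.+1 - u j) * `|be j| + `|n j|)
     + bt * (`|n j| + `|be j|) + 2 * P * (Nrm (sg j.+1) - Nrm (sg j)) + ka) <= _).
    rewrite big_nat [leRHS]big_nat; apply: ler_sum => j /andP[_ jN].
    have j1 := NB j jN; have j2 := bW j jN; have j3 := dsg j jN; have j4 := h0 j jN.
    have j5 := Nrm_mono j jN.
    rewrite /Er lerD2r /al /bt; move: (Nrm (sg j.+1) - Nrm (sg j)) j1 j5 => nu j1 j5.
    have nb := normr_ge0 (be j); have nn := normr_ge0 (n j).
    have j6 : sg j.+1 - sg j <= u j.+1 - u j + d.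
      by move: j3; rewrite ler_norml => /andP[_]; lra.
    have k1 : P * (`|be j| * (sg j.+1 - sg j)) <= P * (`|be j| * (u j.+1 - u j + d)).
      by rewrite ler_wpM2l// ler_wpM2l.
    have k2 : eps * (`|be j| * (`|n j| + nu)) <= eps * (`|be j| * (W + B')).
      by rewrite ler_wpM2l ?(ltW eps0)// ler_wpM2l//; lra.
    have k3 : 0 <= eps * ((W + B') * `|n j|).
      by rewrite mulr_ge0 ?(ltW eps0)// mulr_ge0// addr_ge0.
    have k4 : 0 <= P * (d * `|n j|) by rewrite !mulr_ge0.
    have k5 : 0 <= D * ((u j.+1 - u j) * `|be j|) by rewrite !mulr_ge0// ltW.
    lra.
  rewrite !big_split /= -!mulr_sumr sumr_const_nat subn0 -[ka *+ N]mulr_natl.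
  rewrite (telescope_sumr (Nrm \o sg))//= sg0 [Nrm 0]yosida_norm0 subr0.
  have t1 := ler_wpM2l al0 sumB; have t2 := ler_wpM2l bt0 sumW.
  have P20 : 0 <= 2 * P by rewrite mulr_ge0.
  have t3 := ler_wpM2l P20 (Nrm_le N (leqnn N)).
  move: t1 t2 t3; move: (\sum_(0 <= j < N) _) (\sum_(0 <= j < N) _) (N%:R * ka) => S1 S2 nk.
  rewrite /al /bt; lra.
(* Invariant: [K0] is the reference compensator at the start of interval i, before [n i] is
   released. It follows the scheme up to the accumulated drift, and the penalized compensator up to
   the accumulated energy error. *)
have key i : (i <= N)%N -> exists K0 : H,
  [/\ `|K0 + n i - (m (u i) - X i)| <= \sum_(0 <= j < i) dl j,
      ip (K0 - l (sg i)) (K0 - l (sg i)) <= \sum_(0 <= j < i) Er j &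
      forall j, (j < i)%N -> forall s, sg j <= s -> s < sg j.+1 ->
        exists c, [/\ 0 <= c, c <= 1, c * (s - sg j) <= eps &
          `|U s - Z j - c *: n j| <= P + b + ka]].
  elim: i => [_|i IH iN].
    exists 0; split=> //; rewrite big_geq//.
      by rewrite add0r (eu_n0 eu) (eu_X0 eu) u0 subrr subr0 normr0.
    by rewrite sg0 /l (yosida_l0 hip hU) subrr ip0l.
  have [K0 [dK0 eK0 IHj]] := IH (ltnW iN).
  have hi := h0 i iN; have si := s0 i iN.
  have Zi : forall w, ip (Z i + (u i.+1 - u i) *: be i) w = ip (X i + (leftlim m (u i.+1) - m (u i))) w.
    by move=> w; rewrite (eu_Z eu iN).
  (* The input mismatch splits into the oscillation [E], the accumulated drift (om + d) W, and the
     slope over a duration off by at most u i.+1 - u i + d, that is Hb + d W. This is the origin of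
     [P]. *)
  have pos s : sg i <= s -> s < sg i.+1 -> `|Z i + K0 + n i + (s - sg i) *: be i - mu s| <= P.
    move=> s1 s2.
    have -> : Z i + K0 + n i + (s - sg i) *: be i - mu s =
       (leftlim m (u i.+1) - mu s) + (K0 + n i - (m (u i) - X i))
        + ((s - sg i) - (u i.+1 - u i)) *: be i.
      by clear -hip Zi; apply: (ip_inj hip) => w; have := Zi w; rewrite !ipE; lra.
    apply: le_trans (ler_normD _ _) _.
    have a1 := ler_normD (leftlim m (u i.+1) - mu s) (K0 + n i - (m (u i) - X i)).
    have a2 := near i s iN s1 s2.
    have a3 := dlsum i (ltnW iN).
    have a4 : `|s - sg i - (u i.+1 - u i)| <= (u i.+1 - u i) + d.
      have := dsg i iN; rewrite !ler_norml => /andP[]; rewrite /= => q1 q2.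
      by apply/andP; clear -q1 q2 s1 s2 hi d0; split; lra.
    have a5 : `|(s - sg i - (u i.+1 - u i)) *: be i| <= ((u i.+1 - u i) + d) * `|be i|.
      by rewrite normrZ ler_wpM2r.
    have a6 := hbe i iN.
    have a7 : d * `|be i| <= d * W.
      by rewrite ler_wpM2l//; have := bW i iN; have := normr_ge0 (n i); lra.
    rewrite /P; clear -a1 a2 a3 a5 a6 a7 dK0; lra.
  have [|h1 [c [c0 c1 ct hc]]] := @yosida_piece _ _ _ hip _ hA A_neq0 eps mu U eps0 hU
    (Z i) (X i) (be i) (n i) K0 (sg i) (sg i.+1) P D b ka
    (sgm i (ltnW iN)) (sgs i iN) (eu_A eu iN) (eu_K eu (ltnW iN)) (eu_normal eu (ltnW iN))
    P0 (ZX i iN) ka0 b0 pos.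
    apply: le_trans (Ersum i.+1 iN).
    by rewrite big_nat_recr//= lerD2r.
  exists (K0 + (1 - c) *: n i + (sg i.+1 - sg i) *: be i); split.
  - have Xi w : ip (X i.+1 + n i.+1) w = ip (Z i + jump m (u i.+1)) w.
      by rewrite (eu_n eu iN).
    have -> : K0 + (1 - c) *: n i + (sg i.+1 - sg i) *: be i + n i.+1 - (m (u i.+1) - X i.+1) =
       (K0 + n i - (m (u i) - X i)) - c *: n i + (sg i.+1 - sg i - (u i.+1 - u i)) *: be i.
      by clear -hip Zi Xi; apply: (ip_inj hip) => w; have := Zi w; have := Xi w; rewrite /jump !ipE; lra.
    rewrite big_nat_recr//=; apply: le_trans (ler_normD _ _) _.
    have b1 := ler_normB (K0 + n i - (m (u i) - X i)) (c *: n i).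
    have b2 : `|c *: n i| <= om * `|n i|.
      rewrite normrZ ger0_norm// ler_wpM2r// -(ler_pM2r si).
      exact: le_trans ct (epsom i iN).
    have b3 : `|(sg i.+1 - sg i - (u i.+1 - u i)) *: be i| <= d * `|be i|.
      by rewrite normrZ ler_wpM2r// dsg.
    rewrite /dl; clear -b1 b2 b3 dK0; lra.
  - rewrite big_nat_recr//=; apply: le_trans hc _.
    by rewrite -/(l _) -/(Nrm _) -/(Nrm _) /Er lerD2r.
  - move=> j; rewrite ltnS leq_eqVlt => /predU1P[->//|]; exact: IHj.
by move=> i iN; have [K0 [_ _ h]] := key N (leqnn N); exact: h.
Qed.

(** * Convergence *)

Section Skorokhod.
Context {R : realType}.

(** Nonemptiness of [D] rules out the supremum of the empty set, which is minus infinity. *)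
Lemma ereal_sup_cvg0 {I : Type} (D : set I) (g : R -> I -> R) : D !=set0 ->
  (forall eps t, 0 <= g eps t) ->
  (ereal_sup [set (g eps t)%:E | t in D] @[eps --> 0^'+] --> 0%E) <->
  (forall w : R, 0 < w -> exists2 e0 : R, 0 < e0 & forall eps, 0 < eps -> eps <= e0 ->
    forall t, D t -> g eps t <= w).
Proof.
move=> [t0 Dt0] g0; split.
  move=> cv w w0.
  have : nbhs (0%E : \bar R) [set y | (y < w%:E)%E].
    by exists w => //= y; rewrite /ball /= sub0r normrN lte_fin; apply: le_lt_trans; exact: ler_norm.
  move=> nw; have : \forall eps \near 0^'+, (ereal_sup [set (g eps t)%:E | t in D] < w%:E)%E.
    exact: (cv [set y | (y < w%:E)%E] nw).
  rewrite near_withinE => -[d /= d0 hd].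
  exists (d / 2); first by rewrite divr_gt0.
  move=> eps eps0 epsd t Dt.
  have /= := hd eps; rewrite sub0r normrN gtr0_norm// => /(_ ltac:(lra) eps0) /ltW h.
  rewrite -lee_fin; apply: le_trans h; apply: ereal_sup_ubound; exists t => //.
move=> h A [w /= w0 hA].
have [|e0 e00 he] := h (w / 2); first by rewrite divr_gt0.
change (\forall eps \near 0^'+, A (ereal_sup [set (g eps t)%:E | t in D])).
rewrite near_withinE; exists e0 => //= eps.
rewrite /ball /= sub0r normrN => epse eps0.
rewrite gtr0_norm// in epse.
set S := ereal_sup _.
have S1 : (S <= (w / 2)%:E)%E.
  by apply: ge_ereal_sup => _ [t Dt <-]; rewrite lee_fin; apply: he => //; exact: ltW.
have S2 : (0 <= S)%E.
  apply: (@le_trans _ _ (g eps t0)%:E); first by rewrite lee_fin.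
  by apply: ereal_sup_ubound; exists t0.
have Sf : S \is a fin_num by rewrite ge0_fin_numE// (le_lt_trans S1)// ltry.
rewrite -(fineK Sf); apply: hA; rewrite /ball /= sub0r normrN.
move: S1 S2; rewrite -(fineK Sf) !lee_fin => S1 S2.
rewrite ger0_norm//; lra.
Qed.

(** [kap] is the inverse of [lam], set to 0 at negative times; it carries a time of the penalized
    path back to a time of [m]. *)
Lemma time_change_facts (lam : R -> R) : time_change lam ->
  [/\ lam 0 = 0, (forall t : R, 0 <= t -> 0 <= lam t),
   (forall s t : R, 0 <= s -> s < t -> lam s < lam t) &
   exists kap : R -> R, (forall s : R, 0 <= s -> 0 <= kap s /\ lam (kap s) = s) /\
     (forall s t : R, 0 <= s -> s <= t -> kap s <= kap t)].
Proof.
move=> [[fn _ sj] inc _].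
have pos t : 0 <= t -> 0 <= lam t.
  by move=> t0; have := fn t; rewrite /= !in_itv /= !andbT; apply.
have incr s t : 0 <= s -> s < t -> lam s < lam t.
  move=> s0 st; apply: inc => //; rewrite in_itv /= andbT//.
  by apply: le_trans s0 (ltW st).
have surj s : 0 <= s -> exists t, 0 <= t /\ lam t = s.
  move=> s0; have [|t] := sj s; first by rewrite /= in_itv /= s0.
  by rewrite /= in_itv /= andbT => t0 ts; exists t.
have lam0 : lam 0 = 0.
  have [t [t0 lt]] := surj 0 (lexx 0).
  case: (eqVneq t 0) => [t00|tn0]; first by rewrite t00 in lt.
  have {}t0 : 0 < t by rewrite lt_def tn0.
  by have := incr 0 t (lexx 0) t0; rewrite lt ltNge pos.
pose kap s := if pselect (0 <= s) is left h then sval (cid (surj s h)) else 0.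
have kapP s : 0 <= s -> 0 <= kap s /\ lam (kap s) = s.
  by move=> s0; rewrite /kap; case: pselect => // h; case: cid.
split => //; exists kap; split => // s t s0 st.
have [k1 k2] := kapP s s0; have [k3 k4] := kapP t (le_trans s0 st).
by rewrite leNgt; apply/negP => /(incr _ _ k3); rewrite k2 k4 ltNge st.
Qed.

Lemma skorokhod_near {E : normedModType R} (y : R -> R -> E) (y0 : R -> E) :
  skorokhod_cvg y y0 -> exists lam : R -> R -> R,
  [/\ forall eps, 0 < eps -> time_change (lam eps),
    ereal_sup [set (`|lam eps t - t|)%:E | t in `[0, +oo[] @[eps --> 0^'+] --> 0%E &
   forall T w : R, 0 < w -> exists2 e0 : R, 0 < e0 & forall eps, 0 < eps -> eps <= e0 ->
    (forall t : R, 0 <= t -> `|lam eps t - t| <= w) /\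
    (forall t : R, 0 <= t -> t <= T -> `|y eps (lam eps t) - y0 t| <= w)].
Proof.
move=> [_ _ [lam [tc lamc yc]]]; exists lam; split => // T w w0.
have ne : [set` `[0:R, +oo[]  !=set0 by exists 0; rewrite /= in_itv /= lexx.
have [e1 e10 h1] := (ereal_sup_cvg0 (g := fun eps t => `|lam eps t - t|) ne (fun _ _ => normr_ge0 _)).1 lamc w w0.
pose T' := Num.max T 1.
have T'0 : 0 < T' by rewrite lt_max ltr01 orbT.
have ne' : [set` `[0, T']]  !=set0 by exists 0; rewrite /= in_itv /= lexx ltW.
have [e2 e20 h2] := (ereal_sup_cvg0 (g := fun eps t => `|y eps (lam eps t) - y0 t|) ne' (fun _ _ => normr_ge0 _)).1 (yc T' T'0) w w0.
exists (Num.min e1 e2); first by rewrite lt_min e10.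
move=> eps eps0; rewrite le_min => /andP[l1 l2]; split.
  by move=> t t0; apply: h1 => //=; rewrite in_itv /= t0.
by move=> t t0 tT; apply: h2 => //=; rewrite in_itv /= t0 /T' le_max tT.
Qed.

End Skorokhod.

Lemma partition_mesh {R : realType} (a b : R) N u : partition_of a b N u ->
  exists2 h, 0 < h & forall i, (i < N)%N -> h <= u i.+1 - u i.
Proof.
move=> [_ _ us].
have h0 i : (i < N)%N -> 0 < u i.+1 - u i by move=> iN; rewrite subr_gt0 us.
suff : forall k, (k <= N)%N -> exists2 h, 0 < h & forall i, (i < k)%N -> h <= u i.+1 - u i by apply.
elim=> [_|k IH kN]; first by exists 1.
have [h hp hk] := IH (ltnW kN).
exists (Num.min h (u k.+1 - u k)); first by rewrite lt_min hp h0.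
move=> i; rewrite ltnS leq_eqVlt => /predU1P[->|ik].
  by rewrite ge_min lexx orbT.
by rewrite ge_min hk.
Qed.

Lemma ler_sum_shift {R : realType} (F : nat -> R) N : F 0%N = 0 -> (forall i, 0 <= F i) ->
  \sum_(0 <= i < N) F i <= \sum_(0 <= i < N) F i.+1.
Proof.
move=> F0 Fp; have : \sum_(0 <= i < N.+1) F i = F 0%N + \sum_(0 <= i < N) F i.+1.
  by rewrite big_nat_recl.
by rewrite big_nat_recr//= F0 add0r => <-; rewrite lerDl.
Qed.

(** Total error of [yosida_chain] with |Z i - X i| <= 3 s, written as a multiple of [s] whose factor
    depends only on the uniform bounds [B] and [B']. *)
Lemma chain_budget {R : realType} (P s B B' dW e nk : R) :
  0 <= P -> P <= 7 * s -> 0 <= s -> 0 <= B -> 0 <= B' -> 0 <= dW -> dW <= 1 ->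
  e <= s -> nk <= s ->
  2 * (P * (B + dW + B') + B * (3 * s) + e) + nk <= s * (14 * (B + 1 + B') + 6 * B + 3).
Proof.
move=> P0 P7 s0 B0 B'0 dW0 dW1 es nks.
have : P * (B + dW + B') <= 7 * s * (B + 1 + B') by rewrite ler_pM//; lra.
lra.
Qed.

Lemma eventually_all {R : realType} N (P : nat -> R -> Prop) :
  (forall i, (i < N)%N -> exists2 e0 : R, 0 < e0 & forall e, 0 < e -> e <= e0 -> P i e) ->
  exists2 e0 : R, 0 < e0 & forall e, 0 < e -> e <= e0 -> forall i, (i < N)%N -> P i e.
Proof.
elim: N => [_|N IH hP]; first by exists 1.
have [e1 e10 h1] := IH (fun i iN => hP i (ltnW iN)).
have [e2 e20 h2] := hP N (ltnSn N).
exists (Num.min e1 e2); first by rewrite lt_min e10.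
move=> e e0; rewrite le_min => /andP[l1 l2] i; rewrite ltnS leq_eqVlt => /predU1P[->|iN].
  exact: h2.
exact: h1.
Qed.

Lemma cadlag_comp {R : realType} {E F : completeNormedModType R} (h : E -> F) (f : R -> E) :
  (forall z z', `|h z - h z'| <= `|z - z'|) -> cadlag f -> cadlag (h \o f).
Proof.
move=> hl [fr fl].
have ch : continuous h.
  move=> z; apply/cvgrPdist_le => w w0; near=> z'.
  apply: le_trans (hl _ _) _; near: z'.
  by have /cvgrPdist_le := @cvg_id _ (nbhs z); apply.
split=> t t0; first by apply: cvg_comp (fr t t0) (ch _).
apply/cvg_ex; exists (h (lim (f s @[s --> t^'-]))).
by apply: cvg_comp (fl t t0) (ch _).
Unshelve. all: by end_near. Qed.

Lemma cadlag_pair {R : realType} {E F : completeNormedModType R} (f : R -> E) (g : R -> F) :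
  cadlag f -> cadlag g -> @cadlag R (E * F)%type (fun t => (f t, g t)).
Proof.
move=> [fr fl] [gr gl]; split=> t t0.
  by apply: cvg_pair; [exact: fr|exact: gr].
apply/cvg_ex; exists (lim (f s @[s --> t^'-]), lim (g s @[s --> t^'-])).
by apply: cvg_pair; [exact: fl|exact: gl].
Qed.

Lemma continuous_jump0 {R : realType} {E : completeNormedModType R} (f : R -> E) :
  {within `[0, +oo[, continuous f} -> forall t, 0 <= t -> jump f t = 0.
Proof.
move=> /continuous_within_itvcyP[fc _] t; rewrite le_eqVlt => /predU1P[<-|t0].
  exact: jump0.
rewrite /jump /leftlim t0; apply/eqP; rewrite subr_eq0 eq_sym; apply/eqP.
apply: cvg_lim => //; apply: cvg_at_left_filter; apply: fc.
by rewrite in_itv /= t0.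
Qed.

(** * Approximation along the time change and the three limits *)

Section Main.
Context {R : realType} {H : completeNormedModType R} {ip : {dot H for idfun}}.
Hypothesis hip : induces_norm ip.
Context {A : H -> set H}.
Hypothesis hA : maximal_monotone ip A.
Variables (a : H) (r c : R).
Hypotheses (r0 : 0 < r) (c0 : 0 <= c) (ball_a : forall q, `|q - a| <= r -> dom A q)
  (coer : forall al be, A al be -> r * `|be| <= ip be (al - a) + c * (1 + `|al - a|)).
Let K := closure (dom A).
Let Pi := projection K.
Variables (m x k : R -> H).
Hypotheses (cm : cadlag m) (m0K : K (m 0)) (SP : skorokhod_problem ip A Pi m x k).

Lemma dom_center : dom A a.
Proof. by apply: ball_a; rewrite subrr normr0 ltW. Qed.

Lemma dom_neq0 : dom A !=set0. Proof. by exists a; exact: dom_center. Qed.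

(** [B] is fixed before the precision [s]. The time [ts] is never interior to an interval, so that a
    prescribed time can be made a node. *)
Lemma euler_approx T : 0 < T -> exists2 B, 0 <= B & forall s ts : R, 0 < s ->
  exists N u X Z n be,
  [/\ partition_of 0 T N u, @euler_scheme R H ip A m N u X Z n be,
    forall i, (i < N)%N -> ~ (u i < ts /\ ts < u i.+1),
    forall i, (i <= N)%N -> jump m (u i) = 0 -> n i = 0 &
  [/\ \sum_(0 <= i < N) ((u i.+1 - u i) * `|be i| + `|n i|) <= B,
    forall i t, (i < N)%N -> u i <= t -> t < u i.+1 -> `|leftlim m (u i.+1) - m t| <= s,
    forall i t, (i < N)%N -> u i <= t -> t < u i.+1 -> `|x t - X i| <= 2 * s,
    forall i, (i < N)%N -> `|Z i - X i| <= 3 * s &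
    forall i, (i < N)%N -> (u i.+1 - u i) * `|be i| <= 4 * s]].
Proof.
move=> T0.
have [B B0 hB] := euler_BV hip r0 c0 ball_a coer T0 cm.
have [v kv] := BVloc_control (sp_BV SP).
have cx := sp_cadlag_x SP.
exists B => // s ts s0.
pose M0 := 8 * (v T - v 0) + 4 * B.
have M00 : 0 <= M0.
  by rewrite addr_ge0// mulr_ge0// subr_ge0; apply: (control_mono kv) => //; exact: ltW.
have M01 : 0 < M0 + 1 by lra.
(* The three bounds serve the oscillation estimates, the hypothesis of [euler_BV], and the bound eta
   M0 <= s^2 in [euler_close]. *)
pose eta := Num.min (Num.min s (r / 4)) (s ^+ 2 / (M0 + 1)).
have eta0 : 0 < eta by rewrite !lt_min s0 !divr_gt0// exprn_gt0.
have eta1 : eta <= s by rewrite /eta !ge_min lexx.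
have eta2 : eta <= r / 4 by rewrite /eta !ge_min lexx orbT.
have eta3 : eta * M0 <= s ^+ 2.
  have : eta * (M0 + 1) <= s ^+ 2 by rewrite -ler_pdivlMr// /eta ge_min lexx orbT.
  rewrite mulrDr mulr1; lra.
have [N [u [pu Pu]]] : exists N u, partition_of 0 T N u /\ forall i, (i < N)%N ->
    [/\ osc_le m eta (u i) (u i.+1), osc_le x eta (u i) (u i.+1) & ~ (u i < ts /\ ts < u i.+1)].
  apply: (@exists_partition _ (fun p q => [/\ osc_le m eta p q, osc_le x eta p q & ~ (p < ts /\ ts < q)])).
    exact: ltW.
  move=> t t0 tT.
  have [d1 d10 [h1 h1']] := cadlag_local cm t0 eta0.
  have [d2 d20 [h2 h2']] := cadlag_local cx t0 eta0.
  (* Intervals with end point [t] are kept shorter than the distance from [t] to [ts], unless [t] is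
     [ts] itself. *)
  pose d3 := if t == ts then 1 else `|t - ts|.
  have d30 : 0 < d3 by rewrite /d3; case: eqVneq => // tts; rewrite normr_gt0 subr_eq0.
  have notin p : `|t - p| < d3 -> ~ (p < ts /\ ts < t) /\ ~ (t < ts /\ ts < p).
    rewrite /d3; case: eqVneq => [->|_]; first by rewrite !ltxx; split=> -[].
    move=> lt; split=> -[l1 l2]; move: lt.
      rewrite !gtr0_norm ?subr_gt0//; [lra|exact: lt_trans l1 l2].
    rewrite !ltr0_norm ?subr_lt0//; [lra|exact: lt_trans l1 l2].
  exists (Num.min (Num.min d1 d2) d3); first by rewrite !lt_min d10 d20.
  split=> p; rewrite !lt_min.
    move=> p0 pt /andP[/andP[l1 l2] l3]; split; [exact: h1|exact: h2|].
    by have [] := notin p ltac:(by rewrite gtr0_norm ?subr_gt0).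
  move=> tp /andP[/andP[l1 l2] l3]; split; [exact: h1'|exact: h2'|].
  by have [] := notin p ltac:(by rewrite ltr0_norm ?subr_lt0// opprB).
have [X [Z [n [be eu]]]] := euler_exists hip hA dom_neq0 m0K pu.
have oscm i (iN : (i < N)%N) : osc_le m eta (u i) (u i.+1) by have [] := Pu i iN.
have oscx i (iN : (i < N)%N) : osc_le x eta (u i) (u i.+1) by have [] := Pu i iN.
have sumB := hB N u X Z n be eta pu eu eta2 oscm.
have [XD ZD] := euler_close hip hA dom_neq0 SP kv (ltW eta0) pu eu oscx sumB.
have Xs i : (i <= N)%N -> `|X i - x (u i)| <= s.
  by move=> iN; apply: (norm_le_sqr hip (ltW s0)); apply: le_trans (XD i iN) eta3.
have Zs i : (i < N)%N -> `|Z i - leftlim x (u i.+1)| <= s.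
  by move=> iN; apply: (norm_le_sqr hip (ltW s0)); apply: le_trans (ZD i iN) eta3.
have [u0 uN us] := pu.
have ui0 i : (i <= N)%N -> 0 <= u i by move=> iN; rewrite -u0; exact: (partition_mono pu).
have ZX i : (i < N)%N -> `|Z i - X i| <= 3 * s.
  move=> iN; have e1 := Zs i iN; have e2 := Xs i (ltnW iN).
  have e3 := osc_leftlim cx (ui0 i (ltnW iN)) (us i iN) (oscx i iN) (lexx _) (us i iN).
  have := ler_distD (leftlim x (u i.+1)) (Z i) (X i).
  have := ler_distD (x (u i)) (leftlim x (u i.+1)) (X i).
  rewrite (distrC (leftlim x _) (x (u i))) (distrC (x (u i)) (X i)); lra.
exists N, u, X, Z, n, be; split=> //.
- by move=> i iN; have [] := Pu i iN.
(* Without a jump of [m] the projection acts on [Z i], which is already in the domain. *)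
- case=> [|i] iN jm; first exact: (eu_n0 eu).
  have := eu_n eu iN; rewrite (eu_X eu iN) jm addr0.
  rewrite (projection_id hip hA dom_neq0); last first.
    by apply: subset_closure; exists (be i); exact: (eu_A eu iN).
  by move/eqP; rewrite -subr_eq0 addrAC subrr add0r => /eqP.
split=> //.
(* The shift of index uses n 0 = 0: from here on the normal vector belongs to the interval on its
   right, where it relaxes. *)
- rewrite big_split /=; apply: le_trans sumB; rewrite big_split /= lerD2l.
  by apply: (ler_sum_shift (F := fun i => `|n i|)) => //; rewrite (eu_n0 eu) normr0.
- move=> i t iN t1 t2; rewrite distrC; apply: le_trans eta1.
  exact: (osc_leftlim cm (ui0 i (ltnW iN)) (us i iN) (oscm i iN)).
- move=> i t iN t1 t2; have e1 := Xs i (ltnW iN).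
  have e2 := oscx i iN t (u i) t1 t2 (lexx _) (us i iN).
  have := ler_distD (x (u i)) (x t) (X i); rewrite (distrC (x (u i))); lra.
- move=> i iN; have h0 : 0 < u i.+1 - u i by rewrite subr_gt0 us.
  have -> : (u i.+1 - u i) * `|be i| = `|(u i.+1 - u i) *: be i| by rewrite normrZ gtr0_norm.
  have -> : (u i.+1 - u i) *: be i = (leftlim m (u i.+1) - m (u i)) - (Z i - X i).
    by rewrite opprB addrA [_ + X i]addrC -(eu_Z eu iN) addrAC subrr add0r.
  have e1 := osc_leftlim cm (ui0 i (ltnW iN)) (us i iN) (oscm i iN) (lexx _) (us i iN).
  have e2 := ZX i iN.
  apply: le_trans (ler_normB _ _) _; rewrite distrC; lra.
Qed.

Variables (meps xeps : R -> R -> H) (lam : R -> R -> R).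
Hypothesis hxeps : forall eps, 0 < eps -> yosida_solution A eps (meps eps) (xeps eps).
Hypothesis tc : forall eps, 0 < eps -> time_change (lam eps).
Hypothesis near : forall T w : R, 0 < w -> exists2 e0 : R, 0 < e0 &
  forall eps, 0 < eps -> eps <= e0 ->
    (forall t, 0 <= t -> `|lam eps t - t| <= w) /\
    (forall t, 0 <= t -> t <= T -> `|meps eps (lam eps t) - m t| <= w).

Lemma yosida_BV_uniform T : 0 < T -> exists2 B, 0 <= B & exists2 e0 : R, 0 < e0 &
  forall eps, 0 < eps -> eps <= e0 ->
  \int[@lebesgue_measure R]_(s in `[0, T]) `|yosida A eps (xeps eps s)| <= B.
Proof.
move=> T0; have r4 : 0 < r / 4 by rewrite divr_gt0.
have [C [V [CV mC]]] := cadlag_BV_approx (T + 1) cm r4.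
have T1 : 0 <= T + 1 by lra.
have VT : 0 <= V (T + 1) - V 0 by apply: le_trans (CV 0 (T + 1) T1).
have [B B0 hB] := yosida_BV hip hA r0 c0 dom_center coer T0 VT (normr_ge0 (C 0 - a)).
exists B => //.
(* The bound 1 keeps reference times below [T + 1]; r / 4 plus the r / 4 of [mC] gives the r / 2 of
   [yosida_BV]. *)
have w0 : 0 < Num.min 1 (r / 4) by rewrite lt_min ltr01.
have [e1 e10 h1] := near (T + 1) w0.
exists (Num.min e1 1); first by rewrite lt_min e10 ltr01.
move=> eps eps0; rewrite le_min => /andP[epse eps1].
have [h2 h3] := h1 eps eps0 epse.
have [l0 lpos linc [kap [kapP kapm]]] := time_change_facts (tc eps0).
have kap0 : kap 0 = 0.
  have [k1 k2] := kapP 0 (lexx 0); apply/eqP; rewrite eq_le k1 andbT leNgt; apply/negP.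
  by move=> /(linc 0 _ (lexx 0)); rewrite k2 l0 ltxx.
have kapT s : 0 <= s -> s <= T -> kap s <= T + 1.
  move=> s0 sT; have [k1 k2] := kapP s s0.
  have := h2 _ k1; rewrite k2 le_min => /andP[+ _].
  rewrite distrC => /(le_trans (ler_norm _)); lra.
(* The input is compared with the time-changed path C o kap, whose variation is bounded by that of
   [C] whatever [eps]. *)
apply: (hB eps (meps eps) (xeps eps) (C \o kap) (V \o kap) eps0 eps1 (hxeps eps0)).
- by move=> s t s0 st; apply: CV; exact: kapm.
- rewrite /= kap0 lerD2r.
  have := CV _ _ (kapT T (ltW T0) (lexx _)); move=> /(le_trans (normr_ge0 _)); rewrite subr_ge0.
  exact.
- by rewrite /= kap0.
- move=> s s0 sT; have [k1 k2] := kapP s s0.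
  have kT := kapT s s0 (ltW sT).
  have := h3 _ k1 kT; rewrite k2 le_min => /andP[_ q1].
  have q2 := mC _ k1 kT.
  have := ler_distD (m (kap s)) (meps eps s) (C (kap s)); rewrite /=; lra.
Qed.

(** Common source of the three limits. No smallness of c n is claimed: just after a jump x^eps
    really lies near X i + n i, and each limit disposes of this term in its own way. *)
Lemma yosida_approx T g ts : 0 < T -> 0 < g -> exists N u X n,
  [/\ partition_of 0 T N u,
    forall i, (i < N)%N -> ~ (u i < ts /\ ts < u i.+1),
    forall i, (i <= N)%N -> K (X i) /\ forall q, K q -> 0 <= ip (n i) (X i - q),
    forall i, (i <= N)%N -> jump m (u i) = 0 -> n i = 0 &
    (forall i t, (i < N)%N -> u i <= t -> t < u i.+1 -> `|x t - X i| <= g) /\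
    exists2 e0 : R, 0 < e0 & forall eps, 0 < eps -> eps <= e0 ->
      forall i t, (i < N)%N -> u i <= t -> t < u i.+1 ->
      exists c, [/\ 0 <= c, c <= 1, c * (lam eps t - lam eps (u i)) <= eps &
        `|xeps eps (lam eps t) - X i - c *: n i| <= g]].
Proof.
move=> T0 g0.
have [B B0 hB] := euler_approx T0.
have T10 : 0 < T + 1 by lra.
have [B' B'0 [e1 e10 hB']] := yosida_BV_uniform T10.
pose M := 14 * (B + 1 + B') + 6 * B + 3.
have M0 : 0 < M by rewrite /M; lra.
(* The final error is at most P + g / 4 + ka + 3 s <= 11 s + g / 4, and s M <= (g / 4)^2 is the
   energy budget with b = g / 4. *)
have [s [s0 s1 sg sM]] : exists s, [/\ 0 < s, s <= 1, 32 * s <= g & s * M <= (g / 4) ^+ 2].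
  exists (Num.min (Num.min 1 (g / 32)) ((g / 4) ^+ 2 / M)); split.
  - by rewrite !lt_min ltr01 !divr_gt0// exprn_gt0// divr_gt0.
  - by rewrite !ge_min lexx.
  - by rewrite mulrC -ler_pdivlMr// !ge_min lexx orbT.
  - by rewrite -ler_pdivlMr// ge_min lexx orbT.
have [N [u [X [Z [n [be [pu eu tsP nP [sumB hm hx ZX hbe]]]]]]]] := hB s ts s0.
have [u0 uN us] := pu.
have [hmin h0 hmesh] := partition_mesh pu.
exists N, u, X, n; split=> //.
  by move=> i iN; split; [exact: (eu_K eu)|exact: (eu_normal eu)].
split.
  move=> i t iN t1 t2; apply: le_trans (hx i t iN t1 t2) _; lra.
pose W := \sum_(0 <= i < N) (`|n i| + `|be i|).
have W0 : 0 <= W by apply: sumr_ge0 => i _; exact: addr_ge0.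
have W1 : 0 < W + 1 by lra.
(* The partition is now fixed, so [W] is a constant. With om W <= s / 4 and d <= om, the drift (om +
   2 d) W is below [s], hence P <= 7 s. *)
pose om := s / (4 * (W + 1)).
have om0 : 0 < om by rewrite divr_gt0// mulr_gt0.
have omW : om * W <= s / 4.
  have -> : om * W = s / 4 * (W / (W + 1)).
    by rewrite /om; field; rewrite gt_eqF.
  rewrite ler_piMr//; first by rewrite divr_ge0// ltW.
  by rewrite ler_pdivrMr// mul1r; lra.
pose d := Num.min (Num.min (hmin / 2) om) 1.
have d0 : 0 < d by rewrite !lt_min om0 ltr01 divr_gt0.
have d1 : d <= hmin / 2 by rewrite !ge_min lexx.
have d2 : d <= om by rewrite !ge_min lexx orbT.
have d3 : d <= 1 by rewrite !ge_min lexx orbT.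
have w0 : 0 < Num.min (d / 2) s by rewrite lt_min s0 divr_gt0.
have [e2 e20 hnear] := near T w0.
have WB0 : 0 < W * (W + B') + 1 by rewrite ltr_wpDl// mulr_ge0// addr_ge0.
exists (Num.min (Num.min e1 e2) (Num.min (om * (hmin / 2)) (s / (W * (W + B') + 1)))).
  by rewrite !lt_min e10 e20 divr_gt0// andbT mulr_gt0// divr_gt0.
move=> eps eps0; rewrite !le_min => /andP[/andP[epse1 epse2] /andP[epse3 epse4]].
have [near1 near2] := hnear eps eps0 epse2.
have [l0 lpos linc [kap [kapP kapm]]] := time_change_facts (tc eps0).
have lmono p q : 0 <= p -> p <= q -> lam eps p <= lam eps q.
  by move=> p0; rewrite le_eqVlt => /predU1P[->//|pq]; exact/ltW/linc.
have ui i : (i <= N)%N -> 0 <= u i /\ u i <= T.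
  by move=> iN; split; [rewrite -u0|rewrite -uN]; exact: (partition_mono pu).
have near1' t : 0 <= t -> `|lam eps t - t| <= d / 2.
  by move=> t0; apply: le_trans (near1 t t0) _; rewrite ge_min lexx.
have near2' t : 0 <= t -> t <= T -> `|meps eps (lam eps t) - m t| <= s.
  by move=> t0 tT; apply: le_trans (near2 t t0 tT) _; rewrite ge_min lexx orbT.
pose sg' i := lam eps (u i).
have sgs i : (i < N)%N -> sg' i < sg' i.+1.
  by move=> iN; apply: linc; [have [] := ui i (ltnW iN)|exact: us].
have dsg i : (i < N)%N -> `|sg' i.+1 - sg' i - (u i.+1 - u i)| <= d.
  move=> iN; have q1 := near1' _ (ui i (ltnW iN)).1; have q2 := near1' _ (ui i.+1 iN).1.
  have -> : sg' i.+1 - sg' i - (u i.+1 - u i) = (sg' i.+1 - u i.+1) - (sg' i - u i).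
    by ring.
  by apply: le_trans (ler_normB _ _) _; rewrite [leRHS]splitr lerD.
have epsom i : (i < N)%N -> eps <= om * (sg' i.+1 - sg' i).
  move=> iN; apply: le_trans epse3 _; rewrite ler_wpM2l ?(ltW om0)//.
  have := dsg i iN; rewrite ler_norml => /andP[q1 _].
  by have q2 := hmesh i iN; lra.
have nearE i t : (i < N)%N -> sg' i <= t -> t < sg' i.+1 -> `|leftlim m (u i.+1) - meps eps t| <= 2 * s.
  move=> iN t1 t2; have [ui0 uiT] := ui i (ltnW iN); have [uj0 ujT] := ui i.+1 iN.
  have t0 : 0 <= t by apply: le_trans t1; exact: lpos.
  have [k1 k2] := kapP t t0.
  have k3 : u i <= kap t.
    by rewrite leNgt; apply/negP => /(linc _ _ k1); rewrite k2 ltNge t1.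
  have k4 : kap t < u i.+1.
    by rewrite ltNge; apply/negP => /(lmono _ _ uj0); rewrite k2 leNgt t2.
  have q1 := hm i _ iN k3 k4; have q2 := near2' _ k1 (le_trans (ltW k4) ujT).
  rewrite k2 distrC in q2.
  apply: le_trans (ler_distD (m (kap t)) _ _) _.
  by rewrite mulr_natl mulr2n lerD.
have intB : \int[@lebesgue_measure R]_(t in `[0, sg' N]) `|yosida A eps (xeps eps t)| <= B'.
  apply: le_trans (hB' eps eps0 epse1).
  apply: (yosida_norm_mono hip hA dom_neq0 eps0 (hxeps eps0)); first by apply: lpos; have [] := ui N (leqnn N).
  have := near1' _ (ltW T0); rewrite /sg' uN => /(le_trans (ler_norm _)).
  by lra.
(* The grid tolerance is spent once on each of the [N] intervals. *)
pose ka := s / N.+1%:R.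
have ka0 : 0 < ka by rewrite divr_gt0.
have kas : ka <= s by rewrite ler_pdivrMr// ler_peMr ?(ltW s0)// ler1n.
have Nka : N%:R * ka <= s.
  rewrite /ka mulrCA ler_piMr ?(ltW s0)// ler_pdivrMr ?ltr0n// mul1r ler_nat.
  exact: leqnSn.
have g40 : 0 <= g / 4 by rewrite divr_ge0// ltW.
have s20 : 0 <= 2 * s by rewrite mulr_ge0// ltW.
have s30 : 0 <= 3 * s by rewrite mulr_ge0// ltW.
have s40 : 0 <= 4 * s by rewrite mulr_ge0// ltW.
have dW : d * W <= om * W by rewrite ler_wpM2r.
have P7 : 2 * s + 4 * s + (om + 2 * d) * W <= 7 * s by lra.
have P0 : 0 <= 2 * s + 4 * s + (om + 2 * d) * W.
  by rewrite addr_ge0 ?addr_ge0// mulr_ge0// addr_ge0 ?(ltW om0)// mulr_ge0 ?(ltW d0).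
have sg0' : sg' 0%N = 0 by rewrite /sg' u0.
have := @yosida_chain R H ip hip A hA dom_neq0 m N u X Z n be eps (meps eps) (xeps eps) sg'
  (2 * s) (3 * s) (4 * s) d om W B B' ka (g / 4) eps0 (hxeps eps0) u0 us eu sg0' sgs ZX hbe
  nearE dsg epsom (lexx _) sumB intB s30 s20 s40 (ltW d0) (ltW om0) ka0 g40.
move: P7 P0; set P := 2 * s + 4 * s + _ => P7 P0 /= chain.
move=> i t iN t1 t2.
have [|||c' [c'0 c'1 ct hU]] := chain _ i iN (lam eps t).
- apply: le_trans sM; apply: chain_budget => //; first exact: ltW.
  + by rewrite mulr_ge0// ltW.
  + by apply: le_trans dW (le_trans omW _); rewrite ler_pdivrMr// mul1r (le_trans s1)// ler1n.
  + have : eps * (W * (W + B') + 1) <= s by rewrite -ler_pdivlMr.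
    by rewrite mulrDr mulr1; apply: le_trans; rewrite lerDl ltW.
- by apply: lmono => //; have [] := ui i (ltnW iN).
- by apply: linc => //; apply: le_trans t1; have [] := ui i (ltnW iN).
exists c'; split=> //.
have q1 := ZX i iN.
have -> : xeps eps (lam eps t) - X i - c' *: n i = (xeps eps (lam eps t) - Z i - c' *: n i) + (Z i - X i).
  by rewrite [RHS]addrAC addrA subrK.
apply: le_trans (ler_normD _ _) _; lra.
Qed.

(** The resolvent collapses the segment from X i to X i + n i onto X i up to a small error,
    uniformly in the relaxation parameter. This is why J1 convergence concerns the resolvent
    path. *)
Lemma resolvent_path_approx T w : 0 < T -> 0 < w -> exists2 e0 : R, 0 < e0 &
  forall eps, 0 < eps -> eps <= e0 -> forall t, 0 <= t -> t <= T ->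
  `|resolvent A eps (xeps eps (lam eps t)) - x t| <= w.
Proof.
move=> T0 w0.
have T10 : 0 < T + 1 by lra.
have w30 : 0 < w / 3 by rewrite divr_gt0.
have [N [u [X [n [pu _ XK _ [hx [e1 e10 h1]]]]]]] := yosida_approx 0 T10 w30.
have [|e2 e20 h2] := @eventually_all R N (fun i e => forall c, 0 <= c -> c <= 1 ->
    `|resolvent A e (X i + c *: n i) - X i| <= w / 3).
  move=> i iN; have [XiK nX] := XK i (ltnW iN).
  have [e0 e00 he] := resolvent_normal_ray hip hA dom_neq0 XiK nX w30.
  by exists e0 => // e e_gt0 ee0 c' c'0 c'1; exact: he.
exists (Num.min e1 e2); first by rewrite lt_min e10.
move=> eps eps0; rewrite le_min => /andP[l1 l2] t t0 tT.
have tT1 : t < T + 1 by lra.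
have [i iN [ti tj]] := partition_locate pu t0 tT1.
have [c' [c'0 c'1 _ hU]] := h1 eps eps0 l1 i t iN ti tj.
have q1 := hx i t iN ti tj.
have q2 := h2 eps eps0 l2 i iN c' c'0 c'1.
have := resolvent_nonexp hip hA dom_neq0 (xeps eps (lam eps t)) (X i + c' *: n i) eps0.
rewrite opprD addrA.
have := ler_distD (resolvent A eps (X i + c' *: n i)) (resolvent A eps (xeps eps (lam eps t))) (x t).
have := ler_distD (X i) (resolvent A eps (X i + c' *: n i)) (x t).
rewrite (distrC (X i)); lra.
Qed.

(** The left limit of [x] is in the closed domain, where the projection is the identity. *)
Lemma sp_jump0 t : 0 <= t -> jump m t = 0 -> jump x t = 0.
Proof.
move=> t0 jm; have := sp_jump SP t0; rewrite jm addr0 /Pi /K (projection_id hip hA dom_neq0).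
  by rewrite /jump => <-; rewrite subrr.
move: t0; rewrite le_eqVlt => /predU1P[<-|t0].
  by rewrite leftlim0; exact: (sp_domain SP).
apply: (closed_cvg _ (@closed_closure _ (dom A)) _ _ (leftlim_cvg (sp_cadlag_x SP) t0)).
rewrite near_withinE; exists t => //= s; rewrite /ball_ /= => st lt.
apply: (sp_domain SP); move: st; rewrite gtr0_norm ?subr_gt0//; lra.
Qed.

Lemma yosida_pointwise t : 0 <= t -> jump m t = 0 -> xeps eps t @[eps --> 0^'+] --> x t.
Proof.
move=> t0 jm; apply/cvgrPdist_le => w w_gt0.
pose g := w / 8; have g0 : 0 < g by rewrite divr_gt0.
have T0 : 0 < t + 1 by lra.
have [N [u [X [n [pu tsP XK nP [hx [e1 e10 h1]]]]]]] := yosida_approx t T0 g0.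
have tT1 : t < t + 1 by lra.
have [i iN [ti tj]] := partition_locate pu t0 tT1.
have ut : u i = t.
  apply/eqP; rewrite eq_le ti leNgt /=; apply/negP => lt.
  by apply: (tsP i iN).
have n0 : n i = 0 by apply: nP; rewrite ?ut// ltnW.
have [u0 uN us] := pu.
have [h h0 hmesh] := partition_mesh pu.
have [d d0 hd] : exists2 d, 0 < d & forall s, 0 <= s -> s < t -> t - d < s -> `|x s - x t| <= g.
  have := t0; rewrite le_eqVlt => /predU1P[<-|t_gt0].
    by exists 1 => // s s0; rewrite ltNge s0.
  have [d d0 hd] := cadlag_left (sp_cadlag_x SP) t_gt0 g0.
  exists d => // s s0 st ds; have := hd s ds st.
  by have /eqP := sp_jump0 t0 jm; rewrite /jump subr_eq0 => /eqP <-.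
pose W := \sum_(0 <= j < N) `|n j|.
have W0 : 0 <= W by exact: sumr_ge0.
have nW j : (j < N)%N -> `|n j| <= W.
  move=> jN; rewrite /W big_mkord (bigD1 (Ordinal jN))//= lerDl.
  by apply: sumr_ge0.
have W1 : 0 < 2 * (W + 1) by lra.
have dl0 : 0 < Num.min (h / 2) (d / 2) by rewrite lt_min !divr_gt0.
have [e2 e20 h2] := near 0 dl0.
(* With c' h / 2 <= eps this bound gives c' (W + 1) <= g, so that |c' n j| <= g in the second case
   below. *)
have e30 : 0 < g * h / (2 * (W + 1)) by rewrite divr_gt0// mulr_gt0.
rewrite near_withinE; exists (Num.min (Num.min e1 e2) (g * h / (2 * (W + 1)))).
  by rewrite /= !lt_min e10 e20.
move=> eps /= epsb eps0.
move: epsb; rewrite sub0r normrN gtr0_norm// !lt_min => /andP[/andP[l1 l2] l3].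
have [near1 _] := h2 eps eps0 (ltW l2).
have [k0 kpos kinc [kap [kapP kapm]]] := time_change_facts (tc eps0).
have [p0 pt] := kapP t t0; set p := kap t in p0 pt.
have pd : `|t - p| <= h / 2 /\ `|t - p| <= d / 2.
  by have := near1 p p0; rewrite pt le_min => /andP[].
have hi := hmesh i iN.
have [pd1 pd2] := pd.
(* The reference time [p] may fall on either side of [t]. From [t] on, the interval is the one
   starting at the node [t], where the normal vector is 0. *)
have [tp|pt'] := leP t p.
  have pj : p < u i.+1.
    move: pd1; rewrite distrC => /(le_trans (ler_norm _)); rewrite ut in hi; lra.
  have pi : u i <= p by rewrite ut.
  have [c' [_ _ _]] := h1 eps eps0 (ltW l1) i p iN pi pj.
  rewrite n0 scaler0 subr0 pt => q1.
  have q2 := hx i t iN ti tj.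
  have := ler_distD (X i) (x t) (xeps eps t).
  rewrite (distrC (X i)) /g in q1 q2 *; lra.
(* Before [t], the preceding interval may carry a nonzero [n j], but at least h / 2 has elapsed
   since lam eps (u j), so [c'] is small. Index 0 would mean t = 0, which p < t excludes. *)
case: i => [|j] in iN ti tj ut n0 hi *.
  by move: pt'; rewrite -ut u0 ltNge p0.
have hj := hmesh j (ltnW iN).
have jp : u j <= p.
  move: pd1 => /(le_trans (ler_norm _)); rewrite ut in hj; lra.
have pj : p < u j.+1 by rewrite ut.
have [c' [c'0 c'1 ct]] := h1 eps eps0 (ltW l1) j p (ltnW iN) jp pj.
rewrite pt => q1.
have q2 := hx j p (ltnW iN) jp pj.
have q3 : `|x p - x t| <= g.
  apply: hd => //; move: pd2 => /(le_trans (ler_norm _)); lra.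
have uj0 : 0 <= u j by rewrite -u0; apply: (partition_mono pu) => //; exact/ltnW/ltnW.
have q4 : c' * (h / 2) <= eps.
  apply: le_trans ct; rewrite pt ler_wpM2l//.
  have := near1 _ uj0; rewrite le_min => /andP[/(le_trans (ler_norm _)) + _].
  rewrite ut in hj; lra.
have q5 : `|c' *: n j| <= g.
  rewrite normrZ ger0_norm//; apply: le_trans (ler_wpM2l c'0 (nW j (ltnW iN))) _.
  move: l3; rewrite ltr_pdivlMr// => l3.
  have : c' * (h / 2) * (2 * (W + 1)) <= g * h.
    by apply: le_trans (ltW l3); rewrite ler_wpM2r// ltW.
  have -> : c' * (h / 2) * (2 * (W + 1)) = c' * (W + 1) * h by field.
  rewrite ler_pM2r// mulrDr mulr1; lra.
have := ler_distD (x p) (x t) (xeps eps t).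
have := ler_distD (X j) (x p) (xeps eps t).
have := ler_normD (xeps eps t - X j - c' *: n j) (c' *: n j); rewrite subrK.
rewrite (distrC (X j) (xeps eps t)) (distrC (x t) (x p)) /g in q1 q2 q3 q5 *; lra.
Qed.

Lemma yosida_uniform T : {within `[0, +oo[, continuous m} -> 0 <= T ->
  ereal_sup [set (`|xeps eps t - x t|)%:E | t in `[0, T]] @[eps --> 0^'+] --> 0%E.
Proof.
move=> mc T0.
have jm t : 0 <= t -> jump m t = 0 by exact: continuous_jump0.
have ne : [set` `[0, T]] !=set0 by exists 0; rewrite /= in_itv /= lexx.
apply/(ereal_sup_cvg0 (g := fun eps t => `|xeps eps t - x t|) ne) => // w w_gt0.
pose g := w / 8; have g0 : 0 < g by rewrite divr_gt0.
(* The reference time of some t <= T may exceed [T] by 1 and must remain strictly inside the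
   partitioned range. *)
have T2 : 0 < T + 2 by lra.
have [N [u [X [n [pu _ XK nP [hx [e1 e10 h1]]]]]]] := yosida_approx 0 T2 g0.
have [u0 uN us] := pu.
have u00 i : (i <= N)%N -> 0 <= u i by move=> iN; rewrite -u0; exact: (partition_mono pu).
have n0 i : (i < N)%N -> n i = 0.
  by move=> iN; exact: nP (ltnW iN) (jm _ (u00 _ (ltnW iN))).
have [h h0 hmesh] := partition_mesh pu.
have osc i : (i < N)%N -> osc_le x (2 * g) (u i) (u i.+1).
  move=> iN s s' s1 s2 s3 s4; have q1 := hx i s iN s1 s2; have q2 := hx i s' iN s3 s4.
  by have := ler_distD (X i) (x s) (x s'); rewrite (distrC (X i)); lra.
(* Times closer than the mesh lie in the same interval or in two adjacent ones, and [x] does not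
   jump at the node between them. *)
have close p q : 0 <= p -> p <= q -> q < T + 2 -> q - p < h -> `|x p - x q| <= 4 * g.
  move=> p0 pq qT qh.
  have [i iN [pi pj]] := partition_locate pu p0 (le_lt_trans pq qT).
  have [qj|jq] := ltP q (u i.+1).
    have := osc i iN p q pi pj (le_trans pi pq) qj; lra.
  have iN' : (i.+1 < N)%N.
    rewrite ltn_neqAle iN andbT; apply/eqP => iE.
    by move: qT; rewrite -uN -iE ltNge jq.
  have hi := hmesh _ iN'.
  have q1 := osc_leftlim (sp_cadlag_x SP) (u00 i (ltnW iN)) (us i iN) (osc i iN) pi pj.
  have q2 : `|x (u i.+1) - x q| <= 2 * g by apply: (osc _ iN') => //; [exact: us|lra].
  have /eqP := sp_jump0 (u00 _ iN) (jm _ (u00 _ iN)).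
  rewrite /jump subr_eq0 => /eqP jx; rewrite -jx in q1.
  by have := ler_distD (x (u i.+1)) (x p) (x q); lra.
have dl0 : 0 < Num.min (h / 2) 1 by rewrite lt_min ltr01 divr_gt0.
have [e2 e20 h2] := near 0 dl0.
exists (Num.min e1 e2); first by rewrite lt_min e10.
move=> eps eps0; rewrite le_min => /andP[l1 l2] t; rewrite /= in_itv /= => /andP[t0 tT].
have [near1 _] := h2 eps eps0 l2.
have [k0 kpos kinc [kap [kapP kapm]]] := time_change_facts (tc eps0).
have [p0 pt] := kapP t t0; set p := kap t in p0 pt.
have [pd1 pd2] : `|t - p| <= h / 2 /\ `|t - p| <= 1.
  by have := near1 p p0; rewrite pt le_min => /andP[].
move: pd1 pd2; rewrite !ler_norml => /andP[a1 a2] /andP[a3 a4].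
have pT : p < T + 2 by lra.
have [i iN [pi pj]] := partition_locate pu p0 pT.
have [c' [_ _ _]] := h1 eps eps0 l1 i p iN pi pj.
rewrite n0// scaler0 subr0 pt => q1.
have q2 := hx i p iN pi pj.
have q3 : `|x p - x t| <= 4 * g.
  by have [pt'|/ltW tp] := leP p t; [|rewrite distrC]; apply: close => //; lra.
have := ler_distD (X i) (xeps eps t) (x t).
have := ler_distD (x p) (X i) (x t).
rewrite (distrC (X i) (x p)) /g in q1 q2 q3 *; lra.
Qed.

End Main.

Unset Implicit Arguments.
Set Strict Implicit.

Theorem theorem32 (R : realType) (H : completeNormedModType R)
    (ip : {dot H for idfun}) (hip : induces_norm ip) (hsep : separable H)
    (A : H -> set H) (hA : maximal_monotone ip A)
    (hint : (dom A)° !=set0)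
    (m : R -> H) (meps : R -> R -> H)
    (hm : cadlag m) (hmeps : forall eps, 0 < eps -> cadlag (meps eps))
    (hm0 : closure (dom A) (m 0))
    (xeps : R -> R -> H)
    (hxeps : forall eps, 0 < eps ->
       yosida_solution A eps (meps eps) (xeps eps))
    (x k : R -> H)
    (hxk : skorokhod_problem ip A (projection (closure (dom A))) m x k)
    (hcvg : skorokhod_cvg meps m) :
  [/\ forall t : R, 0 <= t ->
        (jump m t = 0 -> xeps eps t @[eps --> 0^'+] --> x t) /\
        (exists C eps0 : R, [/\ 0 < C, 0 < eps0 &
           forall eps, 0 < eps -> eps <= eps0 ->
             (\int[@lebesgue_measure R]_(s in `[0%R, t])
                (`|yosida A eps (xeps eps s)|)%:E <= C%:E)%E]),
      @skorokhod_cvg R (H * H)%type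
        (fun eps t => (resolvent A eps (xeps eps t), meps eps t))
        (fun t => (x t, m t)) &
      {within `[0, +oo[, continuous m} ->
        forall T : R, 0 <= T ->
          ereal_sup [set (`|xeps eps t - x t|)%:E | t in `[0, T]]
            @[eps --> 0^'+] --> 0%E].

Proof.
have [a [r [c [r0 c0 ball_a coer]]]] := interior_coercive hip hA hint.
have A_neq0 : dom A !=set0 by exact: (dom_neq0 r0 ball_a).
have cx := sp_cadlag_x hxk.
have [lam [tc lamc near]] := skorokhod_near hcvg.
split.
- move=> t t0; split.
    exact: (yosida_pointwise hip hA r0 c0 ball_a coer hm hm0 hxk hxeps tc near).
  (* The uniform bound is stated for positive horizons, whereas [t] may be 0; the integral increases
     with the horizon. *)
  have t10 : 0 < t + 1 by rewrite ltr_wpDl.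
  have [B B0 [e0 e00 hB]] := yosida_BV_uniform hip hA r0 c0 ball_a coer hm hxeps tc near t10.
  exists (B + 1), e0; split=> //; first by rewrite ltr_wpDl.
  move=> eps eps0 epse; have hU := hxeps eps eps0.
  have rc s : 0 <= s -> s < t -> yosida A eps (xeps eps z) @[z --> s^'+] --> yosida A eps (xeps eps s).
    by move=> s0 _; exact: (yosida_right hip hA A_neq0 eps0 hU).
  rewrite (bochner_norm_integral_fin t0 (yosida_bochner hU t0) rc) lee_fin.
  have tt1 : t <= t + 1 by rewrite lerDl.
  apply: le_trans (yosida_norm_mono hip hA A_neq0 eps0 hU t0 tt1) _.
  by apply: le_trans (hB eps eps0 epse) _; rewrite lerDl.
- split.
  + move=> eps eps0; apply: cadlag_pair; last exact: hmeps.
    by apply: cadlag_comp (hxeps eps eps0).1 => z z'; exact: (resolvent_nonexp hip hA A_neq0).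
  + exact: cadlag_pair.
  (* The time change of the input serves both components, and the product norm is the maximum of the
     two. *)
  exists lam; split => // T T0.
  have ne : [set` `[0, T]] !=set0 by exists 0; rewrite /= in_itv /= lexx ltW.
  apply/(ereal_sup_cvg0 (g := fun eps t => `|(resolvent A eps (xeps eps (lam eps t)), meps eps (lam eps t)) - (x t, m t)|) ne) => // w w0.
  have [e1 e10 h1] := resolvent_path_approx hip hA r0 c0 ball_a coer hm hm0 hxk hxeps tc near T0 w0.
  have [e2 e20 h2] := near T w w0.
  exists (Num.min e1 e2); first by rewrite lt_min e10.
  move=> eps eps0; rewrite le_min => /andP[l1 l2] t; rewrite /= in_itv /= => /andP[t0 tT].
  rewrite prod_normE /= ge_max h1//=.
  by have [_ h3] := h2 eps eps0 l2; exact: h3.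
- move=> mc T T0.
  exact: (yosida_uniform hip hA r0 c0 ball_a coer hm hm0 hxk hxeps tc near mc T0).
Qed.
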